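(* Let $n\ge1$, let $\mathcal{Z}=\{z_1,\dots,z_m\}\subset\mathbb{D}^n$ be $m$ distinct points and let $w_1,\dots,w_m\in\mathbb{D}$. Let $\mathcal{Q}_{\mathcal{Z}}=\operatorname{span}\{\mathbb{S}(\cdot,z_i):i=1,\dots,m\}$ and $\mathcal{M}_{\mathcal{Q}_{\mathcal{Z}}}=\mathcal{Q}_{\mathcal{Z}}^{conj}+\mathcal{M}_n+H^2_0(\mathbb{T}^n)$, regarded as a subspace of $L^1(\mathbb{T}^n)$. Define $c=(c_1,\dots,c_m)^T$ by \[ c=\big(\mathbb{S}(z_j,z_i)\big)_{j,i=1}^m{}^{-1}\,(w_1,\dots,w_m)^T \] (the matrix whose $(j,i)$ entry is $\mathbb{S}(z_j,z_i)$), and set $\psi_{\mathcal{Z},\mathcal{W}}=\sum_{i=1}^m c_i\mathbb{S}(\cdot,z_i)$. Then there exists $\varphi\in\mathcal{S}(\mathbb{D}^n)$ with $\varphi(z_i)=w_i$ for all $i=1,\dots,m$ if and only if the functional $f\mapsto\int_{\mathbb{T}^n}\psi_{\mathcal{Z},\mathcal{W}}f\,d\mu$ is a contraction on $(\mathcal{M}_{\mathcal{Q}_{\mathcal{Z}}},\|\cdot\|_1)$.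
   Context: $\mu$ is normalized Lebesgue measure on $\mathbb{T}^n$, $\|\cdot\|_1$ the $L^1(\mathbb{T}^n,\mu)$ norm. $\mathbb{S}(z,w)=\prod_{i=1}^n(1-z_i\bar w_i)^{-1}$ is the Szegő kernel of $\mathbb{D}^n$, and $\mathbb{S}(\cdot,w)$ is the function $z\mapsto\mathbb{S}(z,w)$, an element of $H^2(\mathbb{T}^n)$ (the closed subspace of $L^2(\mathbb{T}^n)$ of functions with Fourier coefficients supported in $\mathbb{Z}_+^n$, identified with analytic functions on $\mathbb{D}^n$). $\mathcal{S}(\mathbb{D}^n)$ is the closed unit ball of $H^\infty(\mathbb{D}^n)$. $S^{conj}=\{\bar f:f\in S\}$; $H^2_0(\mathbb{T}^n)=\{f\in H^2:f(0)=0\}$; $\mathcal{M}_n=L^2(\mathbb{T}^n)\ominus(H^2(\mathbb{T}^n)^{conj}+H^2(\mathbb{T}^n))$. A functional $\Lambda$ is a contraction if $|\Lambda f|\le\|f\|_1$ for all $f$. *)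

(* Defs.v *)
From HB Require Import structures.
From mathcomp Require Import all_boot all_order all_algebra.
From mathcomp Require Import all_classical all_reals all_analysis.
From mathcomp Require Import complex.
Set Implicit Arguments. Unset Strict Implicit. Unset Printing Implicit Defensive.
Import Order.TTheory GRing.Theory Num.Theory.
Local Open Scope classical_set_scope.
Local Open Scope ring_scope.

Record mprob (R : realType) := MProb {
  mp_d : measure_display; mp_T : measurableType mp_d; mp_P : probability mp_T R }.

Definition unif01 (R : realType) := uniform_prob (@ltr01 R).

Fixpoint cube (R : realType) (n : nat) : mprob R :=
  match n with
  | 0 => @MProb R _ unit (@dirac _ unit tt R)
  | S k => let c := cube R k in
      @MProb R _ (_ * mp_T c)%type (@unif01 R \x mp_P c)%E
  end.

Fixpoint cube_coord (R : realType) (n : nat) : mp_T (cube R n) -> nat -> R :=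
  match n return mp_T (cube R n) -> nat -> R with
  | 0 => fun _ _ => 0
  | S k => fun x j => match j with 0 => x.1 | S j' => cube_coord x.2 j' end
  end.

(** * The torus T^n with normalized Lebesgue (Haar) measure mu.
    T^n is parametrized by angle coordinates theta in [0,1]^n; the measure is the
    n-fold product of the uniform probability on [0,1] (i.e. normalized Lebesgue measure),
    and the point of T^n is (exp(2 pi i theta_1), ..., exp(2 pi i theta_n)). *)
Definition Tn (R : realType) (n : nat) := mp_T (cube R n).
Definition torus_mu (R : realType) (n : nat) : probability (Tn R n) R := mp_P (cube R n).

Notation normc := (@Normc.normc _).

Definition torus_pt (R : realType) (n : nat) (x : Tn R n) : 'I_n -> R[i] :=
  fun k => @Complex R (cos (2 * pi * cube_coord x k)) (sin (2 * pi * cube_coord x k)).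

Definition cmeasurable (R : realType) (n : nat) (f : Tn R n -> R[i]) :=
  measurable_fun setT (fun x => complex.Re (f x)) /\
  measurable_fun setT (fun x => complex.Im (f x)).

Definition cint (R : realType) (n : nat) (f : Tn R n -> R[i]) : R[i] :=
  @Complex R (Rintegral (torus_mu R n) setT (fun x => complex.Re (f x)))
             (Rintegral (torus_mu R n) setT (fun x => complex.Im (f x))).

Definition L1norm (R : realType) (n : nat) (f : Tn R n -> R[i]) : \bar R :=
  (\int[torus_mu R n]_x (normc (f x))%:E)%E.

Definition L2 (R : realType) (n : nat) (f : Tn R n -> R[i]) :=
  cmeasurable f /\ (\int[torus_mu R n]_x ((normc (f x)) ^+ 2)%:E < +oo)%E.

Definition inner (R : realType) (n : nat) (f g : Tn R n -> R[i]) : R[i] :=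
  cint (fun x => f x * conjc (g x)).

Definition character (R : realType) (n : nat) (k : 'I_n -> int) (x : Tn R n) : R[i] :=
  \prod_(j < n) (torus_pt x j) ^ (k j).

Definition fourier_coef (R : realType) (n : nat) (f : Tn R n -> R[i]) (k : 'I_n -> int) :=
  inner f (character k).

Definition H2 (R : realType) (n : nat) (f : Tn R n -> R[i]) :=
  L2 f /\ forall k : 'I_n -> int, (exists j, k j < 0) -> fourier_coef f k = 0.

(** H^2_0: f in H^2 with f(0) = 0; the value at 0 of the analytic extension
    sum_k fhat(k) z^k of f is its 0-th Fourier coefficient *)
Definition H2_0 (R : realType) (n : nat) (f : Tn R n -> R[i]) :=
  H2 f /\ fourier_coef f (fun _ => 0) = 0.

Definition Mn (R : realType) (n : nat) (f : Tn R n -> R[i]) :=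
  L2 f /\ forall g h, H2 g -> H2 h -> inner f (fun x => conjc (g x) + h x) = 0.

Definition polydisc (R : realType) (n : nat) (z : 'I_n -> R[i]) :=
  forall k, normc (z k) < 1.

Definition szego (R : realType) (n : nat) (z w : 'I_n -> R[i]) : R[i] :=
  \prod_(k < n) (1 - z k * conjc (w k))^-1.

Definition holomorphic_polydisc (R : realType) (n : nat) (phi : ('I_n -> R[i]) -> R[i]) :=
  forall z, polydisc z ->
  exists d : 'I_n -> R[i], forall e : R, 0 < e -> exists2 delta : R, 0 < delta &
    forall h : 'I_n -> R[i], (forall k, normc (h k) < delta) ->
      normc (phi (fun k => z k + h k) - phi z - \sum_(k < n) d k * h k)
        <= e * \big[Num.max/0]_(k < n) normc (h k).

Definition schur_class (R : realType) (n : nat) (phi : ('I_n -> R[i]) -> R[i]) :=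
  holomorphic_polydisc phi /\ forall z, polydisc z -> normc (phi z) <= 1.

Definition MQ (R : realType) (n m : nat) (z : 'I_m -> 'I_n -> R[i]) (f : Tn R n -> R[i]) :=
  exists (a : 'I_m -> R[i]) (g h : Tn R n -> R[i]),
    [/\ Mn g, H2_0 h &
      forall x, f x = conjc (\sum_(i < m) a i * szego (torus_pt x) (z i)) + g x + h x].

Definition szego_gram (R : realType) (n m : nat) (z : 'I_m -> 'I_n -> R[i]) : 'M[R[i]]_m :=
  \matrix_(j < m, i < m) szego (z j) (z i).

Definition interp_c (R : realType) (n m : nat) (z : 'I_m -> 'I_n -> R[i]) (w : 'I_m -> R[i])
  : 'cV[R[i]]_m := invmx (szego_gram z) *m \col_(i < m) w i.

Definition psiZW (R : realType) (n m : nat) (z : 'I_m -> 'I_n -> R[i]) (w : 'I_m -> R[i])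
  (x : Tn R n) : R[i] :=
  \sum_(i < m) interp_c z w i 0 * szego (torus_pt x) (z i).

Definition contraction_on (R : realType) (n : nat) (S : (Tn R n -> R[i]) -> Prop)
  (Lam : (Tn R n -> R[i]) -> R[i]) :=
  forall f, S f -> ((normc (Lam f))%:E <= L1norm f)%E.

(* Main.v *)
(** If [phi] is a Schur function with [phi (z i) = w i], write an element of
    [MQ z] as [f = conj(sum_i a_i S(., z_i)) + g + h].  Orthogonality and the
    reproducing property of the Szego kernel give
    [int psi f = sum_i conj(a_i) w_i].  Cauchy's formula on the polydisc and
    Fubini's theorem give
    [int phi(r^2 x) f(x) dx = sum_i conj(a_i) phi(r^2 z_i)] for [0 < r < 1], and
    the left-hand side is at most [||f||_1] in modulus; let [r] tend to [1].

    Conversely, extend the functional from [MQ z] to [L^2] by Hahn-Banach, keeping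
    the bound by the [L^1] norm, to some [L], and put [phi(v) = L(conj S(., v))].
    This is holomorphic because [v |-> conj S(., v)] has a Taylor expansion of
    order one that is uniform on the torus.  The Poisson kernel [P_v] differs from
    [conj S(., v)] by an element of [MQ z] annihilated by the functional, so
    [|phi(v)| = |L(P_v)| <= ||P_v||_1 = 1].

    The complex derivative of a holomorphic function is not assumed continuous.
    Cauchy's formula on the circle therefore rests on Goursat's bisection argument,
    applied to the pullback of [F(z) dz / (z - w)] under the homotopy
    [w + tau(s) (e^(2 pi i u) - w)] that contracts the circle to [w]. *)

Require Import Defs.
From HB Require Import structures.
From mathcomp Require Import all_boot all_order all_algebra.
From mathcomp Require Import all_classical all_reals all_analysis.
From mathcomp Require Import complex.
From mathcomp Require Import measurable_realfun ring lra.
Set Implicit Arguments. Unset Strict Implicit. Unset Printing Implicit Defensive.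
Import Order.TTheory GRing.Theory Num.Theory.
Import numFieldNormedType.Exports.
Local Open Scope classical_set_scope.
Local Open Scope ring_scope.
Local Notation cRe := complex.Re.
Local Notation cIm := complex.Im.

(** * The complex modulus *)

Section complex_modulus.
Variable R : realType.
Implicit Types (a b : R[i]) (r : R).

Lemma cReD a b : cRe (a + b) = cRe a + cRe b. Proof. by case: a b => [? ?] []. Qed.
Lemma cImD a b : cIm (a + b) = cIm a + cIm b. Proof. by case: a b => [? ?] []. Qed.
Lemma cReN a : cRe (- a) = - cRe a. Proof. by case: a. Qed.
Lemma cImN a : cIm (- a) = - cIm a. Proof. by case: a. Qed.
Lemma cReM a b : cRe (a * b) = cRe a * cRe b - cIm a * cIm b.
Proof. by case: a b => [? ?] []. Qed.
Lemma cImM a b : cIm (a * b) = cRe a * cIm b + cIm a * cRe b.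
Proof. by case: a b => [? ?] []. Qed.
Lemma cReJ a : cRe (conjc a) = cRe a. Proof. by case: a. Qed.
Lemma cImJ a : cIm (conjc a) = - cIm a. Proof. by case: a. Qed.

Lemma complexP a b : cRe a = cRe b -> cIm a = cIm b -> a = b.
Proof. by case: a b => [? ?] [? ?] /= -> ->. Qed.

Lemma normc_sqrtE a : normc a = Num.sqrt (cRe a ^+ 2 + cIm a ^+ 2).
Proof. by case: a. Qed.

Lemma normc_ge0 a : 0 <= normc a. Proof. exact: (@normr_ge0 R (Rcomplex R)). Qed.

Lemma normc_eq0 a : (normc a == 0) = (a == 0).
Proof. exact: (@normr_eq0 R (Rcomplex R)). Qed.

Lemma normc_sqr a : normc a ^+ 2 = cRe a ^+ 2 + cIm a ^+ 2.
Proof. by rewrite normc_sqrtE sqr_sqrtr // addr_ge0 ?sqr_ge0. Qed.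

Lemma normc_sqr_mulJ a : (normc a ^+ 2)%:C%C = a * conjc a.
Proof. by apply: complexP; rewrite ?cReM ?cImM /= ?cReJ ?cImJ ?normc_sqr; ring. Qed.

Lemma normcJ a : normc (conjc a) = normc a.
Proof. by rewrite !normc_sqrtE cReJ cImJ sqrrN. Qed.

Lemma normc_real r : normc r%:C%C = `|r|.
Proof. by rewrite normc_sqrtE /= expr0n addr0 sqrtr_sqr. Qed.

Lemma normcX a k : normc (a ^+ k) = normc a ^+ k.
Proof.
by elim: k => [|k IH]; rewrite ?expr0 ?Normc.normc1// !exprS Normc.normcM IH.
Qed.

Lemma normc_prod (I : finType) (F : I -> R[i]) :
  normc (\prod_i F i) = \prod_i normc (F i).
Proof. exact: (big_morph _ (@Normc.normcM R) (Normc.normc1 R)). Qed.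

Lemma ler_normc_sum (I : finType) (F : I -> R[i]) :
  normc (\sum_i F i) <= \sum_i normc (F i).
Proof. exact: (@ler_norm_sum R (Rcomplex R)). Qed.

Lemma normc_distC a b : normc (a - b) = normc (b - a).
Proof. exact: (@distrC R (Rcomplex R)). Qed.

Lemma lerB_normc a b : normc a - normc b <= normc (a - b).
Proof. exact: (@lerB_dist R (Rcomplex R)). Qed.

Lemma ler_normB_normc a b : normc (a - b) <= normc a + normc b.
Proof. exact: (@ler_normB R (Rcomplex R)). Qed.

Lemma ler_norm_Re a : `|cRe a| <= normc a.
Proof.
by rewrite normc_sqrtE -sqrtr_sqr ler_sqrt ?lerDl ?addr_ge0 ?sqr_ge0.
Qed.

Lemma ler_norm_Im a : `|cIm a| <= normc a.
Proof.
by rewrite normc_sqrtE -sqrtr_sqr ler_sqrt ?lerDr ?addr_ge0 ?sqr_ge0.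
Qed.

Lemma ler_normc_ReIm a : normc a <= `|cRe a| + `|cIm a|.
Proof.
rewrite normc_sqrtE -[leRHS]ger0_norm ?addr_ge0// -sqrtr_sqr ler_sqrt ?sqr_ge0//.
rewrite sqrrD !real_normK ?num_real// lerD2r lerDl.
by rewrite mulrn_wge0 // mulr_ge0.
Qed.

Lemma conjc_inv1B a b : conjc (1 - a * b)^-1 = (1 - conjc a * conjc b)^-1.
Proof. by rewrite conjc_inv rmorphB rmorph1 rmorphM. Qed.

Lemma normc_phase a : exists2 u : R[i], normc u = 1 & u * a = (normc a)%:C%C.
Proof.
have [->|a0] := eqVneq a 0.
  by exists 1; rewrite ?Normc.normc1 // Normc.normc0 mulr0.
have n0 : normc a != 0 by rewrite normc_eq0.
exists ((normc a)^-1%:C%C * conjc a).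
  by rewrite Normc.normcM normc_real normcJ ger0_norm ?invr_ge0 ?normc_ge0// mulVf.
rewrite -mulrA (mulrC _ a) -normc_sqr_mulJ -rmorphM /=; congr (_%:C)%C.
by rewrite expr2 mulKf.
Qed.

Lemma invc_unit a : normc a = 1 -> a^-1 = conjc a.
Proof.
move=> a1; have a0 : a != 0 by rewrite -normc_eq0 a1 oner_eq0.
by apply: (mulfI a0); rewrite divff// -normc_sqr_mulJ a1 expr1n.
Qed.

Lemma geometric_recursion_eq0 (u : nat -> R[i]) (c : R[i]) (M : R) : normc c < 1 ->
  (forall l, u l = c * u l.+1) -> (forall l, normc (u l) <= M) -> u 0%N = 0.
Proof.
move=> c1 uS uM; apply/eqP; rewrite -normc_eq0 eq_le normc_ge0 andbT.
have u0 l : u 0%N = c ^+ l * u l.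
  by elim: l => [|l IH]; rewrite ?expr0 ?mul1r// IH uS mulrA -exprSr.
have cv : (fun l : nat => normc c ^+ l * M) @ \oo --> (0 : R).
  rewrite -(mul0r M); apply: cvgMl; apply: cvg_expr.
  by rewrite ger0_norm ?normc_ge0.
apply: (ler_cvg_to (cvg_cst (normc (u 0%N))) cv); apply: nearW => l.
by rewrite {1}(u0 l) Normc.normcM normcX ler_wpM2l ?exprn_ge0 ?normc_ge0.
Qed.

End complex_modulus.

HB.instance Definition _ (R : realType) := NormedModule.copy R[i] R[i]^o.

Section complex_topology.
Variable R : realType.
Implicit Types (T : Type) (l : R[i]).

Lemma complex_normE l : `|l| = (normc l)%:C%C.
Proof. by rewrite normc_def; case: l. Qed.

Lemma near_normc l (P : set R[i]) : (\forall b \near l, P b) ->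
  exists2 delta : R, 0 < delta & forall b, normc (b - l) < delta -> P b.
Proof.
move=> /nbhs_normP[e /=]; rewrite ltcE => /andP[/eqP e_real e0] h.
exists (cRe e) => // b hb; apply: h.
by rewrite /= distrC complex_normE ltcE /= e_real eqxx.
Qed.

Lemma cvgc_normcP T (F : set_system T) (FF : Filter F) (f : T -> R[i]) l :
  f x @[x --> F] --> l <->
  forall e : R, 0 < e -> \forall x \near F, normc (l - f x) < e.
Proof.
split=> [/cvgrPdist_lt h e e0|h].
  have /h : 0 < e%:C%C :> R[i] by rewrite ltcR.
  by apply: filterS => x /=; rewrite complex_normE ltcR.
apply/cvgrPdist_lt => e; rewrite ltcE => /andP[/eqP e_real /h].
by apply: filterS => x hx; rewrite complex_normE ltcE /= e_real eqxx.
Qed.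

Lemma cvgc_ReImP T (F : set_system T) (FF : Filter F) (f : T -> R[i]) l :
  f x @[x --> F] --> l <->
  cRe (f x) @[x --> F] --> cRe l /\ cIm (f x) @[x --> F] --> cIm l.
Proof.
split=> [/cvgc_normcP h|[/cvgrPdist_lt cvRe /cvgrPdist_lt cvIm]].
  split; apply/cvgrPdist_lt => e /h; apply: filterS => x; apply: le_lt_trans.
    by rewrite -cReN -cReD ler_norm_Re.
  by rewrite -cImN -cImD ler_norm_Im.
apply/cvgc_normcP => e e0; have e2 : 0 < e / 2 by rewrite divr_gt0.
apply: filterS2 (cvRe _ e2) (cvIm _ e2) => x Re_lt Im_lt.
rewrite (le_lt_trans (ler_normc_ReIm _))// cReD cReN cImD cImN (splitr e).
exact: ltrD.
Qed.

Lemma normc_lim_le T (F : set_system T) (FF : ProperFilter F) (f : T -> R[i]) l (C : R) :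
  f x @[x --> F] --> l -> (\forall x \near F, normc (f x) <= C) -> normc l <= C.
Proof.
move=> /cvgc_normcP fl fC; apply/ler_addgt0Pr => e e0.
have [x [fx_near fx_le]] := filter_ex (filterI (fl e e0) fC).
by rewrite addrC -(subrK (f x) l) (le_trans (le_normcD _ _))// lerD// ltW.
Qed.

Lemma cvg_conjc T (F : set_system T) (FF : Filter F) (f : T -> R[i]) l :
  f x @[x --> F] --> l -> conjc (f x) @[x --> F] --> conjc l.
Proof.
move=> /cvgc_normcP fl; apply/cvgc_normcP => e /fl; apply: filterS => x.
by rewrite -rmorphB normcJ.
Qed.

Lemma cvg_real_complex T (F : set_system T) (FF : Filter F) (f : T -> R) (r : R) :
  f x @[x --> F] --> r -> (f x)%:C%C @[x --> F] --> r%:C%C.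
Proof. by move=> fr; apply/cvgc_ReImP; split => //; exact: cvg_cst. Qed.

End complex_topology.

(** * Integration of complex-valued functions *)

Section complex_measurable.
Context (d : measure_display) (T : measurableType d) (R : realType).
Implicit Types (D : set T) (f g : T -> R[i]).

Definition cmeas D f :=
  measurable_fun D (fun x => cRe (f x)) /\ measurable_fun D (fun x => cIm (f x)).

Lemma cmeas_cst D c : cmeas D (fun=> c).
Proof. by split; exact: measurable_cst. Qed.

Lemma cmeasD D f g : cmeas D f -> cmeas D g -> cmeas D (fun x => f x + g x).
Proof.
move=> [fRe fIm] [gRe gIm]; split.
  by under eq_fun do rewrite cReD; exact: measurable_funD.
by under eq_fun do rewrite cImD; exact: measurable_funD.
Qed.

Lemma cmeasM D f g : cmeas D f -> cmeas D g -> cmeas D (fun x => f x * g x).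
Proof.
move=> [fRe fIm] [gRe gIm]; split.
  by under eq_fun do rewrite cReM; apply: measurable_funB; exact: measurable_funM.
by under eq_fun do rewrite cImM; apply: measurable_funD; exact: measurable_funM.
Qed.

Lemma cmeasJ D f : cmeas D f -> cmeas D (fun x => conjc (f x)).
Proof.
move=> [fRe fIm]; split; first by under eq_fun do rewrite cReJ.
by under eq_fun do rewrite cImJ; exact: measurableT_comp.
Qed.

Lemma cmeasN D f : cmeas D f -> cmeas D (fun x => - f x).
Proof.
move=> mf; under eq_fun do rewrite -mulN1r.
by apply: cmeasM => //; exact: cmeas_cst.
Qed.

Lemma cmeasB D f g : cmeas D f -> cmeas D g -> cmeas D (fun x => f x - g x).
Proof. by move=> mf mg; apply: cmeasD => //; exact: cmeasN. Qed.

Lemma cmeas_sum D (I : Type) (s : seq I) (F : I -> T -> R[i]) :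
  (forall i, cmeas D (F i)) -> cmeas D (fun x => \sum_(i <- s) F i x).
Proof.
move=> mF; elim: s => [|i s IH].
  by under eq_fun do rewrite big_nil; exact: cmeas_cst.
by under eq_fun do rewrite big_cons; exact: cmeasD.
Qed.

Lemma cmeas_prod D (I : Type) (s : seq I) (F : I -> T -> R[i]) :
  (forall i, cmeas D (F i)) -> cmeas D (fun x => \prod_(i <- s) F i x).
Proof.
move=> mF; elim: s => [|i s IH].
  by under eq_fun do rewrite big_nil; exact: cmeas_cst.
by under eq_fun do rewrite big_cons; exact: cmeasM.
Qed.

Lemma cmeasX D f k : cmeas D f -> cmeas D (fun x => f x ^+ k).
Proof.
move=> mf; elim: k => [|k IH]; first by under eq_fun do rewrite expr0; exact: cmeas_cst.
by under eq_fun do rewrite exprS; exact: cmeasM.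
Qed.

Lemma cmeas_normc D f : cmeas D f -> measurable_fun D (fun x => normc (f x)).
Proof.
move=> [fRe fIm]; under eq_fun do rewrite normc_sqrtE.
apply: measurableT_comp.
  by apply: continuous_measurable_fun => x; exact: sqrt_continuous.
by apply: measurable_funD; exact: measurable_funX.
Qed.

(* [y / (y ^+ 2 + 1 / k)] tends to [y^-1] also at [y = 0], where [0^-1 = 0]. *)
Lemma measurable_funV D (f : T -> R) :
  measurable_fun D f -> measurable_fun D (fun x => (f x)^-1).
Proof.
move=> mf; apply: (@measurableT_comp _ _ _ _ _ _ (fun y : R => y^-1)) => //.
apply: (@measurable_fun_cvg _ _ _ _
  (fun k (y : R) => y * (y ^+ 2 + k.+1%:R^-1)^-1)) => [k|y _].
  apply: continuous_measurable_fun => y; apply: cvgM; first exact: cvg_id.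
  apply: cvgV; last by apply: cvgD; [exact: exprn_continuous|exact: cvg_cst].
  by rewrite gt_eqF// ltr_wpDl ?sqr_ge0// invr_gt0.
have [->|y0] := eqVneq y 0.
  by under eq_fun do rewrite mul0r; rewrite invr0; exact: cvg_cst.
have -> : y^-1 = y * (y ^+ 2 + 0)^-1 by rewrite addr0 expr2 invfM mulrA divff// mul1r.
apply: cvgM; first exact: cvg_cst.
apply: cvgV; first by rewrite addr0 expf_neq0.
by apply: cvgD; [exact: cvg_cst|exact: cvg_harmonic].
Qed.

Lemma cmeasV D f : cmeas D f -> cmeas D (fun x => (f x)^-1).
Proof.
move=> [fRe fIm].
have mV : measurable_fun D (fun x => (cRe (f x) ^+ 2 + cIm (f x) ^+ 2)^-1).
  by apply: measurable_funV; apply: measurable_funD; exact: measurable_funX.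
split.
  by apply: eq_measurable_fun (measurable_funM fRe mV) => x _ /=; case: (f x).
apply: eq_measurable_fun (measurable_funN (measurable_funM fIm mV)) => x _ /=.
by case: (f x).
Qed.

End complex_measurable.

Lemma cmeas_comp (d d' : measure_display) (T : measurableType d)
    (U : measurableType d') (R : realType) (f : T -> R[i]) (h : U -> T) :
  cmeas setT f -> measurable_fun setT h -> cmeas setT (fun x => f (h x)).
Proof.
by move=> [fRe fIm] mh; split; [exact: measurableT_comp fRe mh|exact: measurableT_comp fIm mh].
Qed.

Section complex_integral.
Context (d : measure_display) (T : measurableType d) (R : realType).
Variable mu : {measure set T -> \bar R}.
Implicit Types (D : set T) (f g : T -> R[i]).

Definition cintegrable D f :=
  mu.-integrable D (fun x => (cRe (f x))%:E) /\
  mu.-integrable D (fun x => (cIm (f x))%:E).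

Definition cintegral D f : R[i] :=
  Complex (\int[mu]_(x in D) cRe (f x)) (\int[mu]_(x in D) cIm (f x)).

Lemma eq_cintegral D f g : {in D, f =1 g} -> cintegral D f = cintegral D g.
Proof. by move=> fg; congr Complex; apply: eq_Rintegral => x xD; rewrite fg. Qed.

Lemma cintegrable_cmeas D f : cintegrable D f -> cmeas D f.
Proof.
by move=> [/integrableP[/measurable_EFinP ? _] /integrableP[/measurable_EFinP ? _]].
Qed.

Lemma cintegrable_le D f (g : T -> R) : measurable D -> cmeas D f ->
  mu.-integrable D (EFin \o g) -> (forall x, D x -> normc (f x) <= g x) ->
  cintegrable D f.
Proof.
move=> mD [fRe fIm] ig fg; split; apply: (le_integrable mD _ _ ig).
- exact/measurable_EFinP.
- move=> x Dx; rewrite lee_fin (le_trans (ler_norm_Re _))//.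
  by rewrite (le_trans (fg _ Dx))// ler_norm.
- exact/measurable_EFinP.
- move=> x Dx; rewrite lee_fin (le_trans (ler_norm_Im _))//.
  by rewrite (le_trans (fg _ Dx))// ler_norm.
Qed.

Lemma integrable_normc D f : measurable D -> cintegrable D f ->
  mu.-integrable D (fun x => (normc (f x))%:E).
Proof.
move=> mD fi; have [fRe fIm] := fi.
have ig : mu.-integrable D (fun x => (`|cRe (f x)| + `|cIm (f x)|)%:E).
  apply: (eq_integrable mD) (integrableD mD (integrable_abse fRe) (integrable_abse fIm)).
  by move=> x _ /=; rewrite EFinD.
apply: (le_integrable mD _ _ ig).
  by apply/measurable_EFinP/cmeas_normc; exact: cintegrable_cmeas.
move=> x _; rewrite lee_fin ger0_norm ?normc_ge0//.
by rewrite (le_trans (ler_normc_ReIm _))// ler_norm.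
Qed.

Lemma cintegrableD D f g : measurable D ->
  cintegrable D f -> cintegrable D g -> cintegrable D (fun x => f x + g x).
Proof.
move=> mD [fRe fIm] [gRe gIm]; split.
  by apply: (eq_integrable mD) (integrableD mD fRe gRe) => x _ /=; rewrite cReD EFinD.
by apply: (eq_integrable mD) (integrableD mD fIm gIm) => x _ /=; rewrite cImD EFinD.
Qed.

Lemma cintegrable_boundedM D f g (M : R) : measurable D ->
  cmeas D f -> (forall x, D x -> normc (f x) <= M) -> cintegrable D g ->
  cintegrable D (fun x => f x * g x).
Proof.
move=> mD mf fM gi; have ig := integrable_normc mD gi.
have ig' : mu.-integrable D (EFin \o (fun x => M * normc (g x))).
  by apply: (eq_integrable mD) (integrableZl mD M ig) => x _ /=; rewrite EFinM.
apply: (cintegrable_le mD _ ig').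
  by apply: cmeasM => //; exact: cintegrable_cmeas gi.
by move=> x Dx; rewrite Normc.normcM ler_wpM2r ?normc_ge0// fM.
Qed.

Lemma cintegrableZ D c f : measurable D ->
  cintegrable D f -> cintegrable D (fun x => c * f x).
Proof. by move=> mD; apply: (cintegrable_boundedM mD (cmeas_cst D c) (M := normc c)). Qed.

Lemma cintegrableN D f : measurable D ->
  cintegrable D f -> cintegrable D (fun x => - f x).
Proof. by move=> mD fi; under eq_fun do rewrite -mulN1r; exact: cintegrableZ. Qed.

Lemma cintegrableB D f g : measurable D ->
  cintegrable D f -> cintegrable D g -> cintegrable D (fun x => f x - g x).
Proof. by move=> mD fi gi; apply: cintegrableD => //; exact: cintegrableN. Qed.

Lemma cintegrableJ D f : measurable D ->
  cintegrable D f -> cintegrable D (fun x => conjc (f x)).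
Proof.
move=> mD fi; apply: (cintegrable_le mD _ (integrable_normc mD fi)).
  by apply: cmeasJ; exact: cintegrable_cmeas.
by move=> x _; rewrite normcJ.
Qed.

Lemma cintegrable0 D : cintegrable D (fun=> 0).
Proof. by split; exact: integrable0. Qed.

Lemma cintegrable_sum D (I : Type) (s : seq I) (F : I -> T -> R[i]) : measurable D ->
  (forall i, cintegrable D (F i)) -> cintegrable D (fun x => \sum_(i <- s) F i x).
Proof.
move=> mD iF; elim: s => [|i s IH].
  by under eq_fun do rewrite big_nil; exact: cintegrable0.
by under eq_fun do rewrite big_cons; exact: cintegrableD.
Qed.

Lemma cintegralD D f g : measurable D -> cintegrable D f -> cintegrable D g ->
  cintegral D (fun x => f x + g x) = cintegral D f + cintegral D g.
Proof.
move=> mD [fRe fIm] [gRe gIm]; apply: complexP; rewrite ?cReD ?cImD /= -RintegralD//;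
by apply: eq_Rintegral => x _; rewrite ?cReD ?cImD.
Qed.

Lemma cintegralZ D c f : measurable D -> cintegrable D f ->
  cintegral D (fun x => c * f x) = c * cintegral D f.
Proof.
move=> mD [fRe fIm].
have iRe r : mu.-integrable D (EFin \o (fun x => r * cRe (f x))).
  by apply: (eq_integrable mD) (integrableZl mD r fRe) => x _ /=; rewrite EFinM.
have iIm r : mu.-integrable D (EFin \o (fun x => r * cIm (f x))).
  by apply: (eq_integrable mD) (integrableZl mD r fIm) => x _ /=; rewrite EFinM.
have ZRe r := RintegralZl r mD fRe; have ZIm r := RintegralZl r mD fIm.
apply: complexP; rewrite ?cReM ?cImM /= -ZRe -ZIm.
  by rewrite -RintegralB//; apply: eq_Rintegral => x _; rewrite cReM.
by rewrite -RintegralD//; apply: eq_Rintegral => x _; rewrite cImM.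
Qed.

Lemma cintegralN D f : measurable D -> cintegrable D f ->
  cintegral D (fun x => - f x) = - cintegral D f.
Proof.
move=> mD fi; rewrite -mulN1r -cintegralZ//.
by apply: eq_cintegral => x _; rewrite mulN1r.
Qed.

Lemma cintegralB D f g : measurable D -> cintegrable D f -> cintegrable D g ->
  cintegral D (fun x => f x - g x) = cintegral D f - cintegral D g.
Proof.
by move=> mD fi gi; rewrite cintegralD ?cintegralN//; exact: cintegrableN.
Qed.

Lemma cintegral0 D : cintegral D (fun=> 0) = 0.
Proof. by congr Complex; rewrite /Rintegral integral0. Qed.

Lemma cintegral_sum D (I : Type) (s : seq I) (F : I -> T -> R[i]) : measurable D ->
  (forall i, cintegrable D (F i)) ->
  cintegral D (fun x => \sum_(i <- s) F i x) = \sum_(i <- s) cintegral D (F i).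
Proof.
move=> mD iF; elim: s => [|i s IH].
  by rewrite big_nil; under eq_fun do rewrite big_nil; exact: cintegral0.
rewrite big_cons -IH -cintegralD//; last exact: cintegrable_sum.
by under eq_fun do rewrite big_cons.
Qed.

Lemma cintegralJ D f : measurable D -> cintegrable D f ->
  cintegral D (fun x => conjc (f x)) = conjc (cintegral D f).
Proof.
move=> mD [_ fIm].
congr Complex; first by apply: eq_Rintegral => x _; rewrite cReJ.
rewrite -mulN1r -RintegralZl//.
by apply: eq_Rintegral => x _; rewrite cImJ mulN1r.
Qed.

Lemma normc_cintegral D f : measurable D -> cintegrable D f ->
  normc (cintegral D f) <= \int[mu]_(x in D) normc (f x).
Proof.
move=> mD fi; have [u u1 uI] := normc_phase (cintegral D f).
have -> : normc (cintegral D f) = cRe (cintegral D (fun x => u * f x)).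
  by rewrite cintegralZ// uI.
have [ui _] := cintegrableZ u mD fi; apply: le_Rintegral => //.
  exact: integrable_normc.
move=> x _; rewrite (le_trans (ler_norm _))// (le_trans (ler_norm_Re _))//.
by rewrite Normc.normcM u1 mul1r.
Qed.

Lemma Rintegral_normcD D f g : measurable D -> cintegrable D f -> cintegrable D g ->
  \int[mu]_(x in D) normc (f x + g x) <=
  \int[mu]_(x in D) normc (f x) + \int[mu]_(x in D) normc (g x).
Proof.
move=> mD fi gi; have nf := integrable_normc mD fi; have ng := integrable_normc mD gi.
rewrite -RintegralD//; apply: le_Rintegral => //.
- by apply: integrable_normc => //; exact: cintegrableD.
- exact: eq_integrable (integrableD mD nf ng).
- by move=> x _; exact: le_normcD.
Qed.

Lemma Rintegral_normcZ D c f : measurable D -> cintegrable D f ->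
  \int[mu]_(x in D) normc (c * f x) = normc c * \int[mu]_(x in D) normc (f x).
Proof.
move=> mD fi; rewrite -RintegralZl//; last exact: integrable_normc.
by apply: eq_Rintegral => x _; rewrite Normc.normcM.
Qed.

Lemma integrable_finite_cst D (c : R) : measurable D -> (mu D < +oo)%E ->
  mu.-integrable D (fun=> c%:E).
Proof.
move=> mD muD; apply: (@measurable_bounded_integrable _ _ _ _ (cst c)) => //.
exact: bounded_cst.
Qed.

Lemma cintegrable_bounded D f (M : R) : measurable D -> (mu D < +oo)%E ->
  cmeas D f -> (forall x, D x -> normc (f x) <= M) -> cintegrable D f.
Proof.
move=> mD muD mf; apply: (cintegrable_le mD mf).
exact: integrable_finite_cst.
Qed.

Lemma normc_cintegral_le D f (M : R) : measurable D -> (mu D < +oo)%E ->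
  cmeas D f -> (forall x, D x -> normc (f x) <= M) ->
  normc (cintegral D f) <= M * fine (mu D).
Proof.
move=> mD muD mf fM; have fi := cintegrable_bounded mD muD mf fM.
rewrite (le_trans (normc_cintegral mD fi))// -Rintegral_cst//.
apply: le_Rintegral => //; first exact: integrable_normc.
exact: integrable_finite_cst.
Qed.

Lemma cintegral_cst D c : measurable D -> (mu D < +oo)%E ->
  cintegral D (fun=> c) = c * (fine (mu D))%:C%C.
Proof.
by move=> mD muD; apply: complexP; rewrite ?cReM ?cImM /= !Rintegral_cst//; ring.
Qed.

Lemma cintegral_sqr_eq0_ae f : cmeas setT f ->
  (\int[mu]_x ((normc (f x)) ^+ 2)%:E = 0)%E -> {ae mu, forall x, f x = 0}.
Proof.
move=> mf f0; have m2 : measurable_fun setT (fun x => (normc (f x) ^+ 2)%:E).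
  by apply/measurable_EFinP; apply: measurable_funX; exact: cmeas_normc.
have : (\int[mu]_x `|(normc (f x) ^+ 2)%:E| = 0)%E.
  by rewrite -[RHS]f0; apply: eq_integral => x _; rewrite gee0_abs// lee_fin sqr_ge0.
move/(ae_eq_integral_abs _ measurableT m2); apply: filterS => x /(_ I) [] /eqP.
by rewrite sqrf_eq0 normc_eq0 => /eqP.
Qed.

Lemma cintegral_ae_eq0 f : cmeas setT f -> {ae mu, forall x, f x = 0} ->
  cintegral setT f = 0.
Proof.
move=> [fRe fIm] f0; congr Complex; rewrite /Rintegral (@ae_eq_integral _ _ _ _ _ (cst 0%E));
  rewrite ?integral_cst ?mul0e//; try exact/measurable_EFinP;
  by apply: filterS f0 => x /= ->.
Qed.

End complex_integral.

Section complex_fubini.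
Context (d1 d2 : measure_display) (T1 : measurableType d1)
  (T2 : measurableType d2) (R : realType).
Variable m1 : {sigma_finite_measure set T1 -> \bar R}.
Variable m2 : {sigma_finite_measure set T2 -> \bar R}.
Variable f : T1 * T2 -> R[i].
Hypothesis fi : cintegrable (m1 \x m2)%E setT f.

Lemma cintegral12 : (forall x, cintegrable m2 setT (fun y => f (x, y))) ->
  cintegral (m1 \x m2)%E setT f =
  cintegral m1 setT (fun x => cintegral m2 setT (fun y => f (x, y))).
Proof.
move=> sec; case: fi => fRe fIm; congr Complex; rewrite /Rintegral.
  rewrite -(integral12_prod_meas1 fRe); congr fine; apply: eq_integral => x _.
  by rewrite /fubini_F fineK//; apply: integrable_fin_num => //; case: (sec x).
rewrite -(integral12_prod_meas1 fIm); congr fine; apply: eq_integral => x _.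
by rewrite /fubini_F fineK//; apply: integrable_fin_num => //; case: (sec x).
Qed.

Lemma cintegral21 : (forall y, cintegrable m1 setT (fun x => f (x, y))) ->
  cintegral (m1 \x m2)%E setT f =
  cintegral m2 setT (fun y => cintegral m1 setT (fun x => f (x, y))).
Proof.
move=> sec; case: fi => fRe fIm; congr Complex; rewrite /Rintegral.
  rewrite -(integral21_prod_meas1 fRe); congr fine; apply: eq_integral => x _.
  by rewrite /fubini_G fineK//; apply: integrable_fin_num => //; case: (sec x).
rewrite -(integral21_prod_meas1 fIm); congr fine; apply: eq_integral => x _.
by rewrite /fubini_G fineK//; apply: integrable_fin_num => //; case: (sec x).
Qed.

End complex_fubini.

Section probability_product.
Context (d1 d2 : measure_display) (T1 : measurableType d1)
  (T2 : measurableType d2) (R : realType).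
Variables (P1 : probability T1 R) (P2 : probability T2 R).

Lemma cintegrable_fst (f : T1 -> R[i]) : cintegrable P1 setT f ->
  cintegrable (P1 \x P2)%E setT (fun p => f p.1).
Proof.
move=> fi; have mf1 : cmeas setT (fun p : T1 * T2 => f p.1).
  by apply: cmeas_comp; [exact: cintegrable_cmeas fi|exact: measurable_fst].
suff ni : (P1 \x P2)%E.-integrable setT (EFin \o (fun p => normc (f p.1))).
  exact: (cintegrable_le measurableT mf1 ni).
have mn : measurable_fun setT (fun p : T1 * T2 => (normc (f p.1))%:E).
  by apply/measurable_EFinP; exact: cmeas_normc.
apply/integrableP; split => //; under eq_integral do rewrite /= ger0_norm ?normc_ge0//.
rewrite fubini_tonelli1//=; last by move=> p; rewrite lee_fin normc_ge0.
have P2T c : (\int[P2]_y c%:E = c%:E)%E.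
  rewrite integral_cst//; transitivity (c%:E * P2 setT)%E => //.
  by rewrite probability_setT mule1.
rewrite /fubini_F /=; under eq_integral do rewrite P2T.
have /integrableP[_] := integrable_normc measurableT fi.
by under eq_integral do rewrite /= ger0_norm ?normc_ge0//.
Qed.

End probability_product.

(** * Continuous functions of finitely many measurable functions *)

Lemma cvg_ptwsP (I : eqType) (V : topologicalType) (T : Type) (F : set_system T)
    (FF : Filter F) (u : T -> I -> V) (a : I -> V) :
  u t @[t --> F] --> (a : {ptws I -> V}) <-> forall i, u t i @[t --> F] --> a i.
Proof.
split=> [cv i|cv].
  exact: (cvg_comp _ _ cv (@proj_continuous I (fun=> V) i a)).
apply/cvg_sup => i A [B /= [[U oU <-] Ua] /filterS]; apply.
by apply: (cv i); exact: open_nbhs_nbhs.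
Qed.

Section measurable_coordinates.
Context (d : measure_display) (T : measurableType d) (R : realType).

Lemma measurable_fun_countable (K : countType) (k : T -> K) (G : K -> R) :
  (forall v, measurable (k @^-1` [set v])) -> measurable_fun setT (fun x => G (k x)).
Proof.
move=> mk _ B mB; rewrite setTI.
rewrite (_ : _ @^-1` B = \bigcup_v (k @^-1` [set v] `&` [set _ | B (G v)])).
  apply: countable_bigcupT_measurable => // v; apply: measurableI => //.
  have [Bv|nBv] := pselect (B (G v)).
    by rewrite (_ : [set _ | _] = setT)//; apply/seteqP; split => x.
  by rewrite (_ : [set _ | _] = set0)//; apply/seteqP; split => x.
by apply/seteqP; split => [x /= Bx|x [v _ [/= <-]]]; first by exists (k x).
Qed.

Definition quantize (k : nat) (y : R) : R := (Num.floor (k.+1%:R * y))%:~R / k.+1%:R.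

Lemma cvg_quantize (y : R) : quantize k y @[k --> \oo] --> y.
Proof.
apply/cvgrPdist_le => e e0; near=> k.
have k0 : 0 < k.+1%:R :> R by [].
have /andP[ly yl] := floor_itv (k.+1%:R * y).
rewrite ger0_norm ?subr_ge0 /quantize; last by rewrite ler_pdivrMr// [y * _]mulrC.
rewrite lerBlDl (@le_trans _ _ (quantize k y + k.+1%:R^-1))//.
  rewrite /quantize -[X in _ + X]mul1r -mulrDl ler_pdivlMr// [y * _]mulrC.
  by rewrite -[1]/(1%:~R) -intrD ltW.
by rewrite lerD2l ltW//; near: k; exact: (near_infty_natSinv_lt (PosNum e0)).
Unshelve. all: by end_near. Qed.

Lemma measurable_fun_continuous_coords n (X : T -> 'I_n -> R)
    (F : {ptws 'I_n -> R} -> R) :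
  (forall j, measurable_fun setT (X^~ j)) -> continuous F ->
  measurable_fun setT (fun x => F (X x)).
Proof.
move=> mX cF.
apply: (@measurable_fun_cvg _ _ _ _ (fun k x => F (fun j => quantize k (X x j)))) =>
    [k|x _]; last first.
  have cvX : (fun j => quantize k (X x j)) @[k --> \oo] --> (X x : {ptws 'I_n -> R}).
    by apply/cvg_ptwsP => j; exact: cvg_quantize.
  exact: (cvg_comp _ _ cvX (cF _)).
pose floors x : {ffun 'I_n -> int} := [ffun j => Num.floor (k.+1%:R * X x j)].
pose G (v : {ffun 'I_n -> int}) := F (fun j => (v j)%:~R / k.+1%:R).
rewrite (_ : (fun x => _) = (fun x => G (floors x))); last first.
  by apply/funext => x; congr F; apply/funext => j; rewrite ffunE.
apply: measurable_fun_countable => v.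
rewrite (_ : floors @^-1` _ =
    \bigcap_(j : 'I_n) (fun x => k.+1%:R * X x j) @^-1` `[(v j)%:~R, (v j + 1)%:~R[).
  apply: fin_bigcap_measurable => [|j _]; first exact: finite_finset.
   rewrite -[X in measurable X]setTI.
  by apply: measurable_funM => //; exact: mX.
apply/seteqP; split => [x /= <- j _ /=|x /= vx]; first by rewrite ffunE in_itv/= floor_itv.
by apply/ffunP => j; rewrite ffunE; have := vx j I; rewrite /= in_itv/= => /floor_def.
Qed.

End measurable_coordinates.

(** * Cauchy's integral formula on the unit circle *)

Section nested_bisection.
Variable R : realType.
Implicit Types (I J : R * R).

Definition half (lower : bool) I : R * R :=
  if lower then (I.1, (I.1 + I.2) / 2) else ((I.1 + I.2) / 2, I.2).

Definition in_segment (t : R) I := I.1 <= t <= I.2.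

Lemma half_length b I : (half b I).2 - (half b I).1 = (I.2 - I.1) / 2.
Proof. by case: b => /=; lra. Qed.

Lemma half_le b I : I.1 <= I.2 ->
  [/\ I.1 <= (half b I).1, (half b I).1 <= (half b I).2 & (half b I).2 <= I.2].
Proof. by case: b => /= h; split; lra. Qed.

Lemma nested_halves (I : nat -> R * R) : (I 0%N).1 <= (I 0%N).2 ->
  (forall k, exists b, I k.+1 = half b (I k)) ->
  exists t, forall k, in_segment t (I k) /\
    (I k).2 - (I k).1 = ((I 0%N).2 - (I 0%N).1) / 2 ^+ k.
Proof.
move=> I0 IS.
have Ile k : (I k).1 <= (I k).2.
  by elim: k => // k /half_le; have [b ->] := IS k => /(_ b)[].
have step k : (I k).1 <= (I k.+1).1 /\ (I k.+1).2 <= (I k).2.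
  by have [b ->] := IS k; have [] := half_le b (Ile k).
have left_incr : nondecreasing_seq (fun k => (I k).1).
  by apply/nondecreasing_seqP => k; case: (step k).
have right_decr : nonincreasing_seq (fun k => (I k).2).
  by apply/nonincreasing_seqP => k; case: (step k).
have left_right i j : (I i).1 <= (I j).2.
  apply: (le_trans (left_incr _ _ (leq_maxl i j))).
  by apply: (le_trans (Ile _)); apply: right_decr; exact: leq_maxr.
exists (sup (range (fun k => (I k).1))) => k; split; first (apply/andP; split).
- by apply: ub_le_sup; [exists (I k).2 => _ [i _ <-]|exists k].
- by apply: ge_sup; [exists (I 0%N).1, 0%N|move=> _ [i _ <-]].
elim: k => [|k IH]; first by rewrite expr0 divr1.
by have [b ->] := IS k; rewrite half_length IH exprSr invfM mulrA.
Qed.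

Lemma rectangle_bisection (P : (R * R) * (R * R) -> Prop) I J :
  I.1 <= I.2 -> J.1 <= J.2 -> P (I, J) ->
  (forall I' J', I'.1 <= I'.2 -> J'.1 <= J'.2 -> P (I', J') ->
     exists b c, P (half b I', half c J')) ->
  exists t u, forall delta : R, 0 < delta -> exists I' J',
    [/\ P (I', J'), in_segment t I' /\ in_segment u J',
        I'.2 - I'.1 < delta & J'.2 - J'.1 < delta].
Proof.
move=> I12 J12 PIJ Phalf.
pose good (Q : (R * R) * (R * R)) := [/\ Q.1.1 <= Q.1.2, Q.2.1 <= Q.2.2 & P Q].
pose next (Q Q' : {Q | good Q}) := exists b c, sval Q' = (half b (sval Q).1, half c (sval Q).2).
have [|Q [Q0 QS]] := @dependent_choice _ next _ (exist good (I, J) (And3 I12 J12 PIJ)).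
  move=> [[I' J'] [/= I'12 J'12 P']]; apply: cid; have [b [c Pbc]] := Phalf _ _ I'12 J'12 P'.
  have [_ hI _] := half_le b I'12; have [_ hJ _] := half_le c J'12.
  by exists (exist good (half b I', half c J') (And3 hI hJ Pbc)), b, c.
have [||t ht] := @nested_halves (fun k => (sval (Q k)).1).
- by case: (proj2_sig (Q 0%N)).
- by move=> k; have [b [c ->]] := QS k; exists b.
have [||u hu] := @nested_halves (fun k => (sval (Q k)).2).
- by case: (proj2_sig (Q 0%N)).
- by move=> k; have [b [c ->]] := QS k; exists c.
exists t, u => delta d0.
have small (L : R) : \forall k \near \oo, L / 2 ^+ k < delta.
  have cv : L * 2^-1 ^+ k @[k --> \oo] --> (0 : R).
    rewrite -(mulr0 L); apply: cvgMr; apply: cvg_expr.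
    by rewrite ger0_norm ?invr_ge0// invf_lt1// ltr1n.
  have /cvgrPdist_lt/(_ _ d0) := cv; apply: filterS => k.
  by rewrite sub0r normrN exprVn; exact: le_lt_trans (ler_norm _).
near \oo => k; exists (sval (Q k)).1, (sval (Q k)).2.
have [tk ->] := ht k; have [uk ->] := hu k; split => //.
- by rewrite -surjective_pairing; case: (proj2_sig (Q k)).
- by near: k; exact: small.
- by near: k; exact: small.
Unshelve. all: by end_near. Qed.

Section additive_rectangle_function.
Variable Phi : R -> R -> R -> R -> R[i].
Hypothesis add1 : forall a m b c d, a <= m <= b -> c <= d ->
  Phi a b c d = Phi a m c d + Phi m b c d.
Hypothesis add2 : forall a b c m d, a <= b -> c <= m <= d ->
  Phi a b c d = Phi a b c m + Phi a b m d.

Lemma normc_quarters_le I J (M : R) : I.1 <= I.2 -> J.1 <= J.2 ->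
  (forall i j, normc (Phi (half i I).1 (half i I).2 (half j J).1 (half j J).2) <= M) ->
  normc (Phi I.1 I.2 J.1 J.2) <= 4 * M.
Proof.
move=> I12 J12 quarter_le.
have := quarter_le true true; have := quarter_le true false.
have := quarter_le false true; have := quarter_le false false => /=.
set m := (I.1 + I.2) / 2; set k := (J.1 + J.2) / 2 => q1 q2 q3 q4.
have m_mid : I.1 <= m <= I.2 by rewrite /m; lra.
have k_mid : J.1 <= k <= J.2 by rewrite /k; lra.
have /andP[Im mI] := m_mid.
rewrite (add1 m_mid J12) (add2 Im k_mid) (add2 mI k_mid) (le_trans (le_normcD _ _))//.
have := le_normcD (Phi I.1 m J.1 k) (Phi I.1 m k J.2).
by have := le_normcD (Phi m I.2 J.1 k) (Phi m I.2 k J.2); lra.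
Qed.

(* Goursat's argument: if [Phi] exceeded [eta] times the squared half-perimeter
   on a rectangle, it would do so on one of its quarters, and so on down to a point. *)
Lemma additive_rectangle_eq0 :
  (forall t u e, 0 < e -> exists2 delta : R, 0 < delta & forall a b c d,
     a <= t <= b -> c <= u <= d -> b - a < delta -> d - c < delta ->
     normc (Phi a b c d) <= e * (b - a + (d - c)) ^+ 2) ->
  forall a b c d, a <= b -> c <= d -> Phi a b c d = 0.
Proof.
move=> local a b c d ab cd; apply/eqP; rewrite -normc_eq0.
apply/negPn/negP => Phi_neq0.
have Phi_gt0 : 0 < normc (Phi a b c d) by rewrite lt_def Phi_neq0 normc_ge0.
pose size2 (Q : (R * R) * (R * R)) := (Q.1.2 - Q.1.1 + (Q.2.2 - Q.2.1)) ^+ 2.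
pose value (Q : (R * R) * (R * R)) := normc (Phi Q.1.1 Q.1.2 Q.2.1 Q.2.2).
pose eta := normc (Phi a b c d) / (size2 ((a, b), (c, d)) + 1).
have size_gt0 : 0 < size2 ((a, b), (c, d)) + 1 by rewrite ltr_wpDl ?sqr_ge0.
have eta0 : 0 < eta by rewrite divr_gt0.
have [||||t [u small]] := @rectangle_bisection (fun Q => eta * size2 Q < value Q) (a, b) (c, d).
- by [].
- by [].
- by rewrite /value/= mulrAC ltr_pdivrMr// ltr_pM2l// ltrDl.
- move=> I J I12 J12 big; apply: contrapT => none.
  have quarter_le i j : value (half i I, half j J) <= eta * size2 (I, J) / 4.
    rewrite leNgt; apply/negP => lt; apply: none; exists i, j; apply: le_lt_trans lt.
    by rewrite /size2/= !half_length/= -mulrDl exprMn mulrA exprVn -natrX.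
  move: big; rewrite ltNge /value/= => /negP; apply.
  by rewrite (le_trans (normc_quarters_le I12 J12 quarter_le))// mulrC divfK.
have [delta d0 hdelta] := local t u eta eta0.
have [[a' b'] [[c' d'] [/= big [tI uJ] I_lt J_lt]]] := small delta d0.
by move: big; rewrite ltNge hdelta.
Qed.

End additive_rectangle_function.
End nested_bisection.

Section interval_integral.
Variable R : realType.
Local Notation leb := (@lebesgue_measure R).
Local Notation itg a b f := (cintegral leb `[a, b] f).
Implicit Types (f g F : R -> R[i]) (a b m s t : R).

Lemma cmeas_continuous f : continuous f -> cmeas setT (f : measurableTypeR R -> R[i]).
Proof.
by move=> cf; split; apply: continuous_measurable_fun => t;
  have /cvgc_ReImP[] := cf t.
Qed.

Lemma lebesgue_itv_lty a b : (leb `[a, b] < +oo)%E.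
Proof. by rewrite lebesgue_measure_itv /=; case: ifP => _; rewrite ?ltry// -EFinD ltry. Qed.

Lemma fine_lebesgue_itv a b : a <= b -> fine (leb `[a, b]%classic) = b - a.
Proof.
rewrite le_eqVlt lebesgue_measure_itv /= lte_fin => /predU1P[->|->//].
by rewrite ltxx subrr.
Qed.

Lemma continuous_cintegrable a b f : continuous f -> cintegrable leb `[a, b] f.
Proof.
move=> cf; split; apply: continuous_compact_integrable;
  try exact: segment_compact;
  by apply: continuous_subspaceT => t; have /cvgc_ReImP[] := cf t.
Qed.

Lemma cintegral_itv_split a m b f : a <= m <= b -> continuous f ->
  itg a b f = itg a m f + itg m b f.
Proof.
move=> /andP[am mb] cf; have [fRe fIm] := continuous_cintegrable a b cf.
have split (g : R -> R) : leb.-integrable `[a, b] (EFin \o g) ->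
    \int[leb]_(x in `[a, b]) g x =
    \int[leb]_(x in `[a, m]) g x + \int[leb]_(x in `[m, b]) g x.
  move=> gi; have := @Rintegral_itvB R g (BLeft a) (BRight b) m gi.
  rewrite !bnd_simp => /(_ am mb) /eqP; rewrite subr_eq => /eqP ->.
  rewrite addrC; congr (_ + _); apply: Rintegral_itv_obnd_cbnd.
  by apply: integrableS gi => //; apply: subset_itvr; rewrite bnd_simp.
by apply: complexP; rewrite ?cReD ?cImD /=; apply: split.
Qed.

Lemma normc_cintegral_itv_le a b f (M : R) : a <= b -> continuous f ->
  (forall t, a <= t <= b -> normc (f t) <= M) -> normc (itg a b f) <= M * (b - a).
Proof.
move=> ab cf fM; rewrite -(fine_lebesgue_itv ab); apply: normc_cintegral_le => //.
  exact: lebesgue_itv_lty.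
exact: cintegrable_cmeas (continuous_cintegrable a b cf).
Qed.

Lemma cintegral_itv_cst a b (c : R[i]) : a <= b -> itg a b (fun=> c) = c * (b - a)%:C%C.
Proof.
move=> ab; rewrite cintegral_cst//; last exact: lebesgue_itv_lty.
by congr (_ * _%:C)%C; exact: fine_lebesgue_itv.
Qed.

Definition cprimitive F f := forall t,
  is_derive t (1 : R) (fun s => cRe (F s)) (cRe (f t)) /\
  is_derive t (1 : R) (fun s => cIm (F s)) (cIm (f t)).

Lemma cprimitive_continuous F f : cprimitive F f -> continuous F.
Proof.
move=> dF t; have [dRe dIm] := dF t; apply/cvgc_ReImP.
by split; apply: differentiable_continuous; apply/derivable1_diffP; case: dRe dIm => ? _ [].
Qed.

Lemma cintegral_FTC F f a b : a <= b -> continuous f -> cprimitive F f ->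
  itg a b f = F b - F a.
Proof.
rewrite le_eqVlt => /predU1P[->|ab] cf dF.
  by rewrite subrr set_itv1 /cintegral !Rintegral_set1.
have ftc (H h : R -> R) : (forall t, is_derive t 1 H (h t)) -> continuous h ->
    \int[leb]_(t in `[a, b]) h t = H b - H a.
  move=> dH ch; rewrite /Rintegral (@continuous_FTC2 _ h H)//.
  - exact: continuous_subspaceT.
  - have cH : continuous H by move=> t; apply: differentiable_continuous;
      apply/derivable1_diffP; case: (dH t).
    split; first by move=> t _; case: (dH t).
      by apply: cvg_at_right_filter; exact: cH.
    by apply: cvg_at_left_filter; exact: cH.
  - by move=> t _; rewrite derive1E; case: (dH t).
apply: complexP; rewrite ?cReD ?cImD ?cReN ?cImN.
  by apply: (ftc (fun s => cRe (F s))) => t; [case: (dF t)|have /cvgc_ReImP[] := cf t].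
by apply: (ftc (fun s => cIm (F s))) => t; [case: (dF t)|have /cvgc_ReImP[] := cf t].
Qed.

Lemma cprimitive_lipschitz F f (M : R) : continuous f -> cprimitive F f ->
  (forall t, normc (f t) <= M) ->
  forall s t, normc (F s - F t) <= M * `|s - t|.
Proof.
move=> cf dF fM s t; wlog ts : s t / t <= s => [hw|].
  by have [/hw //|/ltW /hw] := leP t s; rewrite normc_distC distrC.
rewrite [`|_|]ger0_norm ?subr_ge0// -(cintegral_FTC ts cf dF).
exact: normc_cintegral_itv_le.
Qed.

Lemma cintegral_unif01 f : continuous f -> cintegral (@unif01 R) setT f = itg 0 1 f.
Proof.
have uniform (h : measurableTypeR R -> R) : measurable_fun setT h ->
    \int[@unif01 R]_x h x = \int[leb]_(x in `[0, 1]) h x.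
  move=> mh; rewrite /Rintegral; congr fine; rewrite integralE [RHS]integralE.
  rewrite !integral_uniform ?subr0 ?invr1 ?mul1e//.
  - by apply: measurable_funeneg; exact/measurable_EFinP.
  - by apply: measurable_funepos; exact/measurable_EFinP.
by move=> /cmeas_continuous[fRe fIm]; congr Complex; exact: uniform.
Qed.

End interval_integral.

Section complex_derivative.
Variable R : realType.
Implicit Types (F : R[i] -> R[i]) (a c : R[i]).

Definition complex_derivable F a :=
  exists L : R[i], forall e : R, 0 < e -> exists2 delta : R, 0 < delta &
    forall h, normc h < delta -> normc (F (a + h) - F a - L * h) <= e * normc h.

Lemma complex_derivable_continuous F a : complex_derivable F a -> {for a, continuous F}.
Proof.
move=> [L hL]; have [delta d0 hdelta] := hL 1 ltr01.
pose K := 1 + normc L; have K0 : 0 < K by rewrite ltr_wpDr ?normc_ge0.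
have near_a (r : R) : 0 < r -> \forall b \near a, normc (b - a) < r.
  move=> r0; have /cvgc_normcP/(_ _ r0) : x @[x --> a] --> a by exact: cvg_id.
  by apply: filterS => b; rewrite normc_distC.
apply/(cvgc_normcP (F := nbhs a)) => e e0; have eK0 : 0 < e / K by rewrite divr_gt0.
apply: filterS2 (near_a _ d0) (near_a _ eK0) => b /hdelta.
rewrite [a + _]addrC subrK mul1r ltr_pdivlMr// [_ * K]mulrC [normc (F a - F b)]normc_distC => h.
apply: le_lt_trans; rewrite -(subrK (L * (b - a)) (F b - F a)) (le_trans (le_normcD _ _))//.
by rewrite /K mulrDl mul1r Normc.normcM lerD2r.
Qed.

Lemma normc_inv_taylor (p q : R[i]) (m : R) : 0 < m -> m <= normc p -> normc q <= m / 2 ->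
  normc ((p - q)^-1 - p^-1 - p^-1 ^+ 2 * q) <= 2 * m^-1 ^+ 3 * normc q ^+ 2.
Proof.
move=> m0 pm qm; have pq : m / 2 <= normc (p - q).
  by rewrite (le_trans _ (lerB_normc _ _))//; lra.
have inv_le (c : R[i]) r : 0 < r -> r <= normc c -> c != 0 /\ normc c^-1 <= r^-1.
  move=> r0 rc; have c0 : 0 < normc c by exact: lt_le_trans rc.
  by rewrite -normc_eq0 gt_eqF// Normc.normcV lef_pV2 ?posrE.
have [p0 pV] := inv_le p m m0 pm.
have [|pq0 pqV] := inv_le (p - q) (m / 2) _ pq; first by rewrite divr_gt0.
have -> : (p - q)^-1 - p^-1 - p^-1 ^+ 2 * q = q ^+ 2 * (p^-1 ^+ 2 * (p - q)^-1).
  by field; rewrite p0 pq0.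
rewrite [leLHS]Normc.normcM normcX mulrC ler_wpM2r ?sqr_ge0//.
rewrite Normc.normcM normcX (_ : 2 * _ = m^-1 ^+ 2 * (m / 2)^-1); last first.
  by rewrite invf_div; ring.
by rewrite ler_pM ?normc_ge0 ?exprn_ge0 ?normc_ge0// lerXn2r ?nnegrE ?normc_ge0// invr_ge0 ltW.
Qed.

Lemma complex_derivable_inv_affine c a : 1 - c * a != 0 ->
  complex_derivable (fun s => (1 - c * s)^-1) a.
Proof.
move=> p0; set p := 1 - c * a in p0; pose m := normc p.
have m0 : 0 < m by rewrite lt_def normc_eq0 p0 normc_ge0.
pose K := 2 * m^-1 ^+ 3 * normc c ^+ 2 + 1.
have K0 : 0 < K by rewrite ltr_wpDl// !mulr_ge0 ?exprn_ge0 ?invr_ge0 ?normc_ge0// ltW.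
exists (p^-1 ^+ 2 * c) => e e0.
pose delta := Num.min (e / K) (m / 2 / (normc c + 1)).
have c1 : 0 < normc c + 1 by rewrite ltr_wpDl ?normc_ge0.
exists delta; first by rewrite lt_min !divr_gt0.
move=> h; rewrite lt_min => /andP[h1 h2].
rewrite (_ : 1 - c * (a + h) = p - c * h); last by rewrite /p; ring.
rewrite -mulrA (le_trans (normc_inv_taylor m0 (lexx _) _))//.
  rewrite Normc.normcM; move: h2; rewrite ltr_pdivlMr// => h2.
  rewrite (le_trans _ (ltW h2))// [leRHS]mulrC ler_wpM2r ?normc_ge0//.
  by rewrite lerDl.
rewrite Normc.normcM exprMn mulrA expr2 mulrA ler_wpM2r ?normc_ge0//.
rewrite (@le_trans _ _ (K * normc h))//; first by rewrite ler_wpM2r ?normc_ge0// lerDl.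
by rewrite mulrC -ler_pdivlMr// ltW.
Qed.

End complex_derivative.

Section circle.
Variable R : realType.
Implicit Types (s t : R).

Definition expi t : R[i] := Complex (cos (2 * pi * t)) (sin (2 * pi * t)).

Lemma normc_expi t : normc (expi t) = 1.
Proof. by rewrite normc_sqrtE /= cos2Dsin2 sqrtr1. Qed.

Lemma expi0 : expi 0 = 1 :> R[i].
Proof. by rewrite /expi mulr0 cos0 sin0. Qed.

Lemma expi1 : expi 1 = 1 :> R[i].
Proof. by rewrite /expi mulr1 mulrC mulr_natr cos2pi sin2pi. Qed.

Lemma expiD s t : expi (s + t) = expi s * expi t.
Proof.
by rewrite /expi mulrDr cosD sinD; apply: complexP; rewrite ?cReM ?cImM //=; ring.
Qed.

Lemma expiX t k : expi t ^+ k = expi (k%:R * t).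
Proof.
elim: k => [|k IH]; first by rewrite mul0r expi0 expr0.
by rewrite exprS IH -expiD -nat1r mulrDl mul1r.
Qed.

Lemma continuous_expi : continuous expi.
Proof.
move=> t; have lin : {for t, continuous (fun x : R => 2 * pi * x)}.
  by apply: cvgM; [exact: cvg_cst|exact: cvg_id].
apply/cvgc_ReImP; split.
  exact: (continuous_comp lin (@continuous_cos R _)).
exact: (continuous_comp lin (@continuous_sin R _)).
Qed.

Lemma cprimitive_expi (c : R) :
  cprimitive (fun t => expi (c * t)) (fun t => Complex 0 (2 * pi * c) * expi (c * t)).
Proof.
move=> t; rewrite cReM cImM /= !mul0r sub0r add0r.
have lin : is_derive t (1 : R) (fun t : R => 2 * pi * (c * t)) (2 * pi * c).
  by apply: is_derive_eq; rewrite /GRing.scale /= mulr1.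
split.
  apply: (is_derive_eq (is_derive1_comp (is_derive_cos _) lin)).
  by rewrite mulNr mulrC.
apply: (is_derive_eq (is_derive1_comp (is_derive_sin _) lin)).
by rewrite mulrC.
Qed.

Lemma continuous_expi_scale (c : R) : continuous (fun t => expi (c * t)).
Proof.
move=> t; apply: (@continuous_comp _ _ _ (fun t => c * t) expi).
  by apply: cvgM; [exact: cvg_cst|exact: cvg_id].
exact: continuous_expi.
Qed.

Lemma normc_2pii : normc (Complex 0 (2 * pi : R)) = 2 * pi.
Proof.
by rewrite normc_sqrtE /= expr0n add0r sqrtr_sqr ger0_norm// mulr_ge0// pi_ge0.
Qed.

Lemma cintegral_expiX k :
  cintegral (@lebesgue_measure R) `[0, 1] (fun t => expi t ^+ k.+1) = 0.
Proof.
pose c : R[i] := Complex 0 (2 * pi * k.+1%:R).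
have c0 : c != 0.
  rewrite -normc_eq0 normc_sqrtE /= expr0n add0r sqrtr_sqr normr_eq0 !mulf_eq0.
  by rewrite !pnatr_eq0 /= gt_eqF// pi_gt0.
have ck : continuous (fun t => c * expi (k.+1%:R * t)).
  by move=> t; apply: cvgM; [exact: cvg_cst|exact: continuous_expi_scale].
transitivity (cintegral (@lebesgue_measure R) `[0, 1] (fun t => expi (k.+1%:R * t))).
  by apply: eq_cintegral => t _; rewrite expiX.
apply: (mulfI c0).
rewrite -cintegralZ//; last exact/continuous_cintegrable/continuous_expi_scale.
rewrite (cintegral_FTC ler01 ck (cprimitive_expi _)).
by rewrite mulr0 expi0 -expiX expi1 expr1n subrr mulr0.
Qed.

End circle.

(* The boundary integral over [a, b] x [c, d] of the one-form
   [g (alpha(s) ds + beta(u) du)], where [alpha = tau'/tau] and [beta = gamma'/gamma].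
   For [g = F (w + tau gamma)] this form is the pullback of [F(z) dz / (z - w)]. *)
Section goursat.
Variable R : realType.
Local Notation leb := (@lebesgue_measure R).
Local Notation itg a b f := (cintegral leb `[a, b] f).
Variables (tau alpha gamma beta : R -> R[i]) (K : R).
Hypotheses (alpha_cont : continuous alpha) (beta_cont : continuous beta).
Hypothesis tau_prim : cprimitive tau (fun s => tau s * alpha s).
Hypothesis gamma_prim : cprimitive gamma (fun u => gamma u * beta u).
Hypothesis K0 : 0 < K.
Hypotheses (tau_le : forall s, normc (tau s) <= K)
  (alpha_le : forall s, normc (alpha s) <= K)
  (gamma_le : forall u, normc (gamma u) <= K)
  (beta_le : forall u, normc (beta u) <= K).
Implicit Types (g h : R -> R -> R[i]) (a b c d : R).

Let tau_cont : continuous tau. Proof. exact: cprimitive_continuous tau_prim. Qed.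
Let gamma_cont : continuous gamma. Proof. exact: cprimitive_continuous gamma_prim. Qed.

Let tau_alpha_cont : continuous (fun s => tau s * alpha s).
Proof. by move=> s; apply: cvgM; [exact: tau_cont|exact: alpha_cont]. Qed.

Let gamma_beta_cont : continuous (fun u => gamma u * beta u).
Proof. by move=> u; apply: cvgM; [exact: gamma_cont|exact: beta_cont]. Qed.

Definition sep_continuous g := (forall u, continuous (g ^~ u)) /\ forall s, continuous (g s).

Definition boundary_integral g a b c d : R[i] :=
  itg c d (fun u => (g b u - g a u) * beta u) - itg a b (fun s => (g s d - g s c) * alpha s).

Lemma continuous_row_diff g a b : sep_continuous g ->
  continuous (fun u => (g b u - g a u) * beta u).
Proof. by move=> [_ cg] u; apply: cvgM; [apply: cvgB; exact: cg|exact: beta_cont]. Qed.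

Lemma continuous_col_diff g c d : sep_continuous g ->
  continuous (fun s => (g s d - g s c) * alpha s).
Proof. by move=> [cg _] s; apply: cvgM; [apply: cvgB; exact: cg|exact: alpha_cont]. Qed.

Lemma boundary_integral_split1 g a m b c d : sep_continuous g -> a <= m <= b ->
  boundary_integral g a b c d = boundary_integral g a m c d + boundary_integral g m b c d.
Proof.
move=> cg amb; rewrite /boundary_integral (cintegral_itv_split amb); last first.
  exact: continuous_col_diff.
rewrite opprD addrACA -cintegralD//; try exact/continuous_cintegrable/continuous_row_diff.
by congr (_ + _); apply: eq_cintegral => u _; ring.
Qed.

Lemma boundary_integral_split2 g a b c m d : sep_continuous g -> c <= m <= d ->
  boundary_integral g a b c d = boundary_integral g a b c m + boundary_integral g a b m d.
Proof.
move=> cg cmd; rewrite /boundary_integral (cintegral_itv_split cmd); last first.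
  exact: continuous_row_diff.
rewrite addrACA -opprD -cintegralD//; try exact/continuous_cintegrable/continuous_col_diff.
by congr (_ - _); apply: eq_cintegral => u _; ring.
Qed.

Lemma boundary_integralD g h a b c d : sep_continuous g -> sep_continuous h ->
  boundary_integral (fun s u => g s u + h s u) a b c d =
  boundary_integral g a b c d + boundary_integral h a b c d.
Proof.
move=> cg ch; rewrite /boundary_integral [RHS]addrACA -opprD.
rewrite -!cintegralD//; try exact/continuous_cintegrable/continuous_row_diff;
  try exact/continuous_cintegrable/continuous_col_diff.
by congr (_ - _); apply: eq_cintegral => x _; ring.
Qed.

Lemma boundary_integral_affine (p q : R[i]) a b c d : a <= b -> c <= d ->
  boundary_integral (fun s u => p + q * (tau s * gamma u)) a b c d = 0.
Proof.
move=> ab cd.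
have rowE : itg c d (fun u => (p + q * (tau b * gamma u) - (p + q * (tau a * gamma u))) *
    beta u) = q * (tau b - tau a) * (gamma d - gamma c).
  rewrite -(cintegral_FTC cd gamma_beta_cont gamma_prim) -cintegralZ.
  - by apply: eq_cintegral => u _; ring.
  - exact: measurable_itv.
  - exact: continuous_cintegrable.
have colE : itg a b (fun s => (p + q * (tau s * gamma d) - (p + q * (tau s * gamma c))) *
    alpha s) = q * (gamma d - gamma c) * (tau b - tau a).
  rewrite -(cintegral_FTC ab tau_alpha_cont tau_prim) -cintegralZ.
  - by apply: eq_cintegral => s _; ring.
  - exact: measurable_itv.
  - exact: continuous_cintegrable.
by rewrite /boundary_integral rowE colE; ring.
Qed.

Lemma boundary_integral_le g a b c d (M : R) : sep_continuous g -> a <= b -> c <= d ->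
  (forall s u, a <= s <= b -> c <= u <= d -> normc (g s u) <= M) ->
  normc (boundary_integral g a b c d) <= 2 * M * K * (b - a + (d - c)).
Proof.
move=> cg ab cd gM.
have diff_le (x y e : R[i]) : normc x <= M -> normc y <= M -> normc e <= K ->
    normc ((x - y) * e) <= 2 * M * K.
  move=> xM yM eK; rewrite Normc.normcM ler_pM ?normc_ge0//.
  by rewrite (le_trans (ler_normB_normc _ _))//; lra.
rewrite (le_trans (ler_normB_normc _ _))// addrC mulrDr lerD//.
  apply: (normc_cintegral_itv_le ab); first exact: continuous_col_diff.
  by move=> s sab; apply: diff_le => //; apply: gM => //; rewrite lexx ?cd.
apply: (normc_cintegral_itv_le cd); first exact: continuous_row_diff.
by move=> u ucd; apply: diff_le => //; apply: gM => //; rewrite lexx ?ab.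
Qed.

Lemma sep_continuous_affine (p q : R[i]) :
  sep_continuous (fun s u => p + q * (tau s * gamma u)).
Proof.
split=> [u s|s u]; apply: cvgD; try exact: cvg_cst; apply: cvgMr; apply: cvgM;
  try exact: cvg_cst.
  exact: tau_cont.
exact: gamma_cont.
Qed.

Lemma boundary_integral_approx_le g (p q : R[i]) a b c d (M : R) :
  sep_continuous g -> a <= b -> c <= d ->
  (forall s u, a <= s <= b -> c <= u <= d ->
     normc (g s u - (p + q * (tau s * gamma u))) <= M) ->
  normc (boundary_integral g a b c d) <= 2 * M * K * (b - a + (d - c)).
Proof.
move=> cg ab cd gM; have ca := sep_continuous_affine p q.
pose remainder s u := g s u - (p + q * (tau s * gamma u)).
have cr : sep_continuous remainder.
  split=> [u s|s u]; apply: cvgB.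
  - exact: (cg.1 u s).
  - exact: (ca.1 u s).
  - exact: (cg.2 s u).
  - exact: (ca.2 s u).
have -> : g = (fun s u => remainder s u + (p + q * (tau s * gamma u))).
  by apply/funext => s; apply/funext => u; rewrite subrK.
rewrite (boundary_integralD _ _ _ _ cr ca) boundary_integral_affine// addr0.
exact: boundary_integral_le.
Qed.

Variables (F : R[i] -> R[i]) (w : R[i]).
Let Gamma s u := w + tau s * gamma u.
Hypothesis dF : forall s u, complex_derivable F (Gamma s u).

Lemma sep_continuous_comp_Gamma : sep_continuous (fun s u => F (Gamma s u)).
Proof.
have cG : sep_continuous Gamma.
  by have := sep_continuous_affine w 1; under [X in sep_continuous X]eq_fun do
    under eq_fun do rewrite mul1r.
split=> [u s|s u].
  apply: (continuous_comp (cG.1 u s)).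
  exact: complex_derivable_continuous.
apply: (continuous_comp (cG.2 s u)).
exact: complex_derivable_continuous.
Qed.

Let Gamma_lipschitz s u s' u' :
  normc (Gamma s u - Gamma s' u') <= K ^+ 3 * (`|s - s'| + `|u - u'|).
Proof.
have le_KK (x y : R[i]) : normc x <= K -> normc y <= K -> normc (x * y) <= K * K.
  by move=> xK yK; rewrite Normc.normcM ler_pM ?normc_ge0.
have tau_lip :=
  cprimitive_lipschitz tau_alpha_cont tau_prim (fun s => le_KK _ _ (tau_le s) (alpha_le s)).
have gamma_lip :=
  cprimitive_lipschitz gamma_beta_cont gamma_prim (fun u => le_KK _ _ (gamma_le u) (beta_le u)).
rewrite (_ : _ - _ = (tau s - tau s') * gamma u + tau s' * (gamma u - gamma u')).
  rewrite (le_trans (le_normcD _ _))// !Normc.normcM mulrDr lerD//.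
    by rewrite exprSr expr2 mulrAC ler_pM ?normc_ge0.
  by rewrite exprS expr2 -mulrA ler_pM ?normc_ge0.
by rewrite /Gamma; ring.
Qed.

Lemma boundary_integral_local t v e : 0 < e -> exists2 delta : R, 0 < delta &
  forall a b c d, a <= t <= b -> c <= v <= d -> b - a < delta -> d - c < delta ->
  normc (boundary_integral (fun s u => F (Gamma s u)) a b c d) <=
    e * (b - a + (d - c)) ^+ 2.
Proof.
move=> e0; have [L hL] := dF t v; pose eta := e / (2 * K ^+ 4).
have eta0 : 0 < eta by rewrite divr_gt0// mulr_gt0// exprn_gt0.
have [delta d0 hdelta] := hL eta eta0.
exists (delta / (2 * K ^+ 3)); first by rewrite divr_gt0// mulr_gt0// exprn_gt0.
move=> a b c d /andP[at_ tb] /andP[cv vd] ba dc.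
have [ab cd] : a <= b /\ c <= d by split; [exact: le_trans tb|exact: le_trans vd].
set S := b - a + (d - c).
have -> : e * S ^+ 2 = 2 * (eta * (K ^+ 3 * S)) * K * S.
  by rewrite /eta; field; rewrite gt_eqF.
apply: (boundary_integral_approx_le (p := F (Gamma t v) - L * (tau t * gamma v)) (q := L)
  sep_continuous_comp_Gamma ab cd) => s u /andP[as_ sb] /andP[cu ud].
have Gamma_le : normc (Gamma s u - Gamma t v) <= K ^+ 3 * S.
  rewrite (le_trans (Gamma_lipschitz _ _ _ _))// ler_pM2l ?exprn_gt0// lerD//.
    by rewrite ler_norml; apply/andP; split; lra.
  by rewrite ler_norml; apply/andP; split; lra.
have Gamma_lt : normc (Gamma s u - Gamma t v) < delta.
  rewrite (le_lt_trans Gamma_le)// mulrC -ltr_pdivlMr ?exprn_gt0//.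
  rewrite (_ : delta / K ^+ 3 = delta / (2 * K ^+ 3) + delta / (2 * K ^+ 3)) ?ltrD//.
  by field; rewrite gt_eqF.
have := hdelta _ Gamma_lt; rewrite [Gamma t v + _]addrC subrK => taylor.
rewrite (le_trans _ (ler_wpM2l (ltW eta0) Gamma_le))// (le_trans _ taylor)//.
by rewrite le_eqVlt /Gamma; apply/orP; left; apply/eqP; congr normc; ring.
Qed.

Lemma goursat a b c d : a <= b -> c <= d ->
  boundary_integral (fun s u => F (Gamma s u)) a b c d = 0.
Proof.
have cG := sep_continuous_comp_Gamma.
apply: additive_rectangle_eq0 => [*|*|t u e e0].
- exact: boundary_integral_split1.
- exact: boundary_integral_split2.
- exact: boundary_integral_local.
Qed.

End goursat.

Section cauchy_circle.
Variable R : realType.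
Local Notation leb := (@lebesgue_measure R).
Local Notation itg a b f := (cintegral leb `[a, b] f).
Implicit Types (F : R[i] -> R[i]) (w : R[i]) (s t u : R).

Definition cauchy_kernel w u : R[i] := (1 - w * conjc (expi u))^-1.

Lemma cauchy_denom_ge w (c : R[i]) : normc c <= 1 -> 1 - normc w <= normc (1 - w * c).
Proof.
move=> c1; apply: le_trans (lerB_normc _ _).
by rewrite Normc.normc1 Normc.normcM lerD2l lerN2 ler_piMr ?normc_ge0.
Qed.

Lemma cauchy_denom_neq0 w (c : R[i]) : normc w < 1 -> normc c <= 1 -> 1 - w * c != 0.
Proof.
move=> w1 /(cauchy_denom_ge w); rewrite -normc_eq0 => h.
by rewrite gt_eqF// (lt_le_trans _ h)// subr_gt0.
Qed.

Lemma cauchy_inv_le w (c : R[i]) : normc w < 1 -> normc c <= 1 ->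
  normc (1 - w * c)^-1 <= (1 - normc w)^-1.
Proof.
move=> w1 c1; have h := cauchy_denom_ge w c1.
by rewrite Normc.normcV lef_pV2 ?posrE ?subr_gt0// (lt_le_trans _ h)// subr_gt0.
Qed.

Lemma cauchy_kernel_le w u : normc w < 1 -> normc (cauchy_kernel w u) <= (1 - normc w)^-1.
Proof. by move=> w1; apply: cauchy_inv_le; rewrite ?normcJ ?normc_expi. Qed.

Lemma continuous_cauchy_kernel w : normc w < 1 -> continuous (cauchy_kernel w).
Proof.
move=> w1 u; apply: cvgV.
  by apply: cauchy_denom_neq0; rewrite ?normcJ ?normc_expi.
apply: cvgB; first exact: cvg_cst.
by apply: cvgMr; apply: cvg_conjc; exact: continuous_expi.
Qed.

(* The radius of the circles about [w] decreases from [1] to [0] along [s >= 0]. *)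
Definition radius s : R[i] := ((1 + s ^+ 2)^-1)%:C%C.
Definition radius_dlog s : R[i] := (- (2 * s) / (1 + s ^+ 2))%:C%C.

Let denom_gt0 s : 0 < 1 + s ^+ 2.
Proof. by rewrite ltr_wpDr ?sqr_ge0. Qed.

Lemma normc_radius s : normc (radius s) = (1 + s ^+ 2)^-1.
Proof. by rewrite normc_real ger0_norm// invr_ge0 ltW. Qed.

Lemma radius_le1 s : normc (radius s) <= 1.
Proof. by rewrite normc_radius invf_le1// lerDl sqr_ge0. Qed.

Lemma radius_dlog_le1 s : normc (radius_dlog s) <= 1.
Proof.
rewrite normc_real normrM normrN [`|_^-1|]ger0_norm ?invr_ge0 ?(ltW (denom_gt0 s))//.
rewrite ler_pdivrMr// mul1r ler_norml; apply/andP.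
by have := sqr_ge0 (s - 1); have := sqr_ge0 (s + 1); rewrite !expr2; split; lra.
Qed.

Lemma continuous_radius_dlog : continuous radius_dlog.
Proof.
move=> s; apply: cvg_real_complex; apply: cvgM.
  by apply: cvgN; apply: cvgM; [exact: cvg_cst|exact: cvg_id].
apply: cvgV; first by rewrite gt_eqF.
by apply: cvgD; [exact: cvg_cst|exact: exprn_continuous].
Qed.

Lemma cprimitive_radius : cprimitive radius (fun s => radius s * radius_dlog s).
Proof.
move=> s; rewrite cReM cImM /= !mul0r mulr0 subr0 addr0; split.
  have dden : is_derive s (1 : R) (fun s : R => 1 + s ^+ 2) (2 * s).
    by apply: is_derive_eq; rewrite /GRing.scale /=; ring.
  have den_neq0 : 1 + s ^+ 2 != 0 by rewrite gt_eqF.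
  split; first by apply: derivableV => //; case: dden.
  rewrite deriveV//.
  by rewrite derive_val /GRing.scale /=; field.
exact: is_derive_cst.
Qed.

Lemma normc_convex_le (t : R) (a b : R[i]) : 0 <= t <= 1 -> normc a <= 1 -> normc b <= 1 ->
  normc (a + t%:C%C * (b - a)) <= 1.
Proof.
move=> /andP[t0 t1] a1 b1.
rewrite (_ : _ + _ = (1 - t)%:C%C * a + t%:C%C * b); last by rewrite rmorphB rmorph1; ring.
rewrite (le_trans (le_normcD _ _))// !Normc.normcM !normc_real !ger0_norm ?subr_ge0//.
by rewrite -[leRHS](subrK t) lerD// ler_piMr ?subr_ge0.
Qed.

Section evaluation_point.
Variable w : R[i].
Hypothesis w1 : normc w < 1.
Local Notation spoke u := (expi u - w).
Let spoke_dlog u := Complex 0 (2 * pi) * cauchy_kernel w u.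

Lemma spoke_neq0 u : spoke u != 0.
Proof.
by rewrite -normc_eq0 gt_eqF// (lt_le_trans _ (lerB_normc _ _))// normc_expi subr_gt0.
Qed.

Lemma spoke_cauchy_kernel u : spoke u * cauchy_kernel w u = expi u.
Proof.
have e0 : expi u != 0 :> R[i] by rewrite -normc_eq0 normc_expi oner_eq0.
rewrite /cauchy_kernel -invc_unit ?normc_expi//.
by field; rewrite e0 spoke_neq0.
Qed.

Let spoke_prim : cprimitive (fun u => spoke u) (fun u => spoke u * spoke_dlog u).
Proof.
move=> u; rewrite mulrCA spoke_cauchy_kernel.
have [] := cprimitive_expi 1 u; rewrite mulr1 mul1r => dRe dIm; split.
  rewrite (_ : (fun s => _) = (fun s => cRe (expi (1 * s)) - cRe w)).
    by apply: is_derive_eq; rewrite subr0.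
  by apply/funext => s; rewrite mul1r cReD cReN.
rewrite (_ : (fun s => _) = (fun s => cIm (expi (1 * s)) - cIm w)).
  by apply: is_derive_eq; rewrite subr0.
by apply/funext => s; rewrite mul1r cImD cImN.
Qed.

Section disc_derivable.
Variable F : R[i] -> R[i].
Hypothesis dF : forall a, normc a <= 1 -> complex_derivable F a.

Let in_disc s u : normc (w + radius s * spoke u) <= 1.
Proof.
apply: normc_convex_le; rewrite ?normc_expi ?(ltW w1)//.
by rewrite -normc_radius normc_ge0 radius_le1.
Qed.

Let circle_cont s : continuous (fun u => F (w + radius s * spoke u) * cauchy_kernel w u).
Proof.
move=> u; apply: cvgM; last exact: continuous_cauchy_kernel.
have spoke_cont : {for u, continuous (fun u => w + radius s * spoke u)}.
  apply: cvgD; first exact: cvg_cst.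
  by apply: cvgMr; apply: cvgB; [exact: continuous_expi|exact: cvg_cst].
by apply: (continuous_comp spoke_cont); exact/complex_derivable_continuous/dF.
Qed.

Lemma boundary_integral_radial s :
  boundary_integral radius_dlog spoke_dlog (fun s u => F (w + radius s * spoke u)) 0 s 0 1 =
  Complex 0 (2 * pi) * (itg 0 1 (fun u => F (w + radius s * spoke u) * cauchy_kernel w u) -
                        itg 0 1 (fun u => F (expi u) * cauchy_kernel w u)).
Proof.
have radius0 u : F (w + radius 0 * spoke u) = F (expi u).
  by rewrite /radius expr0n addr0 invr1 mul1r addrC subrK.
have expi_cont : continuous (fun u => F (expi u) * cauchy_kernel w u).
  by move=> u; under eq_fun do rewrite -radius0; exact: circle_cont.
have col : itg 0 s (fun t => (F (w + radius t * spoke 1) - F (w + radius t * spoke 0)) *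
    radius_dlog t) = 0.
  rewrite -[RHS](cintegral0 leb `[0, s]); apply: eq_cintegral => t _.
  by rewrite expi0 expi1 subrr mul0r.
rewrite /boundary_integral col subr0 -cintegralB; last 3 first.
- exact: measurable_itv.
- exact/continuous_cintegrable/circle_cont.
- exact: continuous_cintegrable.
rewrite -cintegralZ; last 2 first.
- exact: measurable_itv.
- by apply: continuous_cintegrable => u; apply: cvgB; [exact: circle_cont|exact: expi_cont].
by apply: eq_cintegral => u _; rewrite radius0 /spoke_dlog; ring.
Qed.

Lemma cauchy_deform s : 0 <= s ->
  itg 0 1 (fun u => F (w + radius s * spoke u) * cauchy_kernel w u) =
  itg 0 1 (fun u => F (expi u) * cauchy_kernel w u).
Proof.
move=> s0; pose K : R := 2 + 2 * pi / (1 - normc w).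
have pi2 : 0 <= 2 * pi :> R by rewrite mulr_ge0// pi_ge0.
have B0 : 0 <= 2 * pi / (1 - normc w) by rewrite divr_ge0// subr_ge0 ltW.
have K2 : 2 <= K by rewrite lerDl.
have : boundary_integral radius_dlog spoke_dlog
    (fun s u => F (w + radius s * spoke u)) 0 s 0 1 = 0.
  apply: (goursat (K := K) continuous_radius_dlog _ cprimitive_radius spoke_prim) => //.
  - by move=> u; apply: cvgMr; exact: continuous_cauchy_kernel.
  - by lra.
  - by move=> t; have := radius_le1 t; lra.
  - by move=> t; have := radius_dlog_le1 t; lra.
  - by move=> u; have := ler_normB_normc (expi u) w; rewrite normc_expi; move: w1; lra.
  - move=> u; rewrite Normc.normcM normc_2pii.
    by rewrite (le_trans (ler_wpM2l pi2 (cauchy_kernel_le u w1)))// lerDr.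
  - by move=> t u; apply: dF; exact: in_disc.
have pii0 : Complex 0 (2 * pi) != 0 :> R[i].
  by rewrite -normc_eq0 normc_2pii mulf_neq0// gt_eqF// pi_gt0.
by move/eqP; rewrite boundary_integral_radial mulf_eq0 (negbTE pii0) subr_eq0 => /eqP.
Qed.

Lemma cauchy_average :
  itg 0 1 (fun u => F (expi u) * cauchy_kernel w u) = F w * itg 0 1 (cauchy_kernel w).
Proof.
apply/eqP; rewrite -subr_eq0 -normc_eq0 eq_le normc_ge0 andbT.
apply/ler_addgt0Pr => e e0; rewrite add0r.
have m0 : 0 < 1 - normc w by rewrite subr_gt0.
have cF : F b @[b --> w] --> F w by exact/complex_derivable_continuous/dF/ltW.
have [delta d0 hdelta] := near_normc (iffLR (cvgc_normcP _ _ _) cF _ (mulr_gt0 e0 m0)).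
pose s := 2 / delta; have s0 : 0 <= s by rewrite divr_ge0// ltW.
have s_small u : normc (radius s * spoke u) < delta.
  rewrite Normc.normcM normc_radius mulrC ltr_pdivrMr//.
  rewrite (le_lt_trans (ler_normB_normc _ _))// normc_expi.
  have : delta * s = 2 by rewrite /s mulrC divfK// gt_eqF.
  have : 0 <= delta * (s - 2^-1) ^+ 2 by rewrite mulr_ge0 ?sqr_ge0// ltW.
  by rewrite sqrrB; move: w1; nra.
rewrite -(cauchy_deform s0) -cintegralZ; last 2 first.
- exact: measurable_itv.
- exact/continuous_cintegrable/continuous_cauchy_kernel.
have cs : continuous (fun u => F w * cauchy_kernel w u).
  by move=> u; apply: cvgMr; exact: continuous_cauchy_kernel.
rewrite -cintegralB; last 3 first.
- exact: measurable_itv.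
- exact/continuous_cintegrable/circle_cont.
- exact: continuous_cintegrable.
rewrite -[leRHS]mulr1 -[X in _ * X](subr0 1); apply: (normc_cintegral_itv_le ler01).
  by move=> u; apply: cvgB; [exact: circle_cont|exact: cs].
move=> u _; rewrite -mulrBl Normc.normcM -(mulfK (lt0r_neq0 m0) e).
apply: ler_pM; rewrite ?normc_ge0//; last exact: cauchy_kernel_le.
by rewrite normc_distC ltW// hdelta// addrC addKr.
Qed.

End disc_derivable.
End evaluation_point.

Lemma mean_value F : (forall a, normc a <= 1 -> complex_derivable F a) ->
  itg 0 1 (fun u => F (expi u)) = F 0.
Proof.
move=> dF; have kernel0 u : cauchy_kernel 0 u = 1.
  by rewrite /cauchy_kernel mul0r subr0 invr1.
have z1 : normc (0 : R[i]) < 1 by rewrite Normc.normc0.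
have := cauchy_average z1 dF.
rewrite (_ : (fun u => _) = (fun u => F (expi u))); last first.
  by apply/funext => u; rewrite kernel0 mulr1.
move=> ->; rewrite (_ : cauchy_kernel 0 = fun=> 1); last exact/funext.
by rewrite cintegral_itv_cst// subr0 mulr1 mulr1.
Qed.

Lemma cintegral_cauchy_kernel w : normc w < 1 -> itg 0 1 (cauchy_kernel w) = 1.
Proof.
move=> w1; pose F (s : R[i]) := (1 - conjc w * s)^-1.
rewrite -[LHS]conjcK -cintegralJ; last 2 first.
- exact: measurable_itv.
- exact/continuous_cintegrable/continuous_cauchy_kernel.
rewrite (_ : cintegral _ _ _ = F 0); first by rewrite /F mulr0 subr0 invr1 conjc1.
rewrite -mean_value => [|a a1]; last first.
  by apply: complex_derivable_inv_affine; apply: cauchy_denom_neq0; rewrite ?normcJ.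
apply: eq_cintegral => u _.
by rewrite /cauchy_kernel conjc_inv1B conjcK.
Qed.

Theorem cauchy_circle F w : (forall a, normc a <= 1 -> complex_derivable F a) ->
  normc w < 1 -> itg 0 1 (fun u => F (expi u) * cauchy_kernel w u) = F w.
Proof.
by move=> dF w1; rewrite cauchy_average// cintegral_cauchy_kernel// mulr1.
Qed.

End cauchy_circle.

(** * Functions on the torus *)

Notation torus_integrable := (cintegrable (torus_mu _ _) setT).

Section torus_integral.
Variables (R : realType) (n : nat).
Local Notation mu := (torus_mu R n).
Implicit Types (f g : Tn R n -> R[i]) (c : R[i]).

Lemma torus_mu_lty : (mu setT < +oo)%E.
Proof. by rewrite probability_setT ltry. Qed.

Lemma Rintegral_torus_cst (r : R) : \int[mu]_x r = r.
Proof.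
rewrite Rintegral_cst//; transitivity (r * fine (mu setT)) => //.
by rewrite probability_setT mulr1.
Qed.

Lemma eq_cint f g : f =1 g -> cint f = cint g.
Proof. by move=> /funext ->. Qed.

Lemma cint_cst c : cint (fun _ : Tn R n => c) = c.
Proof. by rewrite /cint !Rintegral_torus_cst; case: c. Qed.

Lemma cintD f g : torus_integrable f -> torus_integrable g ->
  cint (fun x => f x + g x) = cint f + cint g.
Proof. exact: cintegralD. Qed.

Lemma cintB f g : torus_integrable f -> torus_integrable g ->
  cint (fun x => f x - g x) = cint f - cint g.
Proof. exact: cintegralB. Qed.

Lemma cintZ c f : torus_integrable f -> cint (fun x => c * f x) = c * cint f.
Proof. exact: cintegralZ. Qed.

Lemma cintJ f : torus_integrable f -> cint (fun x => conjc (f x)) = conjc (cint f).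
Proof. exact: cintegralJ. Qed.

Lemma cint_sum (I : Type) (s : seq I) (F : I -> Tn R n -> R[i]) :
  (forall i, torus_integrable (F i)) ->
  cint (fun x => \sum_(i <- s) F i x) = \sum_(i <- s) cint (F i).
Proof. exact: cintegral_sum. Qed.

Lemma normc_cint f : torus_integrable f -> normc (cint f) <= \int[mu]_x normc (f x).
Proof. exact: normc_cintegral. Qed.

Lemma L1normE f : torus_integrable f -> L1norm f = (\int[mu]_x normc (f x))%:E.
Proof.
move=> fi; rewrite /Rintegral fineK//; apply: integrable_fin_num => //.
exact: integrable_normc.
Qed.

Definition bounded_meas f := cmeas setT f /\ exists M : R, forall x, normc (f x) <= M.

Lemma bounded_meas_cst c : bounded_meas (fun=> c).
Proof. by split; [exact: cmeas_cst|exists (normc c)]. Qed.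

Lemma bounded_measM f g :
  bounded_meas f -> bounded_meas g -> bounded_meas (fun x => f x * g x).
Proof.
move=> [mf [M fM]] [mg [N gN]]; split; first exact: cmeasM.
by exists (M * N) => x; rewrite Normc.normcM ler_pM ?normc_ge0.
Qed.

Lemma bounded_measD f g :
  bounded_meas f -> bounded_meas g -> bounded_meas (fun x => f x + g x).
Proof.
move=> [mf [M fM]] [mg [N gN]]; split; first exact: cmeasD.
by exists (M + N) => x; rewrite (le_trans (le_normcD _ _))// lerD.
Qed.

Lemma bounded_measB f g :
  bounded_meas f -> bounded_meas g -> bounded_meas (fun x => f x - g x).
Proof.
move=> [mf [M fM]] [mg [N gN]]; split; first exact: cmeasB.
by exists (M + N) => x; rewrite (le_trans (ler_normB_normc _ _))// lerD.
Qed.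

Lemma bounded_measJ f : bounded_meas f -> bounded_meas (fun x => conjc (f x)).
Proof.
move=> [mf [M fM]]; split; first exact: cmeasJ.
by exists M => x; rewrite normcJ.
Qed.

Lemma bounded_meas_sum (I : Type) (s : seq I) (F : I -> Tn R n -> R[i]) :
  (forall i, bounded_meas (F i)) -> bounded_meas (fun x => \sum_(i <- s) F i x).
Proof.
move=> bF; elim: s => [|i s IH].
  by under eq_fun do rewrite big_nil; exact: bounded_meas_cst.
by under eq_fun do rewrite big_cons; exact: bounded_measD.
Qed.

Lemma bounded_meas_prod (I : Type) (s : seq I) (F : I -> Tn R n -> R[i]) :
  (forall i, bounded_meas (F i)) -> bounded_meas (fun x => \prod_(i <- s) F i x).
Proof.
move=> bF; elim: s => [|i s IH].
  by under eq_fun do rewrite big_nil; exact: bounded_meas_cst.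
by under eq_fun do rewrite big_cons; exact: bounded_measM.
Qed.

Lemma bounded_integrable f : bounded_meas f -> torus_integrable f.
Proof.
by move=> [mf [M fM]]; apply: (cintegrable_bounded (M := M)) => //; exact: torus_mu_lty.
Qed.

Lemma bounded_integrableM f g :
  bounded_meas f -> torus_integrable g -> torus_integrable (fun x => f x * g x).
Proof. by move=> [mf [M fM]]; exact: cintegrable_boundedM. Qed.

Lemma bounded_integrableMr f g :
  bounded_meas f -> torus_integrable g -> torus_integrable (fun x => g x * f x).
Proof. by move=> bf gi; under eq_fun do rewrite mulrC; exact: bounded_integrableM. Qed.

Lemma L2_sqr_integrable f : L2 f -> mu.-integrable setT (fun x => (normc (f x) ^+ 2)%:E).
Proof.
move=> [mf fy]; apply/integrableP; split.
  by apply/measurable_EFinP; apply: measurable_funX; exact: cmeas_normc.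
apply: le_lt_trans fy; rewrite le_eqVlt; apply/orP; left; apply/eqP.
by apply: eq_integral => x _; rewrite gee0_abs// lee_fin sqr_ge0.
Qed.

Lemma L2_dominated f (G : Tn R n -> R) : cmeas setT f -> mu.-integrable setT (EFin \o G) ->
  (forall x, normc (f x) ^+ 2 <= G x) -> L2 f.
Proof.
move=> mf Gi fG; split => //.
have G0 x : 0 <= G x by apply: le_trans (fG x); exact: sqr_ge0.
have /integrableP[_] := Gi; apply: le_lt_trans.
apply: ge0_le_integral => //.
- by move=> x _; rewrite lee_fin sqr_ge0.
- by apply/measurable_EFinP; apply: measurable_funX; exact: cmeas_normc.
- by apply: measurableT_comp => //; exact: measurable_int Gi.
- by move=> x _ /=; rewrite lee_fin ger0_norm.
Qed.

Lemma L2_integrableM f g : L2 f -> L2 g -> torus_integrable (fun x => f x * g x).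
Proof.
move=> Lf Lg; have If := L2_sqr_integrable Lf; have Ig := L2_sqr_integrable Lg.
have I2 : mu.-integrable setT (EFin \o (fun x => normc (f x) ^+ 2 + normc (g x) ^+ 2)).
  by apply: eq_integrable (integrableD measurableT If Ig) => // x _ /=; rewrite EFinD.
apply: (cintegrable_le measurableT _ I2).
  by apply: cmeasM; [case: Lf|case: Lg].
move=> x _; rewrite Normc.normcM.
have := sqr_ge0 (normc (f x) - normc (g x)); rewrite sqrrB.
have := mulr_ge0 (normc_ge0 (f x)) (normc_ge0 (g x)); rewrite -mulr_natr.
move: (normc (f x)) (normc (g x)) => a b; lra.
Qed.

Lemma L2D f g : L2 f -> L2 g -> L2 (fun x => f x + g x).
Proof.
move=> Lf Lg; have If := L2_sqr_integrable Lf; have Ig := L2_sqr_integrable Lg.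
have I2 : mu.-integrable setT
    (EFin \o (fun x => 2 * (normc (f x) ^+ 2 + normc (g x) ^+ 2))).
  exact: eq_integrable (integrableZl measurableT 2 (integrableD measurableT If Ig)).
have mfg : cmeas setT (fun x => f x + g x) by apply: cmeasD; [case: Lf|case: Lg].
apply: (L2_dominated mfg I2) => x.
rewrite (@le_trans _ _ ((normc (f x) + normc (g x)) ^+ 2))//.
  by rewrite ler_sqr ?nnegrE ?addr_ge0 ?normc_ge0// le_normcD.
rewrite -subr_ge0 [leRHS](_ : _ = (normc (f x) - normc (g x)) ^+ 2) ?sqr_ge0//.
by ring.
Qed.

Lemma bounded_L2M f g : bounded_meas f -> L2 g -> L2 (fun x => f x * g x).
Proof.
move=> [mf [M fM]] Lg; have Ig := L2_sqr_integrable Lg.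
have I2 : mu.-integrable setT (EFin \o (fun x => M ^+ 2 * normc (g x) ^+ 2)).
  by apply: eq_integrable (integrableZl measurableT (M ^+ 2) Ig) => // x _ /=; rewrite EFinM.
have mfg : cmeas setT (fun x => f x * g x) by apply: cmeasM => //; case: Lg.
apply: (L2_dominated mfg I2) => x.
rewrite Normc.normcM exprMn ler_wpM2r ?sqr_ge0// ler_sqr ?nnegrE ?normc_ge0//.
exact: le_trans (normc_ge0 _) (fM x).
Qed.

Lemma L2_cst c : L2 (fun _ : Tn R n => c).
Proof.
apply: (@L2_dominated _ (fun=> normc c ^+ 2)); [exact: cmeas_cst| |by []].
by apply: integrable_finite_cst => //; exact: torus_mu_lty.
Qed.

Lemma bounded_L2 f : bounded_meas f -> L2 f.
Proof.
by move=> bf; have := bounded_L2M bf (L2_cst 1); under eq_fun do rewrite mulr1.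
Qed.

Lemma L2_integrable f : L2 f -> torus_integrable f.
Proof.
by move=> Lf; have := L2_integrableM Lf (L2_cst 1); under eq_fun do rewrite mulr1.
Qed.

Lemma L2Z c f : L2 f -> L2 (fun x => c * f x).
Proof. by apply: bounded_L2M; exact: bounded_meas_cst. Qed.

Lemma L2J f : L2 f -> L2 (fun x => conjc (f x)).
Proof.
move=> Lf; apply: (@L2_dominated _ (fun x => normc (f x) ^+ 2)).
- by apply: cmeasJ; case: Lf.
- exact: L2_sqr_integrable.
- by move=> x; rewrite normcJ.
Qed.

Lemma cint_normc_sqr_eq0 f g : L2 f -> cmeas setT g ->
  cint (fun x => f x * conjc (f x)) = 0 -> cint (fun x => g x * conjc (f x)) = 0.
Proof.
move=> Lf mg ff0; have [mf _] := Lf.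
have f_ae0 : {ae mu, forall x, f x = 0}.
  apply: (cintegral_sqr_eq0_ae mf).
  rewrite -[LHS]fineK; last by apply: integrable_fin_num => //; exact: L2_sqr_integrable.
  congr _%:E; move/(congr1 (@complex.Re R)): ff0 => /= <-; apply: eq_Rintegral => x _.
  by rewrite -normc_sqr_mulJ.
apply: (cintegral_ae_eq0 (mu := mu)); first by apply: cmeasM => //; exact: cmeasJ.
by apply: filterS f_ae0 => x /= ->; rewrite conjc0 mulr0.
Qed.

End torus_integral.

Section torus_coordinates.
Variable R : realType.

Lemma measurable_cube_coord (n k : nat) :
  measurable_fun setT (fun x : Tn R n => cube_coord x k).
Proof.
elim: n k => [|n IH] k; first exact: measurable_cst.
case: k => [|k] /=; first exact: measurable_fst.
by apply: (@measurableT_comp _ _ _ _ _ _ (fun x : Tn R n => cube_coord x k));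
  [exact: IH|exact: measurable_snd].
Qed.

Lemma normc_torus_pt n (x : Tn R n) k : normc (torus_pt x k) = 1.
Proof. exact: normc_expi. Qed.

Lemma torus_pt_neq0 n (x : Tn R n) k : torus_pt x k != 0.
Proof. by rewrite -normc_eq0 normc_torus_pt oner_eq0. Qed.

Lemma conjc_torus_pt n (x : Tn R n) k : conjc (torus_pt x k) = (torus_pt x k)^-1.
Proof. by rewrite invc_unit// normc_torus_pt. Qed.

Lemma cmeas_torus_comp n (F : {ptws 'I_n -> R[i]} -> R[i]) :
  (forall a, (forall k, normc (a k) <= 1) -> {for a, continuous F}) ->
  cmeas setT (fun x : Tn R n => F (torus_pt x)).
Proof.
move=> cF; pose G (theta : {ptws 'I_n -> R}) := F (fun k => expi (theta k)).
have cG : continuous G.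
  move=> theta; have cexpi : (fun k => expi (phi k)) @[phi --> theta] -->
      ((fun k => expi (theta k)) : {ptws 'I_n -> R[i]}).
    apply/(cvg_ptwsP (F := nbhs theta)) => k.
    apply: (@cvg_comp _ _ _ (fun phi : {ptws 'I_n -> R} => phi k)).
      exact: (@proj_continuous 'I_n (fun=> R) k theta).
    exact: continuous_expi.
  by apply: (cvg_comp _ _ cexpi); apply: cF => k; rewrite normc_expi.
pose theta (x : Tn R n) (k : 'I_n) : R := cube_coord x k.
have mtheta k : measurable_fun setT (theta^~ k) by exact: measurable_cube_coord.
split.
  apply: (measurable_fun_continuous_coords mtheta (F := fun phi => cRe (G phi))) => phi.
  by have /cvgc_ReImP[] := cG phi.
apply: (measurable_fun_continuous_coords mtheta (F := fun phi => cIm (G phi))) => phi.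
by have /cvgc_ReImP[] := cG phi.
Qed.

Lemma bounded_meas_coord n k : bounded_meas (fun x : Tn R n => torus_pt x k).
Proof.
split; last by exists 1 => x; rewrite normc_torus_pt.
apply: (@cmeas_torus_comp n (fun a => a k)) => a _.
exact: (@proj_continuous 'I_n (fun=> R[i]) k a).
Qed.

Lemma cint_cons n (f : Tn R n.+1 -> R[i]) : torus_integrable f ->
  (forall t, torus_integrable (fun x : Tn R n => f (t, x))) ->
  cint f = cintegral (@unif01 R) setT (fun t => cint (fun x => f (t, x))).
Proof. by move=> fi fs; exact: (@cintegral12 _ _ _ _ R (@unif01 R) (torus_mu R n)). Qed.

Definition mcons n (a : R[i]) (z : 'I_n -> R[i]) (k : 'I_n.+1) : R[i] :=
  if unlift ord0 k is Some j then z j else a.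

Lemma mcons0 n a (z : 'I_n -> R[i]) : mcons a z ord0 = a.
Proof. by rewrite /mcons unlift_none. Qed.

Lemma mconsS n a (z : 'I_n -> R[i]) j : mcons a z (lift ord0 j) = z j.
Proof. by rewrite /mcons liftK. Qed.

Lemma mcons_eta n (z : 'I_n.+1 -> R[i]) : mcons (z ord0) (fun j => z (lift ord0 j)) = z.
Proof. by apply/funext => k; rewrite /mcons; case: (unliftP ord0 k) => [j|] ->. Qed.

Lemma torus_pt_mcons n t (x : Tn R n) :
  @torus_pt R n.+1 (t, x) = mcons (expi t) (torus_pt x).
Proof. by apply/funext => k; rewrite /mcons; case: (unliftP ord0 k) => [j|] ->. Qed.

End torus_coordinates.

(** * The Szego kernel and Cauchy's formula on the polydisc *)

Definition closed_polydisc (R : realType) (n : nat) (a : 'I_n -> R[i]) :=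
  forall k, normc (a k) <= 1.

Section szego_kernel.
Variable R : realType.

Lemma polydisc_closed n (a : 'I_n -> R[i]) : polydisc a -> closed_polydisc a.
Proof. by move=> a1 k; exact: ltW. Qed.

Lemma closed_polydisc_torus n (x : Tn R n) : closed_polydisc (torus_pt x).
Proof. by move=> k; rewrite normc_torus_pt. Qed.

Lemma closed_polydisc_mcons n (a : R[i]) (y : 'I_n -> R[i]) :
  normc a <= 1 -> closed_polydisc y -> closed_polydisc (mcons a y).
Proof. by move=> a1 y1 k; rewrite /mcons; case: unlift. Qed.

Lemma szego_denom_neq0 (a b : R[i]) : normc a <= 1 -> normc b < 1 -> 1 - a * conjc b != 0.
Proof. by move=> a1 b1; rewrite mulrC cauchy_denom_neq0 ?normcJ. Qed.

Lemma szegoC n (z w : 'I_n -> R[i]) : conjc (szego z w) = szego w z.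
Proof.
rewrite /szego rmorph_prod; apply: eq_bigr => k _.
by rewrite [LHS]conjc_inv1B conjcK mulrC.
Qed.

Lemma szego_mcons n a (z : 'I_n -> R[i]) (w : 'I_n.+1 -> R[i]) :
  szego (mcons a z) w =
  (1 - a * conjc (w ord0))^-1 * szego z (fun j => w (lift ord0 j)).
Proof.
rewrite /szego big_ord_recl mcons0; congr (_ * _).
by apply: eq_bigr => k _; rewrite mconsS.
Qed.

Lemma normc_szego_le n (z w : 'I_n -> R[i]) (r : R) : r < 1 ->
  closed_polydisc z -> (forall k, normc (w k) <= r) -> normc (szego z w) <= (1 - r)^-1 ^+ n.
Proof.
move=> r1 z1 wr; rewrite /szego normc_prod.
rewrite -[X in _ ^+ X](card_ord n) -prodr_const; apply: ler_prod => k _.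
have w1 : normc (conjc (w k)) < 1 by rewrite normcJ (le_lt_trans (wr k)).
rewrite normc_ge0 mulrC (le_trans (cauchy_inv_le w1 (z1 k)))//.
by rewrite normcJ lef_pV2 ?posrE ?subr_gt0 ?lerD2l ?lerN2// -normcJ.
Qed.

Definition szego_factor n (i : 'I_n) (c : R[i]) (x : Tn R n) : R[i] :=
  (1 - torus_pt x i * conjc c)^-1.

Lemma szego_factorE n (w : 'I_n -> R[i]) (x : Tn R n) :
  szego (torus_pt x) w = \prod_i szego_factor i (w i) x.
Proof. by []. Qed.

Lemma cmeas_szego_factor n (i : 'I_n) c : cmeas setT (szego_factor i c).
Proof.
apply: cmeasV; apply: cmeasB; first exact: cmeas_cst.
by apply: cmeasM; [case: (bounded_meas_coord R i)|exact: cmeas_cst].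
Qed.

Lemma cmeas_szego n (w : 'I_n -> R[i]) :
  cmeas setT (fun x : Tn R n => szego (torus_pt x) w).
Proof. by apply: cmeas_prod => i; exact: cmeas_szego_factor. Qed.

Lemma bounded_meas_szego_factor n (i : 'I_n) c : normc c < 1 ->
  bounded_meas (szego_factor i c).
Proof.
move=> c1; split; first exact: cmeas_szego_factor.
exists (1 - normc (conjc c))^-1 => x; rewrite /szego_factor mulrC.
by apply: cauchy_inv_le; rewrite ?normcJ ?normc_torus_pt.
Qed.

Lemma bounded_meas_szego n (w : 'I_n -> R[i]) : polydisc w ->
  bounded_meas (fun x : Tn R n => szego (torus_pt x) w).
Proof.
by move=> w1; apply: bounded_meas_prod => i; exact: bounded_meas_szego_factor.
Qed.

End szego_kernel.

Section polydisc_algebra.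
Variable R : realType.

Definition set_coord n (a : 'I_n -> R[i]) (k : 'I_n) (s : R[i]) : 'I_n -> R[i] :=
  fun j => if j == k then s else a j.

Definition polydisc_algebra n (F : {ptws 'I_n -> R[i]} -> R[i]) :=
  [/\ forall a, closed_polydisc a -> {for a, continuous F},
      forall a k, closed_polydisc a -> complex_derivable (fun s => F (set_coord a k s)) (a k) &
      exists M : R, forall a, closed_polydisc a -> normc (F a) <= M].

Lemma polydisc_algebra_bounded_meas n (F : {ptws 'I_n -> R[i]} -> R[i]) :
  polydisc_algebra F -> bounded_meas (fun x : Tn R n => F (torus_pt x)).
Proof.
move=> [cF _ [M FM]]; split; first exact: cmeas_torus_comp.
by exists M => x; apply: FM; exact: closed_polydisc_torus.
Qed.

Lemma cvg_mcons n (T : Type) (F : set_system T) (FF : Filter F) (b : T -> R[i]) (c : R[i])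
    (u : T -> 'I_n -> R[i]) (a : 'I_n -> R[i]) :
  b t @[t --> F] --> c -> u t @[t --> F] --> (a : {ptws 'I_n -> R[i]}) ->
  mcons (b t) (u t) @[t --> F] --> (mcons c a : {ptws 'I_n.+1 -> R[i]}).
Proof.
move=> bc /cvg_ptwsP ua; apply/cvg_ptwsP => k.
case: (unliftP ord0 k) => [j|] ->.
  rewrite mconsS (_ : (fun t => _) = (fun t => u t j)); first exact: ua.
  by apply/funext => t; rewrite mconsS.
rewrite mcons0 (_ : (fun t => _) = b); first exact: bc.
by apply/funext => t; rewrite mcons0.
Qed.

Lemma set_coord_mconsS n c (a : 'I_n -> R[i]) k s :
  mcons c (set_coord a k s) = set_coord (mcons c a) (lift ord0 k) s.
Proof.
apply/funext => j; rewrite /set_coord; case: (unliftP ord0 j) => [i|] ->.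
  by rewrite !mconsS (inj_eq lift_inj).
by rewrite !mcons0.
Qed.

Lemma set_coord_mcons0 n c (a : 'I_n -> R[i]) s :
  mcons s a = set_coord (mcons c a) ord0 s.
Proof.
apply/funext => j; rewrite /set_coord; case: (unliftP ord0 j) => [i|] ->.
  by rewrite !mconsS.
by rewrite mcons0 eqxx.
Qed.

Lemma polydisc_algebra_mcons n (F : {ptws 'I_n.+1 -> R[i]} -> R[i]) c : normc c <= 1 ->
  polydisc_algebra F -> polydisc_algebra (fun a : {ptws 'I_n -> R[i]} => F (mcons c a)).
Proof.
move=> c1 [cF dF [M FM]]; split=> [a a1|a k a1|].
- have cmc : mcons c b @[b --> (a : {ptws 'I_n -> R[i]})] -->
      (mcons c a : {ptws 'I_n.+1 -> R[i]}).
    have FF : Filter (nbhs (a : {ptws 'I_n -> R[i]})) by exact: nbhs_filter.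
    exact: (cvg_mcons FF (@cvg_cst _ c _ _ _) cvg_id).
  by apply: (cvg_comp _ _ cmc); apply: cF; exact: closed_polydisc_mcons.
- under eq_fun do rewrite set_coord_mconsS.
  by rewrite -(mconsS c a k); apply: dF; exact: closed_polydisc_mcons.
- by exists M => a a1; apply: FM; exact: closed_polydisc_mcons.
Qed.

Lemma polydisc_algebra_derivable_first n (F : {ptws 'I_n.+1 -> R[i]} -> R[i])
    (a : 'I_n -> R[i]) : closed_polydisc a -> polydisc_algebra F ->
  forall c, normc c <= 1 -> complex_derivable (fun s => F (mcons s a)) c.
Proof.
move=> a1 [_ dF _] c c1; under eq_fun do rewrite (set_coord_mcons0 c).
by rewrite -{2}(mcons0 c a); apply: dF; exact: closed_polydisc_mcons.
Qed.

(* Cauchy's formula in each variable, and Fubini. *)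
Theorem cauchy_polydisc n (F : {ptws 'I_n -> R[i]} -> R[i]) (w : 'I_n -> R[i]) :
  polydisc_algebra F -> polydisc w ->
  cint (fun x => F (torus_pt x) * conjc (szego (torus_pt x) w)) = F w.
Proof.
elim: n F w => [F w _ _|n IH F w aF w1].
  rewrite -[RHS](@cint_cst R 0); apply: eq_cint => x.
  by rewrite /szego big_ord0 conjc1 mulr1; congr F; apply/funext; case.
pose w' j := w (lift ord0 j).
have w'1 : polydisc w' by move=> j; exact: w1.
have slice t : polydisc_algebra (fun a : {ptws 'I_n -> R[i]} => F (mcons (expi t) a)).
  by apply: polydisc_algebra_mcons; rewrite ?normc_expi.
have slice_integrable t : torus_integrable
    (fun x : Tn R n => F (mcons (expi t) (torus_pt x)) * conjc (szego (torus_pt x) w')).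
  apply: bounded_integrable; apply: bounded_measM.
    exact: (polydisc_algebra_bounded_meas (slice t)).
  by apply: bounded_measJ; exact: bounded_meas_szego.
have integrandE t x : F (@torus_pt R n.+1 (t, x)) * conjc (szego (@torus_pt R n.+1 (t, x)) w) =
    cauchy_kernel (w ord0) t *
    (F (mcons (expi t) (torus_pt x)) * conjc (szego (torus_pt x) w')).
  rewrite torus_pt_mcons szego_mcons rmorphM /= conjc_inv1B conjcK mulrCA.
  by rewrite [conjc _ * w ord0]mulrC.
rewrite cint_cons; last 2 first.
- apply: bounded_integrable; apply: bounded_measM; first exact: polydisc_algebra_bounded_meas.
  by apply: bounded_measJ; exact: bounded_meas_szego.
- move=> t; under eq_fun do rewrite integrandE.
  exact: cintegrableZ.
transitivity (cintegral (@unif01 R) setT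
    (fun t => F (mcons (expi t) w') * cauchy_kernel (w ord0) t)).
  apply: eq_cintegral => t _; under eq_cint do rewrite integrandE.
  by rewrite cintZ// (IH _ _ (slice t) w'1) mulrC.
have dF := polydisc_algebra_derivable_first (polydisc_closed w'1) aF.
rewrite cintegral_unif01; first by rewrite (cauchy_circle dF (w1 ord0)) mcons_eta.
have cF t : {for expi t, continuous (fun s => F (mcons s w'))}.
  by apply: complex_derivable_continuous; apply: dF; rewrite normc_expi.
move=> t; apply: cvgM; last exact: continuous_cauchy_kernel.
exact: (cvg_comp _ _ (@continuous_expi R t) (cF t)).
Qed.

End polydisc_algebra.

(** * Fourier characters and evaluation by the Szego kernel *)

Section characters.
Variables (R : realType) (n : nat).
Implicit Types (k l : 'I_n -> int) (x : Tn R n).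

Lemma normc_character k x : normc (character k x) = 1.
Proof.
rewrite /character normc_prod big1// => j _.
by case: (k j) => e; rewrite ?Normc.normcV normcX normc_torus_pt expr1n ?invr1.
Qed.

Lemma bounded_meas_character k : bounded_meas (@character R n k).
Proof.
split; last by exists 1 => x; rewrite normc_character.
apply: cmeas_prod => j; have [mj _] := bounded_meas_coord R j.
by case: (k j) => e; [exact: cmeasX|apply: cmeasV; exact: cmeasX].
Qed.

Lemma characterD k l x : character (fun j => k j + l j) x = character k x * character l x.
Proof.
rewrite /character -big_split; apply: eq_bigr => j _ /=.
by rewrite expfzDr ?torus_pt_neq0.
Qed.

Lemma characterN k x : character (fun j => - k j) x = conjc (character k x).
Proof.
rewrite /character rmorph_prod; apply: eq_bigr => j _ /=.
rewrite -invr_expz.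
have conjX (e : nat) : conjc (torus_pt x j ^+ e) = (torus_pt x j)^-1 ^+ e.
  by rewrite rmorphXn; congr (_ ^+ e); exact: conjc_torus_pt.
by case: (k j) => e; rewrite /exprz ?conjc_inv conjX exprVn.
Qed.

Lemma character0 x : character (fun=> 0) x = 1.
Proof. by rewrite /character big1. Qed.

Definition unit_freq (i : 'I_n) : 'I_n -> int := fun j => (i == j)%:Z.

Lemma character_unit_freq i x : character (unit_freq i) x = torus_pt x i.
Proof.
rewrite /character (bigD1 i)//= /unit_freq eqxx expr1z big1 ?mulr1// => j ji.
by rewrite eq_sym (negbTE ji) expr0z.
Qed.

End characters.

Section character_integral.
Variable R : realType.
Local Notation U := (@unif01 R).

Lemma unif01_lty : (U setT < +oo)%E.
Proof. by rewrite /unif01 probability_setT ltry. Qed.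

Lemma cintegral_unif01_expiX (k : nat) : cintegral U setT (fun t => expi t ^+ k.+1) = 0.
Proof.
rewrite cintegral_unif01 ?cintegral_expiX//.
by under eq_fun do rewrite expiX; exact: continuous_expi_scale.
Qed.

Lemma cintegrable_unif01_expiX (k : nat) : cintegrable U setT (fun t => expi t ^+ k).
Proof.
apply: (cintegrable_bounded (M := 1)) => //; first exact: unif01_lty.
  by apply: cmeasX; apply: cmeas_continuous; exact: continuous_expi.
by move=> t _; rewrite normcX normc_expi expr1n.
Qed.

Lemma character_mcons n (k : 'I_n.+1 -> int) t (x : Tn R n) :
  @character R n.+1 k (t, x) = expi t ^ (k ord0) * character (fun i => k (lift ord0 i)) x.
Proof.
rewrite /character big_ord_recl torus_pt_mcons mcons0; congr (_ * _).
by apply: eq_bigr => i _; rewrite mconsS.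
Qed.

Lemma cint_character n (k : 'I_n -> int) j : 0 < k j -> cint (@character R n k) = 0.
Proof.
elim: n k j => [k []//|n IH k j kj].
pose k' i := k (lift ord0 i).
have k'_integrable : torus_integrable (@character R n k').
  by apply: bounded_integrable; exact: bounded_meas_character.
rewrite cint_cons; last 2 first.
- by apply: bounded_integrable; exact: bounded_meas_character.
- by move=> t; under eq_fun do rewrite character_mcons; exact: cintegrableZ.
transitivity (cintegral U setT (fun t => cint (@character R n k') * expi t ^ (k ord0))).
  apply: eq_cintegral => t _; under eq_cint do rewrite character_mcons.
  by rewrite cintZ// mulrC.
case: (unliftP ord0 j) kj => [i|] -> kj.
  rewrite (IH k' i)// (_ : (fun=> _) = fun=> 0) ?cintegral0//.
  by apply/funext => t; rewrite mul0r.
case: (k ord0) kj => [[//|l] _|//]; rewrite [LHS]cintegralZ//.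
  by rewrite cintegral_unif01_expiX mulr0.
exact: cintegrable_unif01_expiX.
Qed.

End character_integral.

Section analytic_in_variable.
Variables (R : realType) (n : nat).
Local Notation mu := (torus_mu R n).
Implicit Types (F G : Tn R n -> R[i]) (i j : 'I_n) (w : 'I_n -> R[i]).

(* [F] has no Fourier coefficient at frequencies [- k] with [k j > 0]. *)
Definition analytic_in j F := torus_integrable F /\
  forall k : 'I_n -> int, 0 < k j -> cint (fun x => F x * character k x) = 0.

Definition analytic F := forall j, analytic_in j F.

Lemma character_integrable F k : torus_integrable F ->
  torus_integrable (fun x => F x * character k x).
Proof. by apply: bounded_integrableMr; exact: bounded_meas_character. Qed.

Lemma analytic_inD j F G : analytic_in j F -> analytic_in j G ->
  analytic_in j (fun x => F x + G x).
Proof.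
move=> [Fi Fk] [Gi Gk]; split=> [|k kj]; first exact: cintegrableD.
under eq_cint do rewrite mulrDl.
by rewrite cintD ?Fk ?Gk ?addr0//; exact: character_integrable.
Qed.

Lemma analytic_inZ j c F : analytic_in j F -> analytic_in j (fun x => c * F x).
Proof.
move=> [Fi Fk]; split=> [|k kj]; first exact: cintegrableZ.
under eq_cint do rewrite -mulrA.
by rewrite cintZ ?Fk ?mulr0//; exact: character_integrable.
Qed.

Lemma analytic_in_coordM j i F : analytic_in j F -> analytic_in j (fun x => torus_pt x i * F x).
Proof.
move=> [Fi Fk]; split=> [|k kj].
  by apply: bounded_integrableM => //; exact: bounded_meas_coord.
rewrite -(Fk (fun l => unit_freq i l + k l)); last by rewrite ltr_wpDl.
by apply: eq_cint => x; rewrite characterD character_unit_freq; ring.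
Qed.

Lemma analytic1 : analytic (fun=> 1).
Proof.
move=> j; split; first by apply: bounded_integrable; exact: bounded_meas_cst.
by move=> k kj; under eq_cint do rewrite mul1r; exact: cint_character kj.
Qed.

Lemma analytic_prod_coordB (I : Type) (s : seq I) (f : I -> 'I_n) (c : I -> R[i]) :
  analytic (fun x => \prod_(i <- s) (torus_pt x (f i) - c i)).
Proof.
elim: s => [|i s IH] j; first by under eq_fun do rewrite big_nil; exact: analytic1.
under eq_fun do rewrite big_cons mulrBl -mulNr.
by apply: analytic_inD; [exact: analytic_in_coordM|exact: analytic_inZ].
Qed.

Lemma cint_coordM_eq0 j F : analytic_in j F -> cint (fun x => torus_pt x j * F x) = 0.
Proof.
move=> [_ h]; rewrite -(h (unit_freq j)) ?/unit_freq ?eqxx//.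
by apply: eq_cint => x; rewrite character_unit_freq mulrC.
Qed.

(* [G = 1 + c e_v G] expands as the geometric series of [c e_v], whose
   frequencies do not decrease the [j]-th coordinate. *)
Lemma analytic_in_geometric j F G (c : R[i]) (v : 'I_n -> int) :
  0 <= v j -> normc c < 1 -> bounded_meas G ->
  (forall x, G x = 1 + c * character v x * G x) ->
  analytic_in j F -> analytic_in j (fun x => G x * F x).
Proof.
move=> vj c1 bG GE [Fi Fk]; have GFi := bounded_integrableM bG Fi.
split=> // k kj; pose freq l i := k i + v i *+ l.
have freqS l x : character (freq l.+1) x = character v x * character (freq l) x.
  by rewrite -characterD; congr character; apply/funext => i; rewrite /freq mulrS addrCA.
pose I l := cint (fun x => G x * F x * character (freq l) x).
have -> : cint (fun x => G x * F x * character k x) = I 0%N.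
  apply: eq_cint => x; congr (_ * character _ x).
  by apply/funext => i; rewrite /freq mulr0n addr0.
apply: (geometric_recursion_eq0 (M := \int[mu]_x normc (G x * F x)) c1) => l.
  have freq_gt0 : 0 < freq l j by rewrite ltr_wpDr// mulrn_wge0.
  rewrite -[RHS]add0r -(Fk _ freq_gt0) -cintZ; last exact: character_integrable.
  rewrite -cintD; last 2 first.
  - exact: character_integrable.
  - by apply: cintegrableZ => //; exact: character_integrable.
  by apply: eq_cint => x; rewrite freqS {1}GE; ring.
rewrite (le_trans (normc_cint (character_integrable _ GFi)))//.
rewrite le_eqVlt; apply/orP; left; apply/eqP; apply: eq_Rintegral => x _.
by rewrite [in LHS]Normc.normcM normc_character mulr1.
Qed.

Lemma szego_factor_rec i c (x : Tn R n) : normc c < 1 ->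
  szego_factor i c x = 1 + conjc c * torus_pt x i * szego_factor i c x.
Proof.
move=> c1; have : 1 - torus_pt x i * conjc c != 0.
  by apply: szego_denom_neq0; rewrite ?normc_torus_pt.
by move=> denom0; rewrite /szego_factor; field.
Qed.

Lemma conjc_szego_factor_rec i c (x : Tn R n) : normc c < 1 ->
  conjc (szego_factor i c x) =
  1 + c * conjc (torus_pt x i) * conjc (szego_factor i c x).
Proof.
by move=> c1; rewrite {1}(szego_factor_rec _ _ c1) rmorphD rmorph1 !rmorphM /= conjcK.
Qed.

Lemma analytic_in_szego_factor j i c F : normc c < 1 ->
  analytic_in j F -> analytic_in j (fun x => szego_factor i c x * F x).
Proof.
move=> c1; apply: (@analytic_in_geometric _ _ _ (conjc c) (unit_freq i)).
- by rewrite /unit_freq.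
- by rewrite normcJ.
- exact: bounded_meas_szego_factor.
- by move=> x; rewrite character_unit_freq; exact: szego_factor_rec.
Qed.

Lemma analytic_in_conjc_szego_factor j i c F : i != j -> normc c < 1 ->
  analytic_in j F -> analytic_in j (fun x => conjc (szego_factor i c x) * F x).
Proof.
move=> ij c1; apply: (@analytic_in_geometric _ _ _ c (fun k => - unit_freq i k)) => //.
- by rewrite /unit_freq (negbTE ij) oppr0.
- by apply: bounded_measJ; exact: bounded_meas_szego_factor.
- by move=> x; rewrite characterN character_unit_freq; exact: conjc_szego_factor_rec.
Qed.

Lemma analytic_prod_szego_factor (s : seq 'I_n) w F : polydisc w -> analytic F ->
  analytic (fun x => (\prod_(i <- s) szego_factor i (w i) x) * F x).
Proof.
move=> w1 aF j; elim: s => [|i s IH]; first by under eq_fun do rewrite big_nil mul1r.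
by under eq_fun do rewrite big_cons -mulrA; exact: analytic_in_szego_factor.
Qed.

Lemma analytic_szego w : polydisc w -> analytic (fun x => szego (torus_pt x) w).
Proof.
move=> w1; under eq_fun do rewrite -[szego _ _]mulr1.
exact: analytic_prod_szego_factor analytic1.
Qed.

Lemma cint_szegoM w F : polydisc w -> analytic F ->
  cint (fun x => szego (torus_pt x) w * F x) = cint F.
Proof.
move=> w1 aF; rewrite /szego /index_enum; elim: (Finite.enum _) => [|i s IH].
  by apply: eq_cint => x; rewrite big_nil mul1r.
rewrite -IH; have aG := analytic_prod_szego_factor s w1 aF.
set G := (fun x => (\prod_(i <- s) szego_factor i (w i) x) * F x) in aG *.
have aH := analytic_in_szego_factor i (w1 i) (aG i).
rewrite -[RHS]addr0 -(mulr0 (conjc (w i))) -(cint_coordM_eq0 aH) -cintZ; last first.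
  by apply: bounded_integrableM; [exact: bounded_meas_coord|case: aH].
rewrite -cintD; last 2 first.
- by case: (aG i).
- apply: cintegrableZ => //.
  by apply: bounded_integrableM; [exact: bounded_meas_coord|case: aH].
apply: eq_cint => x; rewrite big_cons -/(szego_factor i (w i) x).
by rewrite -mulrA -/(G x) {1}(szego_factor_rec i x (w1 i)); ring.
Qed.

End analytic_in_variable.

Section szego_evaluation.
Variables (R : realType) (n : nat) (z : 'I_n -> R[i]).
Hypothesis z1 : polydisc z.
Implicit Types (F G : Tn R n -> R[i]) (j : 'I_n).

(* The value at [z] of the analytic extension of [F]. *)
Definition szego_eval F := cint (fun x => F x * conjc (szego (torus_pt x) z)).

Lemma szego_eval_integrable F : torus_integrable F ->
  torus_integrable (fun x => F x * conjc (szego (torus_pt x) z)).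
Proof.
by apply: bounded_integrableMr; apply: bounded_measJ; exact: bounded_meas_szego.
Qed.

Lemma eq_szego_eval F G : F =1 G -> szego_eval F = szego_eval G.
Proof. by move=> /funext ->. Qed.

Lemma szego_evalD F G : torus_integrable F -> torus_integrable G ->
  szego_eval (fun x => F x + G x) = szego_eval F + szego_eval G.
Proof.
move=> Fi Gi; rewrite /szego_eval -cintD; try exact: szego_eval_integrable.
by apply: eq_cint => x; rewrite mulrDl.
Qed.

Lemma szego_evalZ c F : torus_integrable F ->
  szego_eval (fun x => c * F x) = c * szego_eval F.
Proof.
move=> Fi; rewrite /szego_eval -cintZ; last exact: szego_eval_integrable.
by apply: eq_cint => x; rewrite mulrA.
Qed.

Lemma szego_eval1 : szego_eval (fun=> 1) = 1.
Proof.
rewrite /szego_eval; under eq_cint do rewrite mul1r -[szego _ _]mulr1.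
rewrite cintJ; last first.
  apply: bounded_integrable; apply: bounded_measM; last exact: bounded_meas_cst.
  exact: bounded_meas_szego.
by rewrite cint_szegoM ?cint_cst ?conjc1//; exact: analytic1.
Qed.

Lemma szego_eval_coordM j F : analytic_in j F ->
  szego_eval (fun x => torus_pt x j * F x) = z j * szego_eval F.
Proof.
move=> aF.
pose G x := (\prod_(i | i != j) conjc (szego_factor i (z i) x)) * F x.
have aG : analytic_in j G.
  rewrite /G; under eq_fun do rewrite -big_filter.
  have : all (fun i => i != j) [seq i <- index_enum 'I_n | i != j] by exact: filter_all.
  elim: [seq _ <- _ | _] => [_|i s IH /= /andP[ij /IH as']].
    by under eq_fun do rewrite big_nil mul1r.
  by under eq_fun do rewrite big_cons -mulrA; exact: analytic_in_conjc_szego_factor.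
have evalE (x : Tn R n) :
    F x * conjc (szego (torus_pt x) z) = conjc (szego_factor j (z j) x) * G x.
  by rewrite szego_factorE rmorph_prod (bigD1 j)//= /G; ring.
have Gi : torus_integrable G by case: aG.
have factorG : torus_integrable (fun x => conjc (szego_factor j (z j) x) * G x).
  by apply: bounded_integrableM => //; apply: bounded_measJ; exact: bounded_meas_szego_factor.
rewrite {2}/szego_eval; under [in RHS]eq_cint do rewrite evalE.
rewrite -[RHS]add0r -(cint_coordM_eq0 aG) -cintZ// -cintD; last 2 first.
- by apply: bounded_integrableM => //; exact: bounded_meas_coord.
- exact: cintegrableZ.
apply: eq_cint => x; rewrite -mulrA evalE.
rewrite {1}(conjc_szego_factor_rec j x (z1 j)) conjc_torus_pt.
by field; exact: torus_pt_neq0.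
Qed.

Lemma szego_eval_coordB j a F : analytic_in j F ->
  szego_eval (fun x => (torus_pt x j - a) * F x) = (z j - a) * szego_eval F.
Proof.
move=> aF; have Fi : torus_integrable F by case: aF.
under eq_szego_eval do rewrite mulrBl -mulNr.
rewrite szego_evalD.
- by rewrite szego_eval_coordM// szego_evalZ// mulrBl mulNr.
- by apply: bounded_integrableM => //; exact: bounded_meas_coord.
- exact: cintegrableZ.
Qed.

Lemma szego_eval_prod_coordB (I : Type) (s : seq I) (f : I -> 'I_n) (c : I -> R[i]) :
  szego_eval (fun x => \prod_(i <- s) (torus_pt x (f i) - c i)) =
  \prod_(i <- s) (z (f i) - c i).
Proof.
elim: s => [|i s IH].
  by rewrite big_nil; under eq_szego_eval do rewrite big_nil; exact: szego_eval1.
rewrite big_cons -IH; under eq_szego_eval do rewrite big_cons.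
by rewrite szego_eval_coordB//; exact: analytic_prod_coordB.
Qed.

Lemma szego_eval_szego_factorM i c F : normc c < 1 -> analytic_in i F ->
  szego_eval (fun x => szego_factor i c x * F x) = (1 - z i * conjc c)^-1 * szego_eval F.
Proof.
move=> c1 aF; have aG := analytic_in_szego_factor i c1 aF.
have denom0 : 1 - z i * conjc c != 0 by apply: szego_denom_neq0 => //; exact/ltW/z1.
apply: (mulfI denom0); rewrite mulVKf//.
have Gi : torus_integrable (fun x => szego_factor i c x * F x) by case: aG.
have Fi : torus_integrable F by case: aF.
have rec : szego_eval (fun x => szego_factor i c x * F x) = szego_eval F +
    conjc c * szego_eval (fun x => torus_pt x i * (szego_factor i c x * F x)).
  have cGi : torus_integrable (fun x => torus_pt x i * (szego_factor i c x * F x)).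
    by apply: bounded_integrableM => //; exact: bounded_meas_coord.
  rewrite -szego_evalZ// -szego_evalD//; last exact: cintegrableZ.
  by apply: eq_szego_eval => x; rewrite {1}szego_factor_rec//; ring.
by rewrite szego_eval_coordM// in rec; rewrite mulrBl mul1r {1}rec; ring.
Qed.

Lemma szego_eval_szegoM w F : polydisc w -> analytic F ->
  szego_eval (fun x => szego (torus_pt x) w * F x) = szego z w * szego_eval F.
Proof.
move=> w1 aF; rewrite /szego /index_enum; elim: (Finite.enum _) => [|i s IH].
  by rewrite big_nil mul1r; apply: eq_szego_eval => x; rewrite big_nil mul1r.
rewrite big_cons -mulrA -IH; under eq_szego_eval do rewrite big_cons -mulrA.
apply: szego_eval_szego_factorM => //.
exact: analytic_prod_szego_factor.
Qed.

Lemma szego_reproducing w : polydisc w ->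
  szego_eval (fun x => szego (torus_pt x) w) = szego z w.
Proof.
move=> w1; under eq_szego_eval do rewrite -[szego _ _]mulr1.
by rewrite (szego_eval_szegoM w1 (@analytic1 R n)) szego_eval1 mulr1.
Qed.

End szego_evaluation.

(** * The Hardy space, the Gram matrix and the interpolant *)

Section hardy_space.
Variables (R : realType) (n : nat).
Implicit Types (f g h F G : Tn R n -> R[i]).

Lemma H2_analytic F : H2 F -> analytic F.
Proof.
move=> [LF FH] j; split=> [|k kj]; first exact: L2_integrable.
rewrite -(FH (fun i => - k i)); last by exists j; rewrite oppr_lt0.
by apply: eq_cint => x; rewrite characterN conjcK.
Qed.

Lemma analytic_H2 F : L2 F -> analytic F -> H2 F.
Proof.
move=> LF aF; split=> // k [j kj]; have [_ Fk] := aF j.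
rewrite -(Fk (fun i => - k i)); last by rewrite oppr_gt0.
by apply: eq_cint => x; rewrite characterN.
Qed.

Lemma H2D F G : H2 F -> H2 G -> H2 (fun x => F x + G x).
Proof.
move=> hF hG; apply: analytic_H2; first by apply: L2D; [case: hF|case: hG].
by move=> j; apply: analytic_inD; exact: H2_analytic.
Qed.

Lemma H2Z c F : H2 F -> H2 (fun x => c * F x).
Proof.
move=> hF; apply: analytic_H2; first by apply: L2Z; case: hF.
by move=> j; apply: analytic_inZ; exact: H2_analytic.
Qed.

Lemma H2_cst c : H2 (fun _ : Tn R n => c).
Proof.
have H2_1 : H2 (fun _ : Tn R n => 1).
  by apply: analytic_H2; [exact: L2_cst|exact: analytic1].
by have := H2Z c H2_1; under eq_fun do rewrite mulr1.
Qed.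

Lemma H2_szego w : polydisc w -> H2 (fun x : Tn R n => szego (torus_pt x) w).
Proof.
move=> w1; apply: analytic_H2; last exact: analytic_szego.
by apply: bounded_L2; exact: bounded_meas_szego.
Qed.

Lemma inner_linear c f g h : L2 f -> L2 g -> L2 h ->
  inner (fun x => c * f x + g x) h = c * inner f h + inner g h.
Proof.
move=> Lf Lg Lh; have Lhc := L2J Lh.
rewrite /inner -cintZ; last exact: L2_integrableM.
rewrite -cintD; last exact: L2_integrableM; last by apply: cintegrableZ; last exact: L2_integrableM.
by apply: eq_cint => x; rewrite mulrDl mulrA.
Qed.

Lemma inner0l h : inner (fun=> 0) h = 0.
Proof. by rewrite -[RHS](@cint_cst R n); apply: eq_cint => x; rewrite mul0r. Qed.

Lemma fourier_coef0 f : fourier_coef f (fun=> 0) = cint f.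
Proof. by apply: eq_cint => x; rewrite character0 conjc1 mulr1. Qed.

Lemma Mn_linear c f g : Mn f -> Mn g -> Mn (fun x => c * f x + g x).
Proof.
move=> [Lf of_] [Lg og]; split=> [|F G hF hG]; first by apply: L2D => //; exact: L2Z.
rewrite inner_linear// ?of_ ?og// ?mulr0 ?addr0//.
by apply: L2D; [apply: L2J; case: hF|case: hG].
Qed.

Lemma Mn0 : Mn (fun _ : Tn R n => 0).
Proof. by split=> [|F G _ _]; [exact: L2_cst|exact: inner0l]. Qed.

Lemma H2_0_linear c f g : H2_0 f -> H2_0 g -> H2_0 (fun x => c * f x + g x).
Proof.
move=> [hf f0] [hg g0]; split; first by apply: H2D => //; exact: H2Z.
rewrite /fourier_coef inner_linear; [|by case: hf|by case: hg|].
  by move: f0 g0; rewrite /fourier_coef => -> ->; rewrite mulr0 addr0.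
by apply: bounded_L2; exact: bounded_meas_character.
Qed.

Lemma H2_00 : H2_0 (fun _ : Tn R n => 0).
Proof. by split; [exact: H2_cst|exact: inner0l]. Qed.

Lemma Mn_orthogonal_H2 g G : Mn g -> H2 G -> cint (fun x => G x * g x) = 0.
Proof.
move=> [_ og] hG; rewrite -(og G (fun=> 0) hG (H2_cst 0)).
by apply: eq_cint => x; rewrite addr0 conjcK mulrC.
Qed.

Lemma real_orthogonal_Mn g : L2 g -> (forall x, conjc (g x) = g x) ->
  (forall F, H2 F -> cint (fun x => F x * g x) = 0) -> Mn g.
Proof.
move=> Lg gJ og; split=> // F G hF hG.
have gi H : H2 H -> torus_integrable (fun x => H x * g x).
  by move=> [LH _]; exact: L2_integrableM.
transitivity (cint (fun x => F x * g x) + conjc (cint (fun x => G x * g x))).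
  rewrite -cintJ -?cintD; [|exact: gi|exact/cintegrableJ/gi|exact: gi].
  by apply: eq_cint => x; rewrite rmorphD rmorphM /= conjcK gJ; ring.
by rewrite !og// conjc0 addr0.
Qed.

Lemma cint_szegoM_H2_0 v h : polydisc v -> H2_0 h ->
  cint (fun x => szego (torus_pt x) v * h x) = 0.
Proof.
move=> v1 [hh h0]; rewrite cint_szegoM//; last exact: H2_analytic.
by rewrite -fourier_coef0.
Qed.

Section nodes.
Variables (m : nat) (z : 'I_m -> 'I_n -> R[i]).
Hypothesis z1 : forall i, polydisc (z i).
Implicit Types (a c : 'I_m -> R[i]).

Definition szego_comb a (x : Tn R n) : R[i] := \sum_i a i * szego (torus_pt x) (z i).

Lemma szego_integrable i : torus_integrable (fun x : Tn R n => szego (torus_pt x) (z i)).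
Proof. by apply: bounded_integrable; exact: bounded_meas_szego. Qed.

Lemma bounded_meas_szego_comb c : bounded_meas (szego_comb c).
Proof.
apply: bounded_meas_sum => i.
by apply: bounded_measM; [exact: bounded_meas_cst|exact: bounded_meas_szego].
Qed.

Lemma H2_szego_comb c : H2 (szego_comb c).
Proof.
rewrite /szego_comb /index_enum; elim: (Finite.enum _) => [|i s IH].
  by under eq_fun do rewrite big_nil; exact: H2_cst.
under eq_fun do rewrite big_cons.
by apply: H2D => //; apply: H2Z; exact: H2_szego.
Qed.

Lemma szego_eval_szego_comb c w : polydisc w ->
  szego_eval w (szego_comb c) = \sum_i c i * szego w (z i).
Proof.
move=> w1; transitivity (\sum_i szego_eval w (fun x => c i * szego (torus_pt x) (z i))).
  rewrite {2}/szego_eval -cint_sum => [|i].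
    by apply: eq_cint => x; rewrite /szego_comb mulr_suml.
  by apply: szego_eval_integrable => //; apply: cintegrableZ => //; exact: szego_integrable.
apply: eq_bigr => i _; rewrite szego_evalZ ?szego_reproducing//.
exact: szego_integrable.
Qed.

Lemma cint_conjc_szego_comb a F : torus_integrable F ->
  cint (fun x => F x * conjc (szego_comb a x)) = \sum_i conjc (a i) * szego_eval (z i) F.
Proof.
move=> Fi.
have Si i : torus_integrable (fun x => F x * conjc (szego (torus_pt x) (z i))).
  exact: szego_eval_integrable.
transitivity (cint (fun x => \sum_i conjc (a i) * (F x * conjc (szego (torus_pt x) (z i))))).
  apply: eq_cint => x; rewrite rmorph_sum mulr_sumr; apply: eq_bigr => i _.
  by rewrite rmorphM /= mulrCA.
rewrite cint_sum => [|i]; last exact: cintegrableZ.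
by apply: eq_bigr => i _; rewrite cintZ.
Qed.

Lemma MQ_L2 f : MQ z f -> L2 f.
Proof.
move=> [a [g [h [[Lg _] [[Lh _] _] fE]]]].
rewrite (_ : f = (fun x => conjc (szego_comb a x) + g x + h x)); last exact/funext.
apply: L2D => //; apply: L2D => //.
by apply: L2J; apply: bounded_L2; exact: bounded_meas_szego_comb.
Qed.

Lemma cint_mul_MQ G a g h : bounded_meas G -> H2 G ->
  cint (fun x => G x * h x) = 0 -> Mn g -> H2_0 h ->
  cint (fun x => G x * (conjc (szego_comb a x) + g x + h x)) =
  \sum_i conjc (a i) * szego_eval (z i) G.
Proof.
move=> bG hG Gh0 gM [[Lh _] _]; have [Lg _] := gM.
have iG f : L2 f -> torus_integrable (fun x => G x * f x).
  by move=> Lf; apply: bounded_integrableM => //; exact: L2_integrable.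
have La : L2 (fun x => conjc (szego_comb a x)).
  by apply: L2J; apply: bounded_L2; exact: bounded_meas_szego_comb.
under eq_cint do rewrite !mulrDr.
rewrite cintD ?cintD ?Gh0 ?(Mn_orthogonal_H2 gM hG) ?addr0; try exact: iG.
  by apply: cint_conjc_szego_comb; exact: bounded_integrable.
by apply: cintegrableD => //; exact: iG.
Qed.

Lemma MQ_linear (c : R[i]) f g : MQ z f -> MQ z g -> MQ z (fun x => c * f x + g x).
Proof.
move=> [a [k [h [kM hH fE]]]] [b [k' [h' [k'M h'H gE]]]].
exists (fun i => conjc c * a i + b i), (fun x => c * k x + k' x), (fun x => c * h x + h' x).
split; [exact: Mn_linear|exact: H2_0_linear|move=> x].
rewrite fE gE (_ : \sum_(i < m) (conjc c * a i + b i) * szego (torus_pt x) (z i) =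
   conjc c * szego_comb a x + szego_comb b x).
  by rewrite rmorphD rmorphM /= conjcK /szego_comb; ring.
by rewrite /szego_comb mulr_sumr -big_split; apply: eq_bigr => i _ /=; ring.
Qed.

Lemma MQ0 : MQ z (fun _ : Tn R n => 0).
Proof.
exists (fun=> 0), (fun=> 0), (fun=> 0); split; [exact: Mn0|exact: H2_00|move=> x].
by rewrite big1 ?conjc0 ?addr0// => i _; rewrite mul0r.
Qed.

Lemma MQ_szego i : MQ z (fun x => conjc (szego (torus_pt x) (z i))).
Proof.
exists (fun j => (j == i)%:R), (fun=> 0), (fun=> 0).
split; [exact: Mn0|exact: H2_00|move=> x]; rewrite !addr0; congr conjc.
by rewrite (bigD1 i)//= eqxx mul1r big1 ?addr0// => j /negbTE ->; rewrite mul0r.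
Qed.

Hypothesis z_inj : injective z.

Lemma separating_coord i0 i : i != i0 -> exists j, z i0 j != z i j.
Proof.
move=> /eqP ii0; apply/existsP; rewrite -negb_forall; apply/negP => /forallP same.
by apply: ii0; apply: z_inj; apply/funext => j; have /eqP -> := same j.
Qed.

(* A left null vector yields a combination of kernels of norm zero, whose
   pairing with a polynomial vanishing at all nodes but one picks out a
   coefficient. *)
Lemma szego_gram_unit : szego_gram z \in unitmx.
Proof.
rewrite -row_free_unit; apply: inj_row_free => v v0.
pose a i := conjc (v 0 i); pose F := szego_comb a.
have bF : bounded_meas F by exact: bounded_meas_szego_comb.
have evF i : szego_eval (z i) F = 0.
  rewrite szego_eval_szego_comb//.
  transitivity (conjc ((v *m szego_gram z) 0 i)); last by rewrite v0 mxE conjc0.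
  by rewrite mxE rmorph_sum; apply: eq_bigr => j _; rewrite mxE rmorphM /= szegoC.
have FF : cint (fun x => F x * conjc (F x)) = 0.
  rewrite cint_conjc_szego_comb; last exact: bounded_integrable.
  by rewrite big1// => i _; rewrite evF mulr0.
apply/rowP => i0; rewrite mxE.
have /choice[f hf] : forall k : {i | i != i0}, exists j, z i0 j != z (val k) j.
  by move=> k; apply: separating_coord; exact: valP k.
pose p (x : Tn R n) := \prod_(k : {i | i != i0}) (torus_pt x (f k) - z (val k) (f k)).
have bp : bounded_meas p.
  apply: bounded_meas_prod => k.
  by apply: bounded_measB; [exact: bounded_meas_coord|exact: bounded_meas_cst].
have evp i : szego_eval (z i) p = \prod_(k : {i | i != i0}) (z i (f k) - z (val k) (f k)).
  exact: szego_eval_prod_coordB.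
have := cint_normc_sqr_eq0 (bounded_L2 bF) bp.1 FF.
rewrite cint_conjc_szego_comb; last exact: bounded_integrable.
rewrite (bigD1 i0)//= [X in _ + X]big1 ?addr0 => [|i ii0]; last first.
  by rewrite evp (bigD1 (Sub i ii0 : {i | i != i0}))//= subrr mul0r mulr0.
rewrite conjcK evp => /eqP; rewrite mulf_eq0 => /orP[/eqP //|].
by rewrite prodf_seq_eq0 => /hasP[k _ /=]; rewrite subr_eq0 (negbTE (hf k)).
Qed.

Lemma szego_eval_psiZW (w : 'I_m -> R[i]) i : szego_eval (z i) (psiZW z w) = w i.
Proof.
rewrite szego_eval_szego_comb//.
have := congr1 (fun M : 'cV_m => M i 0) (mulKVmx szego_gram_unit (\col_i w i)).
rewrite /= [RHS]mxE mxE => <-; apply: eq_bigr => j _.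
by rewrite [szego_gram z i j]mxE mulrC.
Qed.

Lemma cint_psiZW_MQ (w : 'I_m -> R[i]) a g h : Mn g -> H2_0 h ->
  cint (fun x => psiZW z w x * (conjc (szego_comb a x) + g x + h x)) =
  \sum_i conjc (a i) * w i.
Proof.
move=> gM hH; rewrite cint_mul_MQ//.
- by apply: eq_bigr => i _; rewrite szego_eval_psiZW.
- exact: bounded_meas_szego_comb.
- exact: H2_szego_comb.
have hi : torus_integrable h by apply: L2_integrable; case: hH => [[]].
have Shi i : torus_integrable (fun x => szego (torus_pt x) (z i) * h x).
  by apply: bounded_integrableM => //; exact: bounded_meas_szego.
rewrite /psiZW; under eq_cint do rewrite mulr_suml.
rewrite cint_sum => [|i]; last by under eq_fun do rewrite -mulrA; exact: cintegrableZ.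
rewrite big1// => i _; under eq_cint do rewrite -mulrA.
by rewrite cintZ// cint_szegoM_H2_0// mulr0.
Qed.

End nodes.
End hardy_space.

(** * Interpolation implies contractivity *)

Section sup_norm.
Variables (R : realType) (n : nat).
Implicit Types (d h : 'I_n -> R[i]).

Definition sup_normc h : R := \big[Num.max/0]_(k < n) normc (h k).

Lemma sup_normc_ge0 h : 0 <= sup_normc h.
Proof. exact: bigmax_ge_id. Qed.

Lemma ler_sup_normc h k : normc (h k) <= sup_normc h.
Proof. exact: (le_bigmax_cond 0 (fun k => normc (h k))). Qed.

Lemma sup_normc_lt h (c : R) : 0 < c -> (forall k, normc (h k) < c) -> sup_normc h < c.
Proof. by move=> c0 hc; apply: bigmax_lt. Qed.

Lemma normc_linear_le d h :
  normc (\sum_(k < n) d k * h k) <= (\sum_(k < n) normc (d k)) * sup_normc h.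
Proof.
rewrite (le_trans (ler_normc_sum _))// mulr_suml ler_sum// => k _.
by rewrite Normc.normcM ler_wpM2l ?normc_ge0// ler_sup_normc.
Qed.

Lemma near_ptws_normc (a : {ptws 'I_n -> R[i]}) (r : R) : 0 < r ->
  \forall b \near a, forall k, normc (b k - a k) < r.
Proof.
move=> r0; have FF : Filter (nbhs a) by exact: nbhs_filter.
have near_coord k : \forall b \near a, normc (b k - a k) < r.
  have cv : b k @[b --> a] --> a k by exact: (@proj_continuous 'I_n (fun=> R[i]) k a).
  have := iffLR (cvgc_normcP FF _ _) cv r r0; apply: filterS => b.
  by rewrite normc_distC.
exact: (filter_forall FF near_coord).
Qed.

End sup_norm.

Section dilation.
Variables (R : realType) (n : nat).
Implicit Types (phi : ('I_n -> R[i]) -> R[i]) (a : 'I_n -> R[i]).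

Lemma holomorphic_continuous phi a : holomorphic_polydisc phi -> polydisc a ->
  {for (a : {ptws 'I_n -> R[i]}), continuous (phi : {ptws 'I_n -> R[i]} -> R[i])}.
Proof.
move=> hphi a1; have [d hd] := hphi a a1; have [delta d0 hdelta] := hd 1 ltr01.
pose K : R := 1 + \sum_k normc (d k).
have K0 : 0 < K by rewrite ltr_pwDl// sumr_ge0// => k _; exact: normc_ge0.
have FF : Filter (nbhs (a : {ptws 'I_n -> R[i]})) by exact: nbhs_filter.
apply/(cvgc_normcP FF) => e e0.
have eK0 : 0 < e / K by rewrite divr_gt0.
apply: filterS2 (near_ptws_normc a d0) (near_ptws_normc a eK0) => b b_delta b_eK.
have := hdelta (fun k => b k - a k) b_delta; rewrite mul1r.
rewrite (_ : (fun k => a k + (b k - a k)) = b); last first.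
  by apply/funext => k; rewrite addrC subrK.
move=> taylor; rewrite normc_distC.
rewrite -(subrK (\sum_(k < n) d k * (b k - a k)) (phi b - phi a)).
rewrite (le_lt_trans (le_normcD _ _))//.
rewrite (le_lt_trans (lerD taylor (normc_linear_le d (fun k => b k - a k))))//.
rewrite -/(sup_normc (fun k => b k - a k)) -[X in X + _]mul1r -mulrDl -/K mulrC -ltr_pdivlMr//.
exact: sup_normc_lt.
Qed.

Definition dilate (r : R) a : 'I_n -> R[i] := fun k => r%:C%C * a k.

Lemma szego_dilate (r : R) (x y : 'I_n -> R[i]) :
  szego (dilate r x) y = szego x (dilate r y).
Proof.
by apply: eq_bigr => k _; rewrite /dilate rmorphM /= oppr0 mulrCA mulrA.
Qed.

Lemma cvg_dilate (T : Type) (F : set_system T) (FF : Filter F) (r : T -> R) (s : R)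
    (u : T -> 'I_n -> R[i]) a :
  r t @[t --> F] --> s -> u t @[t --> F] --> (a : {ptws 'I_n -> R[i]}) ->
  dilate (r t) (u t) @[t --> F] --> (dilate s a : {ptws 'I_n -> R[i]}).
Proof.
move=> rs /cvg_ptwsP ua; apply/cvg_ptwsP => k.
by apply: cvgM; [exact: cvg_real_complex|exact: ua].
Qed.

Lemma dilate1 a : dilate 1 a = a.
Proof. by apply/funext => k; rewrite /dilate mul1r. Qed.

Variable r : R.
Hypothesis r01 : 0 < r < 1.

Lemma normc_dilate a k : normc (dilate r a k) = r * normc (a k).
Proof.
by case/andP: r01 => r0 _; rewrite Normc.normcM normc_real ger0_norm// ltW.
Qed.

Lemma polydisc_dilate a : closed_polydisc a -> polydisc (dilate r a).
Proof.
case/andP: r01 => r0 r1 a1 k; rewrite normc_dilate (le_lt_trans _ r1)//.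
by rewrite ler_piMr// ltW.
Qed.

Lemma dilate_set_coord a k s :
  dilate r (set_coord a k (a k + s)) =
  (fun j => dilate r a j + set_coord (fun=> 0) k (r%:C%C * s) j).
Proof.
apply/funext => j; rewrite /dilate /set_coord; case: eqP => [->|_]; first by rewrite mulrDr.
by rewrite addr0.
Qed.

Lemma set_coord_id a k : set_coord a k (a k) = a.
Proof. by apply/funext => j; rewrite /set_coord; case: eqP => [->|]. Qed.

Lemma complex_derivable_dilate phi a k : holomorphic_polydisc phi -> closed_polydisc a ->
  complex_derivable (fun s => phi (dilate r (set_coord a k s))) (a k).
Proof.
move=> hphi a1; have [d hd] := hphi _ (polydisc_dilate a1).
exists (d k * r%:C%C) => e e0; have [delta d0 hdelta] := hd e e0.
exists delta => // s hs; have [r0 r1] := andP r01.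
have rs_le : normc (r%:C%C * s) <= normc s.
  by rewrite Normc.normcM normc_real (ger0_norm (ltW r0)) ler_piMl ?normc_ge0// ltW.
pose h := set_coord (fun=> 0) k (r%:C%C * s).
have h_le j : normc (h j) <= normc s.
  by rewrite /h /set_coord; case: eqP => // _; rewrite Normc.normc0 normc_ge0.
have -> : d k * r%:C%C * s = \sum_(j < n) d j * h j.
  rewrite (bigD1 k)//= big1 ?addr0 /h /set_coord ?eqxx ?mulrA// => j /negbTE ->.
  by rewrite mulr0.
rewrite dilate_set_coord set_coord_id.
apply: (le_trans (hdelta h (fun j => le_lt_trans (h_le j) hs))).
rewrite ler_wpM2l ?(ltW e0)//; apply: bigmax_le; first exact: normc_ge0.
by move=> j _; exact: h_le.
Qed.

Lemma continuous_dilate (F : {ptws 'I_n -> R[i]} -> R[i]) a :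
  {for (dilate r a : {ptws 'I_n -> R[i]}), continuous F} ->
  {for (a : {ptws 'I_n -> R[i]}), continuous (fun b : {ptws 'I_n -> R[i]} => F (dilate r b))}.
Proof.
move=> cF; have FF : Filter (nbhs (a : {ptws 'I_n -> R[i]})) by exact: nbhs_filter.
exact: (cvg_comp _ _ (cvg_dilate FF (@cvg_cst _ r _ _ _) cvg_id) cF).
Qed.

Lemma bounded_meas_dilate (F : {ptws 'I_n -> R[i]} -> R[i]) : polydisc_algebra F ->
  bounded_meas (fun x : Tn R n => F (dilate r (torus_pt x))).
Proof.
move=> [cF _ [M FM]]; have closed_dilate a (a1 : closed_polydisc a) :=
  polydisc_closed (polydisc_dilate a1).
split; last by exists M => x; apply/FM/closed_dilate/closed_polydisc_torus.
apply: (cmeas_torus_comp (F := fun a => F (dilate r a))) => a a1.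
exact/continuous_dilate/cF/closed_dilate.
Qed.

Lemma polydisc_algebra_dilate phi : schur_class phi ->
  polydisc_algebra (fun a : {ptws 'I_n -> R[i]} => phi (dilate r a)).
Proof.
move=> [hphi phi_le]; split=> [a a1|a k a1|].
- exact/continuous_dilate/holomorphic_continuous/polydisc_dilate.
- exact: complex_derivable_dilate.
- by exists 1 => a a1; apply: phi_le; exact: polydisc_dilate.
Qed.

Lemma cmeas_szego_dilate : cmeas setT (fun p : Tn R n * Tn R n =>
  szego (torus_pt p.1) (dilate r (torus_pt p.2))).
Proof.
have mpt k : cmeas setT (fun x : Tn R n => torus_pt x k) by case: (bounded_meas_coord R k).
apply: cmeas_prod => k; apply: cmeasV; apply: cmeasB; first exact: cmeas_cst.
apply: cmeasM; first by apply: (cmeas_comp (mpt k)); exact: measurable_fst.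
apply: cmeasJ; apply: cmeasM; first exact: cmeas_cst.
by apply: (cmeas_comp (mpt k)); exact: measurable_snd.
Qed.

Lemma normc_szego_dilate_le (x y : Tn R n) :
  normc (szego (torus_pt x) (dilate r (torus_pt y))) <= (1 - r)^-1 ^+ n.
Proof.
case/andP: r01 => _ r1; apply: normc_szego_le => //; first exact: closed_polydisc_torus.
by move=> k; rewrite normc_dilate normc_torus_pt mulr1.
Qed.

(* By Cauchy's formula [F (r x)] is the integral of [F(y) S(x, r y)] in [y]; then Fubini. *)
Lemma cint_dilateM_swap (F : {ptws 'I_n -> R[i]} -> R[i]) (f : Tn R n -> R[i]) :
  polydisc_algebra F -> torus_integrable f ->
  cint (fun x => F (dilate r (torus_pt x)) * f x) =
  cint (fun y => F (torus_pt y) *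
    cint (fun x => szego (torus_pt x) (dilate r (torus_pt y)) * f x)).
Proof.
move=> aF fi; have bF := polydisc_algebra_bounded_meas aF; have [mF [M FM]] := bF.
have dilate_polydisc (x : Tn R n) := polydisc_dilate (closed_polydisc_torus x).
pose kernel (p : Tn R n * Tn R n) :=
  F (torus_pt p.2) * szego (torus_pt p.1) (dilate r (torus_pt p.2)).
have mkernel : cmeas setT kernel.
  by apply: cmeasM cmeas_szego_dilate; apply: (cmeas_comp mF); exact: measurable_snd.
have kernel_le p : normc (kernel p) <= M * (1 - r)^-1 ^+ n.
  by rewrite Normc.normcM ler_pM ?normc_ge0// normc_szego_dilate_le.
have joint_integrable : cintegrable (torus_mu R n \x torus_mu R n)%E setT
    (fun p => kernel p * f p.1).
  apply: (cintegrable_boundedM _ mkernel (M := M * (1 - r)^-1 ^+ n)) => //.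
  exact: cintegrable_fst.
have row_bounded x : bounded_meas (fun y => kernel (x, y)).
  split; last by exists (M * (1 - r)^-1 ^+ n) => y; exact: kernel_le.
  by apply: (cmeas_comp mkernel (h := fun y => (x, y))); exact: measurable_pair1.
have col_integrable y :
    torus_integrable (fun x => szego (torus_pt x) (dilate r (torus_pt y)) * f x).
  by apply: bounded_integrableM => //; exact: bounded_meas_szego.
transitivity (cintegral (torus_mu R n \x torus_mu R n)%E setT (fun p => kernel p * f p.1)).
  rewrite cintegral12// => [|x]; last first.
    apply: bounded_integrable.
    exact: (bounded_measM (row_bounded x) (@bounded_meas_cst R n (f x))).
  apply: eq_cint => x; rewrite -(cauchy_polydisc aF (dilate_polydisc x)) mulrC.
  rewrite -cintZ; last by apply: szego_eval_integrable => //; exact: bounded_integrable.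
  by apply: eq_cint => y; rewrite /kernel /= szegoC szego_dilate mulrC.
rewrite cintegral21// => [|y]; last first.
  by under eq_fun do rewrite /kernel/= -mulrA; exact: cintegrableZ.
apply: eq_cint => y; rewrite -cintZ//.
by apply: eq_cint => x; rewrite mulrA.
Qed.

End dilation.

Section interpolation_contraction.
Variables (R : realType) (n m : nat) (z : 'I_m -> 'I_n -> R[i]).
Hypothesis z1 : forall i, polydisc (z i).
Implicit Types (phi : ('I_n -> R[i]) -> R[i]) (a : 'I_m -> R[i]) (f g h : Tn R n -> R[i]).

Lemma cint_szego_MQ v a g h : polydisc v -> Mn g -> H2_0 h ->
  cint (fun x => szego (torus_pt x) v * (conjc (szego_comb z a x) + g x + h x)) =
  \sum_i conjc (a i) * szego (z i) v.
Proof.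
move=> v1 gM hH; rewrite cint_mul_MQ//; last exact: cint_szegoM_H2_0.
- by apply: eq_bigr => i _; rewrite szego_reproducing.
- exact: bounded_meas_szego.
- exact: H2_szego.
Qed.

Lemma cint_dilateM_MQ (F : {ptws 'I_n -> R[i]} -> R[i]) (r : R) a g h :
  polydisc_algebra F -> 0 < r < 1 -> Mn g -> H2_0 h ->
  cint (fun x => F (dilate r (torus_pt x)) * (conjc (szego_comb z a x) + g x + h x)) =
  \sum_i conjc (a i) * F (dilate r (z i)).
Proof.
move=> aF r01 gM hH; have bF := polydisc_algebra_bounded_meas aF.
have fi : torus_integrable (fun x => conjc (szego_comb z a x) + g x + h x).
  by apply/L2_integrable/(MQ_L2 z1); exists a, g, h.
rewrite cint_dilateM_swap//.
have zr i := polydisc_dilate r01 (polydisc_closed (z1 i)).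
have evi i : torus_integrable
    (fun y => F (torus_pt y) * conjc (szego (torus_pt y) (dilate r (z i)))).
  by apply: szego_eval_integrable => //; exact: bounded_integrable.
transitivity (cint (fun y => \sum_i conjc (a i) *
    (F (torus_pt y) * conjc (szego (torus_pt y) (dilate r (z i)))))).
  apply: eq_cint => y; rewrite cint_szego_MQ//; last first.
    exact: polydisc_dilate (closed_polydisc_torus y).
  rewrite mulr_sumr; apply: eq_bigr => i _.
  by rewrite szegoC szego_dilate mulrCA.
rewrite cint_sum => [|i]; last exact: cintegrableZ.
by apply: eq_bigr => i _; rewrite cintZ// cauchy_polydisc.
Qed.

Lemma dilated_interpolation_bound phi (r : R) a g h : schur_class phi -> 0 < r < 1 ->
  Mn g -> H2_0 h ->
  normc (\sum_i conjc (a i) * phi (dilate r (dilate r (z i)))) <=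
  \int[torus_mu R n]_x normc (conjc (szego_comb z a x) + g x + h x).
Proof.
move=> phiS r01 gM hH; have aphi := polydisc_algebra_dilate r01 phiS.
have fi : torus_integrable (fun x => conjc (szego_comb z a x) + g x + h x).
  by apply/L2_integrable/(MQ_L2 z1); exists a, g, h.
have bphi := bounded_meas_dilate r01 aphi.
have pfi := bounded_integrableM bphi fi.
rewrite -(cint_dilateM_MQ _ aphi r01 gM hH) (le_trans (normc_cint pfi))//.
apply: le_Rintegral => //; try exact: integrable_normc.
move=> x _; rewrite Normc.normcM ler_piMl ?normc_ge0//; apply: phiS.2.
apply: (polydisc_dilate r01); apply: polydisc_closed.
exact: polydisc_dilate (closed_polydisc_torus x).
Qed.

Lemma cvg_dilate_twice phi v : holomorphic_polydisc phi -> polydisc v ->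
  phi (dilate r (dilate r v)) @[r --> 1^'-] --> phi v.
Proof.
move=> hphi v1; have cr : r @[r --> (1 : R)^'-] --> (1 : R).
  by apply: cvg_at_left_filter; exact: cvg_id.
have FF : Filter (1 : R)^'- by exact: filter_filter.
have cv := cvg_dilate FF cr (cvg_dilate FF cr (@cvg_cst {ptws 'I_n -> R[i]} v _ _ FF)).
rewrite !dilate1 in cv.
exact: (cvg_comp _ _ cv (holomorphic_continuous hphi v1)).
Qed.

Lemma interpolation_contraction phi (w : 'I_m -> R[i]) : injective z ->
  schur_class phi -> (forall i, phi (z i) = w i) ->
  contraction_on (MQ z) (fun f => cint (fun x => psiZW z w x * f x)).
Proof.
move=> z_inj phiS phiw f fMQ; rewrite (L1normE (L2_integrable (MQ_L2 z1 fMQ))) lee_fin.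
case: fMQ => [a [g [h [gM hH /funext ->]]]].
rewrite (cint_psiZW_MQ z1 z_inj w a gM hH).
have cv : \sum_i conjc (a i) * phi (dilate r (dilate r (z i))) @[r --> 1^'-] -->
    \sum_i conjc (a i) * w i.
  apply: cvg_big => [|i _]; first exact: add_continuous.
  apply: cvgMr; rewrite -phiw.
  by apply: cvg_dilate_twice => //; case: phiS.
apply: (normc_lim_le _ cv); near=> r.
apply: dilated_interpolation_bound => //; apply/andP; split.
  by near: r; exact: nbhs_left_gt.
by near: r; exact: nbhs_left_lt.
Unshelve. all: by end_near. Qed.

End interpolation_contraction.

(** * The Hahn-Banach theorem *)

Section linear_subsets.
Variables (K : pzRingType) (V : lmodType K) (D : set V).

Definition linear_set := D 0 /\ forall c u v, D u -> D v -> D (c *: u + v).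

Definition linear_on (f : V -> K) :=
  forall c u v, D u -> D v -> f (c *: u + v) = c * f u + f v.

Hypothesis linD : linear_set.

Lemma linear_setZ c u : D u -> D (c *: u).
Proof. by move=> Du; have [D0 DL] := linD; have := DL c u 0 Du D0; rewrite addr0. Qed.

Lemma linear_setD u v : D u -> D v -> D (u + v).
Proof. by move=> Du Dv; have [_ DL] := linD; have := DL 1 u v Du Dv; rewrite scale1r. Qed.

Lemma linear_setB u v : D u -> D v -> D (u - v).
Proof. by move=> Du Dv; have [_ DL] := linD; have := DL (-1) v u Dv Du; rewrite scaleN1r addrC. Qed.

Lemma linear_set_sum (I : Type) (s : seq I) (c : I -> K) (u : I -> V) :
  (forall i, D (u i)) -> D (\sum_(i <- s) c i *: u i).
Proof.
move=> Du; elim: s => [|i s IH]; first by rewrite big_nil; exact: linD.1.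
by rewrite big_cons; apply: linD.2.
Qed.

Variable f : V -> K.
Hypothesis linf : linear_on f.

Lemma linear_onD u v : D u -> D v -> f (u + v) = f u + f v.
Proof. by move=> Du Dv; have := linf 1 Du Dv; rewrite scale1r mul1r. Qed.

Lemma linear_on0 : f 0 = 0.
Proof.
have [D0 _] := linD; have := linear_onD D0 D0; rewrite addr0 => /esym/eqP.
by rewrite -subr_eq0 addrK => /eqP.
Qed.

Lemma linear_onZ c u : D u -> f (c *: u) = c * f u.
Proof.
by move=> Du; have [D0 _] := linD; have := linf c Du D0; rewrite linear_on0 !addr0.
Qed.

Lemma linear_onB u v : D u -> D v -> f (u - v) = f u - f v.
Proof.
by move=> Du Dv; rewrite addrC -scaleN1r linf// mulN1r addrC.
Qed.

Lemma linear_on_sum (I : Type) (s : seq I) (c : I -> K) (u : I -> V) :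
  (forall i, D (u i)) -> f (\sum_(i <- s) c i *: u i) = \sum_(i <- s) c i * f (u i).
Proof.
move=> Du; elim: s => [|i s IH]; first by rewrite !big_nil linear_on0.
by rewrite !big_cons linf ?IH//; exact: linear_set_sum.
Qed.

End linear_subsets.

Section real_hahn_banach.
Variables (R : realType) (V : lmodType R) (D : set V) (p : V -> R).
Implicit Types (u v : V) (r s : R) (G : set (V * R^o)).
Hypothesis linD : linear_set D.
Hypothesis pD : forall u v, D u -> D v -> p (u + v) <= p u + p v.
Hypothesis pZ : forall r u, 0 < r -> D u -> p (r *: u) = r * p u.

Definition dominated_graph G :=
  linear_set G /\ forall u s, G (u, s) -> D u /\ s <= p u.

Definition extend_graph G v s : set (V * R^o) :=
  [set x | exists r y, G y /\ x = r *: (v, s : R^o) + y].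

Lemma extend_graph_sub G v s : G `<=` extend_graph G v s.
Proof. by move=> x Gx; exists 0, x; rewrite scale0r add0r. Qed.

Lemma extend_graph_self G v s : linear_set G -> extend_graph G v s (v, s).
Proof. by move=> [G0 _]; exists 1, 0; rewrite scale1r addr0. Qed.

Lemma extend_graph_linear G v s : linear_set G -> linear_set (extend_graph G v s).
Proof.
move=> linG; split; first by apply: extend_graph_sub; exact: linG.1.
move=> c _ _ [r [x [Gx ->]]] [t [y [Gy ->]]]; exists (c * r + t), (c *: x + y).
split; first exact: linG.2.
by rewrite scalerDr scalerA addrACA -scalerDl.
Qed.

Lemma extension_value G v : dominated_graph G -> D v -> exists s,
  forall u t, G (u, t) -> t - p (u - v) <= s /\ s + t <= p (u + v).
Proof.
move=> [linG domG] Dv.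
pose lower : set R := [set t | exists u s, G (u, s) /\ t = s - p (u - v)].
have lower_le u s : G (u, s) -> ubound lower (p (u + v) - s).
  move=> Gu _ [u' [s' [Gu' ->]]]; have [Du _] := domG _ _ Gu; have [Du' _] := domG _ _ Gu'.
  have sum_le : s' + s <= p (u' + u) by have [] := domG _ _ (linear_setD linG Gu' Gu).
  have := pD (linear_setB linD Du' Dv) (linear_setD linD Du Dv).
  rewrite (_ : u' - v + (u + v) = u' + u); last by rewrite addrACA addNr addr0.
  lra.
exists (sup lower) => u t Gu; split.
  by apply: ub_le_sup; [exists (p (u + v) - t); exact: lower_le|exists u, t].
by rewrite -lerBrDr; apply: ge_sup; [exists (t - p (u - v)), u, t|exact: lower_le].
Qed.

Lemma dominated_graph_extend G v : dominated_graph G -> D v ->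
  exists s, dominated_graph (extend_graph G v s).
Proof.
move=> domG Dv; have [s sP] := extension_value domG Dv; exists s.
have [linG Gp] := domG; split; first exact: extend_graph_linear.
move=> _ _ [r [[u t] [Gu [-> ->]]]]; have [Du ut] := Gp _ _ Gu.
split; first exact: linD.2.
have [r0|r0|->] := ltrgtP r 0; last first.
- by rewrite !scale0r !add0r.
- have Gr := linear_setZ linG r^-1 Gu; have [Dr _] := Gp _ _ Gr.
  have [_] := sP _ _ Gr; rewrite -(ler_pM2l r0) -pZ//; last exact: linear_setD.
  by rewrite scalerDr scalerA mulrDr mulrA divff ?gt_eqF// scale1r mul1r addrC [_ + u]addrC.
- have t0 : 0 < - r by rewrite oppr_gt0.
  have Gr := linear_setZ linG (- r)^-1 Gu; have [Dr _] := Gp _ _ Gr.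
  have [+ _] := sP _ _ Gr; rewrite -(ler_pM2l t0) mulrBr -pZ//; last exact: linear_setB.
  rewrite scalerBr scalerA mulrA divff ?gt_eqF// scale1r mul1r scaleNr opprK mulNr.
  by rewrite [u + _]addrC /=; set q := p _ => h; rewrite -[r *: _]/(r * s); lra.
Qed.

Variables (M : set V) (f : V -> R).
Hypothesis linM : linear_set M.
Hypothesis MD : M `<=` D.
Hypothesis linf : linear_on M f.
Hypothesis fp : forall u, M u -> f u <= p u.

Definition graph_on : set (V * R^o) := [set x | M x.1 /\ x.2 = f x.1].

Lemma dominated_graph_on : dominated_graph graph_on.
Proof.
split=> [|u s [/= Mu ->]]; last by split; [exact: MD|exact: fp].
split; first by split; [exact: linM.1|rewrite (linear_on0 linM linf)].
move=> c [u s] [v t] [/= Mu ->] [/= Mv ->]; split; first exact: linM.2.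
by rewrite /= linf.
Qed.

Lemma maximal_dominated_graph : exists G, [/\ dominated_graph G, graph_on `<=` G &
  forall G', dominated_graph G' -> G `<=` G' -> G' `<=` G].
Proof.
have [|A [domA maxA]] :=
    @Zorn_bigcup (V * R^o)%type [set X | dominated_graph (graph_on `|` X)].
  move=> F FP tot.
  have in_one x y : (graph_on `|` \bigcup_(X in F) X) x ->
      (graph_on `|` \bigcup_(X in F) X) y ->
      exists X, [/\ dominated_graph X, X `<=` graph_on `|` \bigcup_(X in F) X, X x & X y].
    have sub X : F X -> graph_on `|` X `<=` graph_on `|` \bigcup_(X in F) X.
      by move=> FX a [|Xa]; [left|right; exists X].
    move=> [gx|[X FX Xx]] [gy|[Y FY Yy]].
    - by exists graph_on; split=> [||//|//]; [exact: dominated_graph_on|move=> a; left].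
    - by exists (graph_on `|` Y); split; [exact: FP|exact: sub|left|right].
    - by exists (graph_on `|` X); split; [exact: FP|exact: sub|right|left].
    - have [XY|YX] := tot _ _ FX FY.
        by exists (graph_on `|` Y); split; [exact: FP|exact: sub|right; exact: XY|right].
      by exists (graph_on `|` X); split; [exact: FP|exact: sub|right|right; exact: YX].
  split; first split.
  - by left; have [[]] := dominated_graph_on.
  - move=> c x y Ux Uy; have [X [[[_ linX] _] subX Xx Xy]] := in_one x y Ux Uy.
    by apply: subX; exact: linX.
  - by move=> u s Uus; have [X [[_ domX] _ Xus _]] := in_one _ _ Uus Uus; exact: domX.
exists (graph_on `|` A); split=> // G' domG' sub x G'x.
apply: contrapT => nx; apply: (maxA G'); last first.
  rewrite /= (_ : graph_on `|` G' = G')//; apply/seteqP; split=> y; last by right.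
  by case=> // gy; apply: sub; left.
split; first by move=> y Ay; apply: sub; right.
by move=> G'A; apply: nx; right; exact: G'A.
Qed.

Theorem real_hahn_banach : exists L : V -> R,
  [/\ linear_on D L, forall u, D u -> L u <= p u & forall u, M u -> L u = f u].
Proof.
have [G [domG graphG maxG]] := maximal_dominated_graph; have [linG Gp] := domG.
have total v : exists s, D v -> G (v, s).
  have [Dv|nDv] := pselect (D v); last by exists 0.
  have [s dom_ext] := dominated_graph_extend domG Dv; exists s => _.
  by apply: (maxG _ dom_ext (@extend_graph_sub _ _ _)); exact: extend_graph_self.
have p0 : p 0 = 0.
  have [D0 _] := linD; have := pZ (ltr0n _ 2) D0; rewrite scaler0; lra.
have unique u s t : G (u, s) -> G (u, t) -> s = t.
  suff le s' t' : G (u, s') -> G (u, t') -> s' <= t'.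
    by move=> Gs Gt; apply/le_anti; rewrite !le.
  move=> Gs Gt; have [_] := Gp _ _ (linear_setB linG Gs Gt).
  by rewrite subrr p0 subr_le0.
have /choice[L GL] := total; exists L; split.
- move=> c u v Du Dv; apply: (@unique (c *: u + v)); first by apply: GL; exact: linD.2.
  exact: (linG.2 c _ _ (GL _ Du) (GL _ Dv)).
- by move=> u Du; have [] := Gp _ _ (GL _ Du).
- by move=> u Mu; apply: (@unique u); [exact/GL/MD|exact: graphG].
Qed.

End real_hahn_banach.

Definition restrict_scalars (R : realType) (V : lmodType R[i]) : Type := V.

Section restriction_of_scalars.
Variables (R : realType) (V : lmodType R[i]).
Local Notation W := (restrict_scalars V).

HB.instance Definition _ := GRing.Zmodule.on W.

Definition real_scale (r : R) (v : W) : W := r%:C%C *: (v : V).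

Lemma real_scaleA r s v : real_scale r (real_scale s v) = real_scale (r * s) v.
Proof. by rewrite /real_scale scalerA -rmorphM. Qed.

Lemma real_scale1 : left_id 1 real_scale.
Proof. by move=> v; rewrite /real_scale rmorph1 scale1r. Qed.

Lemma real_scaleDr : right_distributive real_scale +%R.
Proof. by move=> r u v; rewrite /real_scale scalerDr. Qed.

Lemma real_scaleDl v : {morph real_scale^~ v : r s / r + s}.
Proof. by move=> r s; rewrite /real_scale rmorphD scalerDl. Qed.

HB.instance Definition _ := GRing.Zmodule_isLmodule.Build R W
  real_scaleA real_scale1 real_scaleDr real_scaleDl.

End restriction_of_scalars.

Section complex_hahn_banach.
Variables (R : realType) (V : lmodType R[i]) (D M : set V) (p : V -> R) (f : V -> R[i]).
Hypothesis linD : linear_set D.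
Hypothesis pD : forall u v, D u -> D v -> p (u + v) <= p u + p v.
Hypothesis pZ : forall c u, D u -> p (c *: u) = normc c * p u.
Hypothesis linM : linear_set M.
Hypothesis MD : M `<=` D.
Hypothesis linf : linear_on M f.
Hypothesis fp : forall u, M u -> normc (f u) <= p u.

Lemma real_part_extension : exists U : restrict_scalars V -> R,
  [/\ linear_on (D : set (restrict_scalars V)) U, forall u, D u -> U u <= p u &
      forall u, M u -> U u = cRe (f u)].
Proof.
have real_linear (A : set V) : linear_set A -> linear_set (A : set (restrict_scalars V)).
  by move=> [A0 AL]; split=> // r u v; exact: AL.
apply: real_hahn_banach => //; try exact: real_linear.
- by move=> r u r0 Du; rewrite pZ// normc_real gtr0_norm.
- by move=> r u v Mu Mv; rewrite linf// cReD cReM /= mul0r subr0.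
- move=> u Mu; rewrite (le_trans (ler_norm _))// (le_trans (ler_norm_Re _))//.
  exact: fp.
Qed.

(* A complex functional is recovered from its real part: [L v = U v - i U (i v)]. *)
Theorem complex_hahn_banach : exists L : V -> R[i],
  [/\ linear_on D L, forall u, D u -> normc (L u) <= p u & forall u, M u -> L u = f u].
Proof.
have [U [linU Up Uf]] := real_part_extension; pose ii : R[i] := Complex 0 1.
have linW : linear_set (D : set (restrict_scalars V)).
  by split=> [|r u v]; [exact: linD.1|exact: linD.2].
have UD u v : D u -> D v -> U (u + v) = U u + U v.
  exact: (@linear_onD _ (restrict_scalars V) _ U linU).
have UZ (r : R) u : D u -> U (r%:C%C *: u) = r * U u.
  exact: (@linear_onZ _ (restrict_scalars V) _ linW U linU).
have DZ c u : D u -> D (c *: u) by exact: linear_setZ.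
have UC (c : R[i]) u : D u -> U (c *: u) = cRe c * U u + cIm c * U (ii *: u).
  move=> Du; have cE : c = (cRe c)%:C%C + (cIm c)%:C%C * ii.
    by apply: complexP; rewrite ?cReD ?cImD ?cReM ?cImM /=; ring.
  by rewrite {1}cE scalerDl -scalerA UD ?UZ ?UZ//; [exact/DZ|exact/DZ|exact/DZ/DZ].
pose L v := Complex (U v) (- U (ii *: v)).
have linL : linear_on D L.
  move=> c u v Du Dv; have Dcu := DZ c u Du.
  have U_ic : U (ii *: (c *: u)) = - cIm c * U u + cRe c * U (ii *: u).
    by rewrite scalerA (UC (ii * c))// cReM cImM /=; ring.
  apply: complexP; rewrite ?cReD ?cImD ?cReM ?cImM /=.
    by rewrite UD// (UC c)//; ring.
  by rewrite scalerDr UD ?U_ic; [ring|exact: DZ|exact: DZ].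
exists L; split=> // u => [Du|Mu].
  have [a a1 aL] := normc_phase (L u).
  have -> : normc (L u) = U (a *: u).
    by have := congr1 (@complex.Re R) aL; rewrite -(linear_onZ linD linL)// => ->.
  by rewrite (le_trans (Up _ (DZ _ _ Du)))// pZ// a1 mul1r.
apply: complexP => /=; rewrite Uf//; last exact: linear_setZ.
by rewrite (linear_onZ linM linf)// cReM /=; ring.
Qed.

End complex_hahn_banach.

(** * Contractivity implies interpolation *)

Section uniform_taylor.
Variables (R : realType) (n : nat) (X : Type).
Implicit Types (f g : X -> ('I_n -> R[i]) -> R[i]) (d : 'I_n -> X -> R[i]) (v h : 'I_n -> R[i]).

Definition translate v h : 'I_n -> R[i] := fun k => v k + h k.

Definition taylor_remainder f d v h x :=
  f x (translate v h) - f x v - \sum_(k < n) d k x * h k.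

Definition uniform_taylor f d v := exists C delta : R, [/\ 0 <= C, 0 < delta &
  forall h, sup_normc h < delta ->
    forall x, normc (taylor_remainder f d v h x) <= C * sup_normc h ^+ 2].

Lemma uniform_taylor_cst (c : R[i]) v : uniform_taylor (fun _ _ => c) (fun _ _ => 0) v.
Proof.
exists 0, 1; split=> // h _ x; rewrite /taylor_remainder subrr sub0r big1 => [|k _].
  by rewrite oppr0 Normc.normc0 mul0r.
by rewrite mul0r.
Qed.

Lemma uniform_taylor_increment f d v : uniform_taylor f d v ->
  (forall k, exists N : R, forall x, normc (d k x) <= N) ->
  exists K delta : R, [/\ 0 <= K, 0 < delta & forall h, sup_normc h < delta ->
    forall x, normc (f x (translate v h) - f x v) <= K * sup_normc h].
Proof.
move=> [C [delta [C0 delta0 fC]]] /choice[N dN].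
exists (C + \sum_(k < n) `|N k|), (Num.min delta 1); split.
- by rewrite addr_ge0// sumr_ge0.
- by rewrite lt_min delta0 /=.
move=> h; rewrite lt_min => /andP[h_delta h1] x; have h0 := sup_normc_ge0 h.
rewrite -(subrK (\sum_(k < n) d k x * h k) (f x (translate v h) - f x v)).
rewrite (le_trans (le_normcD _ _))// mulrDl lerD//.
  rewrite (le_trans (fC h h_delta x))// expr2 mulrA ler_piMr ?mulr_ge0//.
  exact: ltW.
rewrite (le_trans (normc_linear_le _ _))// ler_wpM2r// ler_sum// => k _.
exact: le_trans (dN k x) (ler_norm _).
Qed.

Lemma uniform_taylorM f g d d' v : uniform_taylor f d v -> uniform_taylor g d' v ->
  (exists M : R, forall x, normc (f x v) <= M) -> (exists N : R, forall x, normc (g x v) <= N) ->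
  (forall k, exists M : R, forall x, normc (d k x) <= M) ->
  (forall k, exists N : R, forall x, normc (d' k x) <= N) ->
  uniform_taylor (fun x u => f x u * g x u) (fun k x => d k x * g x v + f x v * d' k x) v.
Proof.
move=> Tf Tg [M fM] [N gN] dM d'N.
have [K1 [r1 [K10 r10 incf]]] := uniform_taylor_increment Tf dM.
have [K2 [r2 [K20 r20 incg]]] := uniform_taylor_increment Tg d'N.
have [C1 [s1 [C10 s10 fC]]] := Tf; have [C2 [s2 [C20 s20 gC]]] := Tg.
exists (C1 * `|N| + `|M| * C2 + K1 * K2), (Num.min (Num.min r1 r2) (Num.min s1 s2)); split.
- by rewrite !addr_ge0 ?mulr_ge0.
- by rewrite !lt_min r10 r20 s10.
move=> h; rewrite !lt_min => /andP[/andP[h1 h2] /andP[h3 h4]] x.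
have h0 := sup_normc_ge0 h.
have fM' : normc (f x v) <= `|M| by exact: le_trans (fM x) (ler_norm M).
have gN' : normc (g x v) <= `|N| by exact: le_trans (gN x) (ler_norm N).
have -> : taylor_remainder (fun x u => f x u * g x u)
      (fun k x => d k x * g x v + f x v * d' k x) v h x =
    taylor_remainder f d v h x * g x v + f x v * taylor_remainder g d' v h x +
    (f x (translate v h) - f x v) * (g x (translate v h) - g x v).
  rewrite /taylor_remainder (_ : \sum_(k < n) (_ + _) * h k =
      (\sum_(k < n) d k x * h k) * g x v + f x v * \sum_(k < n) d' k x * h k); last first.
    by rewrite mulr_suml mulr_sumr -big_split; apply: eq_bigr => k _ /=; ring.
  by ring.
set H := sup_normc h in h0 *.
have -> : (C1 * `|N| + `|M| * C2 + K1 * K2) * H ^+ 2 =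
    C1 * H ^+ 2 * `|N| + `|M| * (C2 * H ^+ 2) + K1 * H * (K2 * H) by ring.
rewrite (le_trans (le_normcD _ _))// lerD//.
  rewrite (le_trans (le_normcD _ _))// lerD// Normc.normcM ler_pM ?normc_ge0//.
    exact: fC.
  exact: gC.
by rewrite Normc.normcM ler_pM ?normc_ge0//; [exact: incf|exact: incg].
Qed.

End uniform_taylor.

Section szego_taylor.
Variables (R : realType) (n : nat).
Implicit Types (v h : 'I_n -> R[i]) (x : Tn R n).

Definition szego_factor_derivative i (c : R[i]) (k : 'I_n) x :=
  if k == i then conjc (szego_factor i c x) ^+ 2 * conjc (torus_pt x i) else 0.

Lemma bounded_meas_szego_factor_derivative i c k : normc c < 1 ->
  bounded_meas (szego_factor_derivative i c k).
Proof.
move=> c1; rewrite /szego_factor_derivative; case: eqP => _; last exact: bounded_meas_cst.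
have bf : bounded_meas (fun x => conjc (szego_factor i c x)).
  by apply: bounded_measJ; exact: bounded_meas_szego_factor.
apply: bounded_measM; first by under eq_fun do rewrite expr2; exact: bounded_measM.
by apply: bounded_measJ; exact: bounded_meas_coord.
Qed.

Lemma conjc_szego_factorE i c x :
  conjc (szego_factor i c x) = (1 - c * conjc (torus_pt x i))^-1.
Proof. by rewrite conjc_inv1B conjcK mulrC. Qed.

Lemma uniform_taylor_szego_factor i v : polydisc v ->
  uniform_taylor (fun x u => conjc (szego_factor i (u i) x)) (szego_factor_derivative i (v i)) v.
Proof.
move=> v1; pose m := 1 - normc (v i); have m0 : 0 < m by rewrite subr_gt0.
have K0 : 0 <= 2 * m^-1 ^+ 3 by rewrite mulr_ge0 ?exprn_ge0 ?invr_ge0// ltW.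
exists (2 * m^-1 ^+ 3), (m / 2); split=> // [|h hm x]; first by rewrite divr_gt0.
pose p := 1 - v i * conjc (torus_pt x i); pose q := h i * conjc (torus_pt x i).
have x1 : normc (conjc (torus_pt x i)) = 1 by rewrite normcJ normc_torus_pt.
have qE : normc q = normc (h i) by rewrite Normc.normcM x1 mulr1.
have -> : taylor_remainder (fun x u => conjc (szego_factor i (u i) x))
    (szego_factor_derivative i (v i)) v h x = (p - q)^-1 - p^-1 - p^-1 ^+ 2 * q.
  rewrite /taylor_remainder (bigD1 i)//= big1 => [|k /negbTE ki]; last first.
    by rewrite /szego_factor_derivative ki mul0r.
  rewrite /szego_factor_derivative eqxx !conjc_szego_factorE /translate addr0 -/p.
  rewrite (_ : 1 - (v i + h i) * _ = p - q); last by rewrite /p /q; ring.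
  by rewrite /q; ring.
have hi := ler_sup_normc h i.
have pm : m <= normc p by apply: cauchy_denom_ge; rewrite x1.
have qm : normc q <= m / 2 by rewrite qE; exact/ltW/(le_lt_trans hi).
rewrite (le_trans (normc_inv_taylor m0 pm qm))// qE.
by rewrite ler_wpM2l ?lerXn2r ?nnegrE ?normc_ge0 ?sup_normc_ge0.
Qed.

Lemma uniform_taylor_szego v : polydisc v -> exists2 d : 'I_n -> Tn R n -> R[i],
  (forall k, bounded_meas (d k)) & uniform_taylor (fun x u => conjc (szego (torus_pt x) u)) d v.
Proof.
move=> v1.
rewrite (_ : (fun x u => _) = (fun x u => \prod_i conjc (szego_factor i (u i) x))); last first.
  by apply/funext => x; apply/funext => u; rewrite szego_factorE rmorph_prod.
rewrite /index_enum; elim: (Finite.enum _) => [|i s [d bd Td]].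
  exists (fun _ _ => 0) => [k|]; first exact: bounded_meas_cst.
  under eq_fun do under eq_fun do rewrite big_nil.
  exact: uniform_taylor_cst.
pose f x := conjc (szego_factor i (v i) x).
pose g x := \prod_(j <- s) conjc (szego_factor j (v j) x).
have bfac j : bounded_meas (fun x => conjc (szego_factor j (v j) x)).
  by apply: bounded_measJ; exact: bounded_meas_szego_factor.
have bg : bounded_meas g by exact: bounded_meas_prod.
have bd' k := bounded_meas_szego_factor_derivative i k (v1 i).
exists (fun k x => szego_factor_derivative i (v i) k x * g x + f x * d k x) => [k|].
  exact: bounded_measD (bounded_measM (bd' k) bg) (bounded_measM (bfac i) (bd k)).
under eq_fun do under eq_fun do rewrite big_cons.
apply: uniform_taylorM => //; [exact: uniform_taylor_szego_factor|exact: (bfac i).2|exact: bg.2| |].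
  by move=> k; exact: (bd' k).2.
by move=> k; exact: (bd k).2.
Qed.

End szego_taylor.

Section poisson_kernel.
Variables (R : realType) (n : nat) (v : 'I_n -> R[i]).
Hypothesis v1 : polydisc v.
Local Notation mu := (torus_mu R n).

Definition poisson (x : Tn R n) : R[i] :=
  (szego v v)^-1 * (szego (torus_pt x) v * conjc (szego (torus_pt x) v)).

Lemma szego_diag_neq0 : szego v v != 0.
Proof.
by apply/prodf_neq0 => k _; rewrite invr_neq0// szego_denom_neq0// ltW.
Qed.

Lemma poisson_real x : conjc (poisson x) = poisson x.
Proof.
rewrite /poisson rmorphM /= conjc_inv (szegoC v v) rmorphM /= conjcK.
by rewrite [_ * szego _ v]mulrC.
Qed.

Lemma poisson_ge0 x : 0 <= cRe (poisson x).
Proof.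
rewrite /poisson -normc_sqr_mulJ cReM /= mulr0 subr0 mulr_ge0 ?sqr_ge0//.
rewrite /szego prodfV invrK (_ : \prod_k _ = (\prod_k (1 - normc (v k) ^+ 2))%:C%C).
  by rewrite prodr_ge0// => k _; rewrite subr_ge0 expr_le1 ?normc_ge0// ltW.
by rewrite rmorph_prod; apply: eq_bigr => k _; rewrite -normc_sqr_mulJ rmorphB rmorph1.
Qed.

Lemma normc_poisson x : normc (poisson x) = cRe (poisson x).
Proof.
have im0 : cIm (poisson x) = 0.
  by have /(congr1 (@complex.Im R)) := poisson_real x; rewrite cImJ; lra.
by rewrite normc_sqrtE im0 expr0n addr0 sqrtr_sqr ger0_norm ?poisson_ge0.
Qed.

Lemma bounded_meas_poisson : bounded_meas poisson.
Proof.
apply: bounded_measM; first exact: bounded_meas_cst.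
by apply: bounded_measM; [|apply: bounded_measJ]; exact: bounded_meas_szego.
Qed.

Lemma cint_poisson F : H2 F -> cint (fun x => F x * poisson x) = szego_eval v F.
Proof.
move=> hF; have aF := H2_analytic hF.
have Fi : torus_integrable F by apply: L2_integrable; case: hF.
have SFi : torus_integrable (fun x => szego (torus_pt x) v * F x).
  by apply: bounded_integrableM => //; exact: bounded_meas_szego.
rewrite -[RHS](mulKf szego_diag_neq0) -szego_eval_szegoM//.
rewrite /szego_eval -cintZ; last exact: szego_eval_integrable.
by apply: eq_cint => x; rewrite /poisson; ring.
Qed.

Lemma Rintegral_normc_poisson : \int[mu]_x normc (poisson x) = 1.
Proof.
have /(congr1 (@complex.Re R)) := cint_poisson (H2_cst n 1).
rewrite szego_eval1// => /= <-; apply: eq_Rintegral => x _.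
by rewrite normc_poisson mul1r.
Qed.

Definition poisson_defect (x : Tn R n) : R[i] :=
  poisson x - szego (torus_pt x) v - conjc (szego (torus_pt x) v) + 1.

Lemma cint_poisson_defect F : H2 F -> cint (fun x => F x * poisson_defect x) = 0.
Proof.
move=> hF; have Fi : torus_integrable F by apply: L2_integrable; case: hF.
have Pi : torus_integrable (fun x => F x * poisson x).
  by apply: bounded_integrableMr => //; exact: bounded_meas_poisson.
have Si : torus_integrable (fun x => szego (torus_pt x) v * F x).
  by apply: bounded_integrableM => //; exact: bounded_meas_szego.
have Ei := szego_eval_integrable v1 Fi.
transitivity (cint (fun x => F x * poisson x) -
    cint (fun x => szego (torus_pt x) v * F x) - szego_eval v F + cint F).
  rewrite /szego_eval -cintB -?cintB -?cintD//; last 2 first.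
  - by apply: cintegrableB => //; exact: cintegrableB.
  - exact: cintegrableB.
  by apply: eq_cint => x; rewrite /poisson_defect; ring.
rewrite cint_poisson// cint_szegoM//; last exact: H2_analytic.
by ring.
Qed.

Lemma Mn_poisson_defect : Mn poisson_defect.
Proof.
apply: real_orthogonal_Mn cint_poisson_defect.
  apply: bounded_L2; apply: bounded_measD; last exact: bounded_meas_cst.
  apply: bounded_measB; last by apply: bounded_measJ; exact: bounded_meas_szego.
  by apply: bounded_measB; [exact: bounded_meas_poisson|exact: bounded_meas_szego].
move=> x; rewrite /poisson_defect rmorphD !rmorphB rmorph1 /= conjcK poisson_real.
by ring.
Qed.

Lemma H2_0_szegoB1 : H2_0 (fun x => szego (torus_pt x) v - 1).
Proof.
have hS := H2_szego v1; split; first by apply: H2D => //; exact: H2_cst.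
rewrite fourier_coef0 cintB ?cint_cst; last 2 first.
- by apply: bounded_integrable; exact: bounded_meas_szego.
- by apply: bounded_integrable; exact: bounded_meas_cst.
under eq_cint do rewrite -[szego _ _]mulr1.
by rewrite cint_szegoM ?cint_cst ?subrr//; exact: analytic1.
Qed.

Lemma MQ_poisson m (z : 'I_m -> 'I_n -> R[i]) :
  MQ z (fun x => poisson x - conjc (szego (torus_pt x) v)).
Proof.
exists (fun=> 0), poisson_defect, (fun x => szego (torus_pt x) v - 1).
split; [exact: Mn_poisson_defect|exact: H2_0_szegoB1|move=> x].
rewrite big1 => [|i _]; last by rewrite mul0r.
by rewrite conjc0 /poisson_defect; ring.
Qed.

End poisson_kernel.

Section contractive_functional.
Variables (R : realType) (n : nat).
Local Notation mu := (torus_mu R n).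

Lemma L2_linear_set : linear_set (@L2 R n).
Proof. by split=> [|c f g Lf Lg]; [exact: L2_cst|apply: L2D => //; exact: L2Z]. Qed.

Variable L : (Tn R n -> R[i]) -> R[i].
Hypothesis linL : linear_on (@L2 R n) L.
Hypothesis L_le : forall f, L2 f -> normc (L f) <= \int[mu]_x normc (f x).

Lemma normc_functional_le f (M : R) : bounded_meas f -> (forall x, normc (f x) <= M) ->
  normc (L f) <= M.
Proof.
move=> bf fM; rewrite (le_trans (L_le (bounded_L2 bf)))// -[leRHS](@Rintegral_torus_cst R n).
apply: le_Rintegral => //.
- by apply: integrable_normc => //; exact: bounded_integrable.
- by apply: integrable_finite_cst => //; exact: torus_mu_lty.
Qed.

Lemma functional_taylor_remainder (f : Tn R n -> ('I_n -> R[i]) -> R[i]) d v h :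
  L2 (f^~ v) -> L2 (f^~ (translate v h)) -> (forall k, L2 (d k)) ->
  L (taylor_remainder f d v h) =
  L (f^~ (translate v h)) - L (f^~ v) - \sum_(k < n) L (d k) * h k.
Proof.
move=> Lv Lvh Ld.
rewrite (_ : taylor_remainder f d v h =
    (f^~ (translate v h)) - (f^~ v) - \sum_(k < n) h k *: d k); last first.
  apply/funext => x; rewrite /taylor_remainder !fctE fct_sumE; congr (_ - _).
  by apply: eq_bigr => k _; rewrite mulrC.
have LB := linear_setB L2_linear_set Lvh Lv.
have Lsum := linear_set_sum L2_linear_set (index_enum 'I_n) h Ld.
rewrite (linear_onB linL LB Lsum) (linear_onB linL Lvh Lv).
rewrite (linear_on_sum L2_linear_set linL)//; congr (_ - _).
by apply: eq_bigr => k _; rewrite mulrC.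
Qed.

Lemma holomorphic_functional (f : Tn R n -> ('I_n -> R[i]) -> R[i]) :
  (forall v, cmeas setT (f^~ v)) -> (forall v, polydisc v -> bounded_meas (f^~ v)) ->
  (forall v, polydisc v ->
     exists2 d, forall k, bounded_meas (d k) & uniform_taylor f d v) ->
  holomorphic_polydisc (fun v => L (f^~ v)).
Proof.
move=> mf bf Tf v v1; have [d bd [C [delta [C0 delta0 taylor]]]] := Tf v v1.
have Ce (e : R) : 0 < e -> 0 < e / (C + 1) by move=> e0; rewrite divr_gt0 ?ltr_wpDl.
exists (fun k => L (d k)) => e e0; exists (Num.min delta (e / (C + 1))) => [|h].
  by rewrite lt_min delta0 Ce.
move=> /sup_normc_lt; rewrite lt_min delta0 Ce// => /(_ isT); rewrite lt_min.
move=> /andP[h_delta h_e]; have {}taylor := taylor h h_delta.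
have br : bounded_meas (taylor_remainder f d v h).
  split; last by exists (C * sup_normc h ^+ 2).
  apply: cmeasB; first exact: cmeasB.
  by apply: cmeas_sum => k; apply: cmeasM; [exact: (bd k).1|exact: cmeas_cst].
have btranslate : bounded_meas (f^~ (translate v h)).
  rewrite (_ : f^~ _ = fun x =>
      taylor_remainder f d v h x + (f x v + \sum_(k < n) d k x * h k)); last first.
    by apply/funext => x; rewrite /taylor_remainder; ring.
  apply: bounded_measD => //; apply: bounded_measD; first exact: bf.
  by apply: bounded_meas_sum => k; apply: bounded_measM => //; exact: bounded_meas_cst.
rewrite -functional_taylor_remainder; last 3 first.
- exact/bounded_L2/bf.
- exact: bounded_L2.
- by move=> k; exact: bounded_L2.
rewrite (le_trans (normc_functional_le br taylor))// expr2 mulrA.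
rewrite ler_wpM2r ?sup_normc_ge0//; move/ltW: h_e; rewrite ler_pdivlMr ?ltr_wpDl//.
by apply: le_trans; rewrite mulrC ler_wpM2l ?sup_normc_ge0// lerDl.
Qed.

Local Notation interpolant := (fun v => L (fun x => conjc (szego (torus_pt x) v))).

Lemma holomorphic_szego_functional : holomorphic_polydisc interpolant.
Proof.
apply: (@holomorphic_functional (fun x v => conjc (szego (torus_pt x) v))) => v.
- by apply: cmeasJ; exact: cmeas_szego.
- by move=> v1; apply: bounded_measJ; exact: bounded_meas_szego.
- exact: uniform_taylor_szego.
Qed.

(* [L] cannot tell the kernel from the Poisson kernel, which has norm one. *)
Lemma normc_szego_functional_le v : polydisc v ->
  L (fun x => poisson v x - conjc (szego (torus_pt x) v)) = 0 -> normc (interpolant v) <= 1.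
Proof.
move=> v1 L0; have bP := bounded_meas_poisson v1.
have bS : bounded_meas (fun x : Tn R n => conjc (szego (torus_pt x) v)).
  by apply: bounded_measJ; exact: bounded_meas_szego.
have LB := linear_onB linL (bounded_L2 bP) (bounded_L2 bS).
have -> : interpolant v = L (poisson v).
  by apply/eqP; rewrite eq_sym -subr_eq0 -LB; exact/eqP.
by rewrite (le_trans (L_le (bounded_L2 bP)))// Rintegral_normc_poisson.
Qed.

End contractive_functional.

Section contraction_interpolation.
Variables (R : realType) (n m : nat) (z : 'I_m -> 'I_n -> R[i]) (w : 'I_m -> R[i]).
Hypotheses (z_inj : injective z) (z1 : forall i, polydisc (z i)).
Local Notation mu := (torus_mu R n).
Local Notation psi := (psiZW z w).

Lemma MQ_linear_set : linear_set (MQ z).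
Proof. by split=> [|c f g]; [exact: MQ0|exact: MQ_linear]. Qed.

Lemma psiZW_integrableM f : L2 f -> torus_integrable (fun x => psi x * f x).
Proof.
move=> Lf; apply: bounded_integrableM; last exact: L2_integrable.
exact: bounded_meas_szego_comb.
Qed.

Lemma linear_on_psiZW : linear_on (MQ z) (fun f => cint (fun x => psi x * f x)).
Proof.
move=> c f g Mf Mg; have fi := psiZW_integrableM (MQ_L2 z1 Mf).
have gi := psiZW_integrableM (MQ_L2 z1 Mg).
rewrite -cintZ// -cintD//; last exact: cintegrableZ.
by apply: eq_cint => x; rewrite mulrDr mulrCA.
Qed.

Hypothesis contr : contraction_on (MQ z) (fun f => cint (fun x => psi x * f x)).

Lemma contractive_extension : exists L : (Tn R n -> R[i]) -> R[i],
  [/\ linear_on (@L2 R n) L, forall f, L2 f -> normc (L f) <= \int[mu]_x normc (f x) &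
      forall f, MQ z f -> L f = cint (fun x => psi x * f x)].
Proof.
apply: (complex_hahn_banach (L2_linear_set R n) _ _ MQ_linear_set (MQ_L2 z1)
  linear_on_psiZW).
- by move=> f g Lf Lg; apply: Rintegral_normcD => //; exact: L2_integrable.
- by move=> c f Lf; apply: Rintegral_normcZ => //; exact: L2_integrable.
by move=> f Mf; rewrite -lee_fin -L1normE; [exact: contr|exact/L2_integrable/(MQ_L2 z1)].
Qed.

Lemma contraction_interpolation :
  exists phi : ('I_n -> R[i]) -> R[i], schur_class phi /\ forall i, phi (z i) = w i.
Proof.
have [L [linL L_le L_MQ]] := contractive_extension.
exists (fun v => L (fun x => conjc (szego (torus_pt x) v))); split; last first.
  by move=> i; rewrite L_MQ; [exact: szego_eval_psiZW|exact: MQ_szego].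
split=> [|v v1]; first exact: holomorphic_szego_functional.
apply: normc_szego_functional_le => //; rewrite (L_MQ _ (MQ_poisson v1 z)).
under eq_cint do rewrite mulrBr.
have bP := bounded_meas_poisson v1; have bS := bounded_measJ (bounded_meas_szego v1).
rewrite cintB; [|exact/psiZW_integrableM/bounded_L2|exact/psiZW_integrableM/bounded_L2].
by rewrite cint_poisson ?subrr//; exact: H2_szego_comb.
Qed.

End contraction_interpolation.

Theorem theorem6p6 (R : realType) (n m : nat) (hn : (1 <= n)%N)
  (z : 'I_m -> 'I_n -> R[i]) (w : 'I_m -> R[i]) :
  injective z -> (forall i, polydisc (z i)) -> (forall i, normc (w i) < 1) ->
  (exists phi : ('I_n -> R[i]) -> R[i], schur_class phi /\ forall i, phi (z i) = w i) <->
  contraction_on (MQ z) (fun f => cint (fun x => psiZW z w x * f x)).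
Proof.
move=> z_inj z1 _; split; last exact: contraction_interpolation.
by move=> [phi [phiS phiw]]; exact: interpolation_contraction phiS phiw.
Qed.
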